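(* Let $V_6=Q\cap F\subset\mathbb{P}^5$ be a prime Fano threefold of genus $4$, where $Q\subset \mathbb{P}^5$ is a quadric hypersurface and $F\subset\mathbb{P}^5$ is a cubic hypersurface. Then: (1) If $\mathrm{rk}(Q)=6$, then on $V_6$ there lie two $\mathbb{P}^3$-families of plane cubics, cut out on $V_6$ by the elements of the two $\mathbb{P}^3$-families of planes on $Q$; moreover, if $V_6$ is general, then the general element of each of these two families is a smooth plane cubic curve. (2) If $\mathrm{rk}(Q)=5$, then on $V_6$ there lies one $\mathbb{P}^3$-family of plane cubics, cut out on $V_6$ by the elements of the unique $\mathbb{P}^3$-family of planes on $Q$; moreover, if $V_6$ is general, then the general plane cubic on $V_6$ is a smooth plane cubic curve.
   Context: We work over $\mathbb{C}$. A prime Fano threefold is a smooth projective threefold $V$ with $-K_V$ ample and $\mathrm{Pic}(V)=\mathbb{Z}[-K_V]$; its genus $g$ is defined by $(-K_V)^3=2g-2$. A prime Fano threefold $V_6$ of genus $4$ is a smooth complete intersection in $\mathbb{P}^5$ of a quadric $Q$ (uniquely determined by $V_6$, of rank $5$ or $6$) and a cubic $F$. If $\mathrm{rk}(Q)=6$, then $Q\cong Gr(2,4)$ carries two families of planes, each parameterized by $\mathbb{P}^3$; if $\mathrm{rk}(Q)=5$, then $Q$ is a cone with vertex a point over a smooth $3$-dimensional quadric and carries one family of planes, parameterized by $\mathbb{P}^3$. A $\mathbb{P}^3$-family is a family parameterized by $\mathbb{P}^3$. A plane cubic on $V_6$ is a 1-cycle of degree $3$ of the form $V_6\cap\mathbb{P}^2$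 for a plane $\mathbb{P}^2\subset Q$ (possibly reducible or non-reduced). *)

(* Defs.v *)
From HB Require Import structures.
From mathcomp Require Import all_boot all_order all_algebra.
From mathcomp Require Import mpoly.

Set Implicit Arguments.
Unset Strict Implicit.
Unset Printing Implicit Defensive.

Import GRing.Theory.

Local Open Scope ring_scope.

(* A point of P^(n-1) is a nonzero row vector of 'rV[K]_n, up to scaling.     *)
(* A plane of P^5 is the row space of a row-free matrix A : 'M[K]_(3, 6); the *)
(* rows of A give homogeneous coordinates y_0, y_1, y_2 on it.                *)
(* A hypersurface is given by its homogeneous equation.                       *)

Section PlaneCubics.
Variable K : numClosedFieldType.

(* Zariski topology on a subset L of an affine space, L being given as a type *)
(* T of objects, a predicate on T and a coordinate map. A sequence U of       *)
(* polynomials stands for the open set where they do not all vanish. Since    *)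
(* the principal opens form a basis, it is enough to test density on them.    *)
(* For a subset of a projective space we use the affine cone over it (without *)
(* the origin): for properties which are invariant under scaling, "general"   *)
(* has the same meaning on both.                                              *)

Definition in_open (N : nat) (U : seq {mpoly K[N]}) (x : 'I_N -> K) : bool :=
  has (fun G : {mpoly K[N]} => G.@[x] != 0) U.

Definition dense_open (T : Type) (N : nat) (coord : T -> 'I_N -> K)
    (L : T -> Prop) (U : seq {mpoly K[N]}) : Prop :=
  forall H : {mpoly K[N]},
    (exists x, L x /\ H.@[coord x] != 0) ->
    exists x, [/\ L x, H.@[coord x] != 0 & in_open U (coord x)].

Definition general_element (T : Type) (N : nat) (coord : T -> 'I_N -> K)
    (L P : T -> Prop) : Prop :=
  exists U : seq {mpoly K[N]},
    dense_open coord L U /\ forall x, L x -> in_open U (coord x) -> P x.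

(* Jacobian criterion: q = f = 0 is smooth of codimension 2 at each point.    *)

Definition grad (n : nat) (p : {mpoly K[n]}) (x : 'rV[K]_n) : 'rV[K]_n :=
  \row_i (p^`M(i)).@[x 0].

Definition prime_Fano_genus4 (q f : {mpoly K[6]}) : Prop :=
  [/\ q \is 2.-homog, f \is 3.-homog &
      forall x : 'rV[K]_6, x != 0 -> q.@[x 0] = 0 -> f.@[x 0] = 0 ->
        row_free (col_mx (grad q x) (grad f x))].

(* The second derivatives of a quadratic form are the entries of twice its    *)
(* Gram matrix.                                                               *)

Definition quadric_rank (q : {mpoly K[6]}) : nat :=
  \rank (\matrix_(i < 6, j < 6) (q^`M(i)^`M(j))@_0%MM).

(* The coefficients of a pair (quadratic form, cubic form).                   *)

Definition coef_index : finType := ('X_{1..6 < 3} + 'X_{1..6 < 4})%type.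

Definition coefs (qf : {mpoly K[6]} * {mpoly K[6]}) (i : 'I_#|coef_index|) : K :=
  match enum_val i with
  | inl m => qf.1@_m
  | inr m => qf.2@_m
  end.

Definition Fano_of_rank (r : nat) (qf : {mpoly K[6]} * {mpoly K[6]}) : Prop :=
  prime_Fano_genus4 qf.1 qf.2 /\ quadric_rank qf.1 = r.

(* The restriction of a form to the plane A, in the coordinates y.            *)

Definition restrict (p : {mpoly K[6]}) (A : 'M[K]_(3, 6)) : {mpoly K[3]} :=
  p \mPo [tuple \sum_(j < 3) A j i *: 'X_j | i < 6].

Definition plane_on (q : {mpoly K[6]}) (A : 'M[K]_(3, 6)) : Prop :=
  row_free A /\ restrict q A = 0.

(* The scheme V :&: A is the zero scheme in the plane A of the nonzero form c *)
(* of degree 3. Its 1-cycle is then the divisor of c, i.e. \sum_k m_k [c_k=0] *)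
(* if c = \prod_k c_k ^+ m_k with the c_k irreducible and pairwise coprime;   *)
(* it has degree \sum_k m_k * deg c_k = 3.                                    *)

Definition cuts_cubic (q f : {mpoly K[6]}) (A : 'M[K]_(3, 6))
    (c : {mpoly K[3]}) : Prop :=
  [/\ c \is 3.-homog, c != 0 &
      forall h : {mpoly K[3]},
        (exists a b, h = a * restrict q A + b * restrict f A) <->
        (exists a, h = a * c)].

Definition plane_cubic (q f : {mpoly K[6]}) (A : 'M[K]_(3, 6)) : Prop :=
  plane_on q A /\ exists c, cuts_cubic q f A c.

Definition smooth_curve (c : {mpoly K[3]}) : Prop :=
  forall y : 'rV[K]_3, y != 0 -> c.@[y 0] = 0 -> grad c y != 0.

Definition smooth_plane_cubic (q f : {mpoly K[6]}) (A : 'M[K]_(3, 6)) : Prop :=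
  plane_on q A /\ exists c, cuts_cubic q f A c /\ smooth_curve c.

(* A morphism from P^3 to the Grassmannian of planes in P^5 is given, in      *)
(* Pluecker coordinates, by forms of the same degree without common zero.     *)
(* The Pluecker coordinates of A are its 3 x 3 minors, here listed with       *)
(* redundancy, one for each map s from rows to columns.                       *)

Definition pluecker_forms := {ffun 'I_3 -> 'I_6} -> {mpoly K[4]}.

(* A is the plane with parameter t.                                           *)

Definition plane_at (Phi : pluecker_forms) (t : 'rV[K]_4)
    (A : 'M[K]_(3, 6)) : Prop :=
  row_free A /\ exists c : K, c != 0 /\
    forall s : {ffun 'I_3 -> 'I_6}, \det (colsub s A) = c * (Phi s).@[t 0].

(* The morphism is required to be an isomorphism of P^3 onto its image, i.e.  *)
(* injective with injective differentials. By Euler's formula the latter      *)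
(* amounts to injectivity of the differentials of the lift to affine cones.   *)

Definition P3_family_of_planes (Phi : pluecker_forms) : Prop :=
  [/\ exists d : nat, forall s, Phi s \is d.-homog,
      forall t, t != 0 -> exists A, plane_at Phi t A,
      forall t t' A, t != 0 -> t' != 0 ->
        plane_at Phi t A -> plane_at Phi t' A -> exists c : K, t' = c *: t &
      forall t v : 'rV[K]_4, t != 0 ->
        (forall s, \sum_(i < 4) v 0 i * ((Phi s)^`M(i)).@[t 0] = 0) -> v = 0].

Definition belongs_to (Phi : pluecker_forms) (A : 'M[K]_(3, 6)) : Prop :=
  exists t, t != 0 /\ plane_at Phi t A.

Definition unique_P3_family (q : {mpoly K[6]}) (Phi : pluecker_forms) : Prop :=
  P3_family_of_planes Phi /\ forall A, plane_on q A <-> belongs_to Phi A.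

Definition two_P3_families (q : {mpoly K[6]})
    (Phi1 Phi2 : pluecker_forms) : Prop :=
  [/\ P3_family_of_planes Phi1, P3_family_of_planes Phi2,
      forall A, plane_on q A <-> (belongs_to Phi1 A \/ belongs_to Phi2 A) &
      forall A, ~ (belongs_to Phi1 A /\ belongs_to Phi2 A)].

Definition cuts_plane_cubics (q f : {mpoly K[6]}) (Phi : pluecker_forms) : Prop :=
  forall t A, t != 0 -> plane_at Phi t A -> plane_cubic q f A.

Definition general_cubic_smooth (q f : {mpoly K[6]})
    (Phi : pluecker_forms) : Prop :=
  general_element (fun (t : 'rV[K]_4) => t 0) (fun t => t != 0)
    (fun t => forall A, plane_at Phi t A -> smooth_plane_cubic q f A).

End PlaneCubics.

(* Main.v *)
Require Import Defs.
From HB Require Import structures.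
From mathcomp Require Import all_boot all_order all_algebra.
From mathcomp Require Import mpoly complex reals.
From mathcomp Require Import boolp classical_sets filter.
From mathcomp Require Import ring.

(** The assertions hold for every smooth threefold, so that no genericity has to
    be imposed on it: only the plane in the family is general.

    The planes of the quadric. A quadratic form of rank six or five is brought
    to a normal form by a change of coordinates ([congruent_same_rank]). In rank
    six the quadric is the Grassmannian of lines of [P^3], and a plane on it is a
    set of lines which pairwise meet, hence consists of the lines through a point
    or of the lines in a plane. The point or plane is found as a kernel in a
    half-spin representation of the Clifford algebra ([isotropic_plane]). The
    Pluecker coordinates of either family are the second Veronese embedding
    followed by an injective linear map ([family_P3]), and the images of the two
    linear maps are complementary ([Psi6_separated]). In rank five the
    planes are the joins of the vertex with the lines of a hyperplane section of
    the smooth quadric, and each such line lies on exactly one plane of each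
    family of the latter; one of these two families therefore parameterizes the
    planes of the cone ([cone_family]).

    The plane cubics. A plane of the quadric cuts out a cubic curve as soon as
    the cubic form does not vanish on it. In rank five the plane contains the
    vertex, which is not on the threefold by smoothness ([cone_restrict_neq0]).
    In rank six, if the cubic form vanishes on the plane, then the comparison of
    the two differentials along the plane gives a quadratic map from [K^3] to
    itself. It has an eigenvector, by a resultant computation
    ([exists_eigenvector]), and the corresponding point would be singular
    ([smooth_quadric_restrict_neq0]).

    Smoothness of the general cubic. The incidence variety of pairs of a
    parameter and a point of the threefold on the corresponding plane is smooth,
    because the planes of a family move every point of the quadric other than
    the vertex in all directions of the quadric ([wedge_chart_submersive],
    [cone_chart_submersive]). Generic smoothness of its projection to [P^3] is
    proved without dimension theory ([generic_smoothness]): if singular points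
    [y(t)] existed for a dense set of parameters [t], one could differentiate
    the equation along [t], the derivations [d/dt_i] being extended to the
    coordinates of [y] in an ultrapower of the base field ([derivation_tower]),
    and the incidence variety would be singular. *)

Set Implicit Arguments.
Unset Strict Implicit.
Unset Printing Implicit Defensive.
Import GRing.Theory Num.Theory.
Local Open Scope ring_scope.
Local Notation restrict := Defs.restrict.

(** * Generic smoothness *)

Section DerivationTower.
Variables (K : numClosedFieldType) (X : Type) (F : set_system X).
Hypothesis ultraF : UltraFilter F.

(** The function [u] vanishes [F]-almost everywhere, that is, it is zero in the
    ultrapower of [K] along [F]. *)
Definition null (u : X -> K) : Prop := F (fun x => u x = 0).

Lemma null_dec (u : X -> K) : null u \/ F (fun x => u x != 0).
Proof.
case: (in_ultra_setVsetC (fun x => u x = 0) ultraF) => [|h]; [by left|right].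
by apply: filterS h => x /= /eqP.
Qed.

Lemma nullNF (u : X -> K) : null u -> ~ F (fun x => u x != 0).
Proof.
move=> u0 u1; have : F set0 by apply: filterS2 u0 u1 => x /= ->; rewrite eqxx.
exact: filter_not_empty.
Qed.

Lemma null_zero (u : X -> K) : (forall x, u x = 0) -> null u.
Proof. by move=> u0; apply: filterS filterT => x _ /=. Qed.

Lemma null_sum n (u : 'I_n -> X -> K) :
  (forall i, null (u i)) -> null (fun x => \sum_(i < n) u i x).
Proof.
elim: n u => [|n IHn] u u0; first by apply: null_zero => x; rewrite big_ord0.
apply: filterS2 (IHn (fun i => u (widen_ord (leqnSn n) i)) _) (u0 ord_max) => //.
by move=> x /= h1 h2; rewrite big_ord_recr /= h1 h2 addr0.
Qed.

(** For each [x], [D x] is a derivation of [A] over the evaluation [ev x], and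
    the family [D] is compatible with the passage to the ultrapower: it descends
    to a derivation of the image of [A] in it. *)
Definition null_derivation (A : idomainType) (ev : X -> {rmorphism A -> K})
    (D : X -> {additive A -> K}) : Prop :=
  (forall x a b, D x (a * b) = ev x a * D x b + D x a * ev x b) /\
  (forall a, null (fun x => ev x a) -> null (fun x => D x a)).

(** The extension of a derivation from the image of [A] in the ultrapower to
    the subring generated by one more element [y], which is an arbitrary
    function on [X]. The ring [{poly A}] is evaluated at [y] by [adjoin_ev]. *)
Section Adjoin.
Variables (A : idomainType) (ev : X -> {rmorphism A -> K}).
Variables (D : X -> {additive A -> K}) (y : X -> K).
Variable adjoin_ev : X -> {rmorphism {poly A} -> K}.
Hypothesis adjoin_evC : forall x a, adjoin_ev x a%:P = ev x a.
Hypothesis adjoin_evX : forall x, adjoin_ev x 'X = y x.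
Hypothesis DM : forall x a b, D x (a * b) = ev x a * D x b + D x a * ev x b.
Hypothesis Dnull : forall a, null (fun x => ev x a) -> null (fun x => D x a).

Lemma adjoin_ev_sum x n (p : {poly A}) : (size p <= n)%N ->
  adjoin_ev x p = \sum_(i < n) ev x p`_i * y x ^+ i.
Proof.
move=> sp; rewrite -[p in LHS]coefK poly_def rmorph_sum /=.
rewrite (big_ord_widen n (fun i => adjoin_ev x (p`_i *: 'X^i)) sp).
rewrite big_mkcond; apply: eq_bigr => i _; case: ltnP => [_|/leq_sizeP h].
  by rewrite -mul_polyC rmorphM rmorphXn /= adjoin_evC adjoin_evX.
by rewrite h // rmorph0 mul0r.
Qed.

(** The derivation [D] applied to the coefficients of [p], followed by
    evaluation at [y]. *)
Definition coef_der x (p : {poly A}) := \sum_(i < size p) D x p`_i * y x ^+ i.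

Lemma coef_derE x n (p : {poly A}) : (size p <= n)%N ->
  coef_der x p = \sum_(i < n) D x p`_i * y x ^+ i.
Proof.
move=> sp; rewrite /coef_der (big_ord_widen n (fun i => D x p`_i * y x ^+ i) sp).
rewrite big_mkcond; apply: eq_bigr => i _; case: ltnP => // /leq_sizeP h.
by rewrite h // raddf0 mul0r.
Qed.

Lemma coef_derD x : {morph coef_der x : p q / p + q}.
Proof.
move=> p q; pose n := maxn (size p) (size q).
rewrite !(@coef_derE x n) ?leq_maxl ?leq_maxr ?size_polyD // -big_split /=.
by apply: eq_bigr => i _; rewrite coefD raddfD mulrDl.
Qed.

Lemma coef_derC x a : coef_der x a%:P = D x a.
Proof.
rewrite (@coef_derE x 1) ?size_polyC_leq1 // big_ord1 coefC eqxx expr0 mulr1 //.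
Qed.

Lemma coef_derMX x p : coef_der x (p * 'X) = coef_der x p * y x.
Proof.
rewrite (@coef_derE x (size p).+1); last first.
  by rewrite (leq_trans (size_polyMleq _ _)) // size_polyX addn2.
rewrite big_ord_recl coefMX eqxx raddf0 mul0r add0r mulr_suml.
by apply: eq_bigr => i _; rewrite coefMX /= exprSr mulrA.
Qed.

Lemma coef_derCM x a q :
  coef_der x (a%:P * q) = ev x a * coef_der x q + D x a * adjoin_ev x q.
Proof.
rewrite !(@coef_derE x (size q)) ?(@adjoin_ev_sum x (size q)) //; last first.
  by rewrite mul_polyC size_scale_leq.
rewrite !mulr_sumr -big_split; apply: eq_bigr => i _ /=.
by rewrite mul_polyC coefZ DM mulrDl !mulrA.
Qed.

Lemma coef_derM x p q : coef_der x (p * q) =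
  adjoin_ev x p * coef_der x q + coef_der x p * adjoin_ev x q.
Proof.
elim/poly_ind: p q => [|p c IHp] q.
  by rewrite mul0r rmorph0 -polyC0 coef_derC raddf0 !mul0r addr0.
rewrite mulrDl coef_derD -mulrA (mulrC 'X) mulrA coef_derMX IHp coef_derCM.
rewrite coef_derD coef_derMX coef_derC.
rewrite (rmorphD (adjoin_ev x)) (rmorphM (adjoin_ev x)) adjoin_evC adjoin_evX.
ring.
Qed.

Lemma coef_der_null (p : {poly A}) : (forall i, null (fun x => ev x p`_i)) ->
  null (fun x => coef_der x p).
Proof.
move=> h; apply: null_sum => i; apply: filterS (Dnull (h i)) => x /= ->.
by rewrite mul0r.
Qed.

Lemma adjoin_ev_null (p : {poly A}) : (forall i, null (fun x => ev x p`_i)) ->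
  null (fun x => adjoin_ev x p).
Proof.
move=> h; have /null_sum : forall i : 'I_(size p), null (fun x => ev x p`_i * y x ^+ i).
  by move=> i; apply: filterS (h i) => x /= ->; rewrite mul0r.
by apply: filterS => x; rewrite (@adjoin_ev_sum x (size p)); first [done|idtac].
Qed.

(** If every polynomial of size less than [n] which vanishes at [y] has a null
    leading coefficient, then all its coefficients are null: below the least
    degree of an algebraic relation for [y], only the trivial one is left. *)
Lemma null_coefs n :
  (forall P : {poly A}, (size P < n)%N -> null (fun x => adjoin_ev x P) ->
     null (fun x => ev x (lead_coef P))) ->
  forall Q : {poly A}, (size Q < n)%N -> null (fun x => adjoin_ev x Q) ->
  forall i, null (fun x => ev x Q`_i).
Proof.
move=> hlead Q; move: {2}(size Q) (leqnn (size Q)) => k.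
elim: k Q => [|k IHk] Q sQ sQn Q0 i.
  by move: sQ; rewrite leqn0 size_poly_eq0 => /eqP ->; apply: null_zero => x;
    rewrite coef0 rmorph0.
have lQ := hlead _ sQn Q0.
have [Qz|Qnz] := eqVneq Q 0.
  by apply: null_zero => x; rewrite Qz coef0 rmorph0.
pose Q' := Q - lead_coef Q *: ('X ^+ (size Q).-1).
have sQ' : (size Q' < size Q)%N.
  rewrite -(prednK (n := size Q)) ?lt0n ?size_poly_eq0 // ltnS.
  apply/leq_sizeP => j; rewrite leq_eqVlt => /orP[/eqP <-|hj].
    by rewrite coefB coefZ coefXn eqxx mulr1 subrr.
  rewrite coefB coefZ coefXn gtn_eqF // mulr0 subr0.
  by rewrite nth_default //; move: hj; case: (size Q).
have Q'0 : null (fun x => adjoin_ev x Q').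
  apply: filterS2 Q0 lQ => x /= h1 h2.
  by rewrite /Q' (rmorphB (adjoin_ev x)) h1 -mul_polyC (rmorphM (adjoin_ev x))
    adjoin_evC h2 mul0r subr0.
have sQ'k : (size Q' <= k)%N by rewrite -ltnS (leq_trans sQ').
apply: filterS2 (IHk _ sQ'k (ltn_trans sQ' sQn) Q'0 i) lQ => x /= h1 h2.
have -> : Q`_i = Q'`_i + lead_coef Q * (i == (size Q).-1)%:R.
  by rewrite coefB coefZ coefXn subrK.
by rewrite rmorphD rmorphM h1 h2 mul0r addr0.
Qed.

(** The derivation of [{poly A}] which extends [D] and sends ['X] to [d]. *)
Definition adjoin_der_fun (d : X -> K) x (p : {poly A}) : K :=
  coef_der x p + d x * adjoin_ev x p^`().

Lemma adjoin_der_additive d x : zmod_morphism (adjoin_der_fun d x).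
Proof.
have dD : {morph adjoin_der_fun d x : p q / p + q}.
  move=> p q; rewrite /adjoin_der_fun coef_derD derivD (rmorphD (adjoin_ev x)); ring.
move=> p q; apply: (addIr (adjoin_der_fun d x q)).
by rewrite -dD !subrK.
Qed.

Lemma adjoin_der_exists d : exists D' : X -> {additive {poly A} -> K},
  forall x p, D' x p = adjoin_der_fun d x p.
Proof.
pose mx x := GRing.isZmodMorphism.Build {poly A} K _ (adjoin_der_additive d x).
by exists (fun x => HB.pack_for {additive {poly A} -> K} (adjoin_der_fun d x) (mx x)).
Qed.

Lemma adjoin_derM d x p q : adjoin_der_fun d x (p * q) =
  adjoin_ev x p * adjoin_der_fun d x q + adjoin_der_fun d x p * adjoin_ev x q.
Proof.
rewrite /adjoin_der_fun coef_derM derivM.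
rewrite (rmorphD (adjoin_ev x)) !(rmorphM (adjoin_ev x)); ring.
Qed.

Lemma adjoin_derC d x a : adjoin_der_fun d x a%:P = D x a.
Proof. by rewrite /adjoin_der_fun coef_derC derivC raddf0 mulr0 addr0. Qed.

Lemma adjoin_der_null d (p : {poly A}) : (forall i, null (fun x => ev x p`_i)) ->
  null (fun x => adjoin_der_fun d x p).
Proof.
move=> h; have h' : null (fun x => adjoin_ev x p^`()).
  apply: adjoin_ev_null => i; apply: filterS (h i.+1) => x /= hx.
  by rewrite coef_deriv raddfMn /= hx mul0rn.
apply: filterS2 (coef_der_null h) h' => x /= h1 h2.
by rewrite /adjoin_der_fun h1 h2 mulr0 addr0.
Qed.

(** When [y] is transcendental any value [d] of the derivation at [y] is
    admissible. Otherwise [d] is determined by an algebraic relation [P] of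
    minimal degree, through [P^D(y) + d P'(y) = 0]; here [P'(y)] is not null by
    minimality of [P] and because [K] has characteristic zero. *)
Lemma adjoin_derivation : exists D' : X -> {additive {poly A} -> K},
  null_derivation adjoin_ev D' /\ forall x a, D' x a%:P = D x a.
Proof.
pose alg n := `[< exists P : {poly A}, [/\ size P = n, null (fun x => adjoin_ev x P)
  & ~ null (fun x => ev x (lead_coef P))] >].
have [[n0 algn0]|noalg] := pselect (exists n, alg n); last first.
  have [D' D'E] := adjoin_der_exists (fun=> 0).
  exists D'; split; last by move=> x a; rewrite D'E adjoin_derC.
  split; first by move=> *; rewrite !D'E adjoin_derM.
  move=> p p0; under eq_fun do rewrite D'E.
  apply: adjoin_der_null; apply: (@null_coefs (size p).+1) => //.
  move=> P _ P0; apply: contrapT => lP; apply: noalg; exists (size P).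
  by apply/asboolP; exists P.
have [n /asboolP[P [sP P0 lP]] minn] := ex_minnP (ex_intro alg n0 algn0).
have hlead (Q : {poly A}) : (size Q < n)%N -> null (fun x => adjoin_ev x Q) ->
    null (fun x => ev x (lead_coef Q)).
  move=> sQ Q0; apply: contrapT => lQ; move: sQ; rewrite ltnNge.
  by rewrite minn //; apply/asboolP; exists Q.
have Pnz : P != 0.
  by apply/eqP => Pz; apply: lP; apply: null_zero => x; rewrite Pz lead_coef0 rmorph0.
have sP1 : (1 < size P)%N.
  rewrite ltnNge; apply/negP => /size1_polyC Pc; apply: lP.
  apply: filterS P0 => x /=; rewrite Pc lead_coefC adjoin_evC.
  by [].
have P'nz : F (fun x => adjoin_ev x P^`() != 0).
  have [P'0|//] := null_dec (fun x => adjoin_ev x P^`()).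
  exfalso; apply: lP.
  have sP' : (size P^`() < n)%N by rewrite -sP lt_size_deriv.
  have := null_coefs hlead sP' P'0 (size P).-2; apply: filterS => x /=.
  rewrite coef_deriv raddfMn /= lead_coefE.
  have -> : (size P).-2.+1 = (size P).-1 by move: sP1; case: (size P) => [|[]].
  move=> /eqP; rewrite mulrn_eq0.
  by case/orP => [/eqP h|/eqP //]; move: sP1; rewrite -subn1 -ltnS; case: (size P) h => [|[|]].
(* Pseudo-division by P reduces a relation Q to one of smaller degree, whose  *)
(* coefficients are null.                                                     *)
pose d x := - coef_der x P / adjoin_ev x P^`().
have [D' D'E] := adjoin_der_exists d.
exists D'; split; last by move=> x a; rewrite D'E adjoin_derC.
split; first by move=> *; rewrite !D'E adjoin_derM.
have dP : null (fun x => adjoin_der_fun d x P).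
  by apply: filterS P'nz => x hx /=; rewrite /adjoin_der_fun /d mulfVK // addrN.
move=> Q Q0; under eq_fun do rewrite D'E.
have eqQ := Pdiv.Idomain.divp_eq Q P; set lk := lead_coef P ^+ _ in eqQ.
set S := Q %/ P in eqQ; set R := Q %% P in eqQ.
have lknz : F (fun x => ev x lk != 0).
  have [//|] := null_dec (fun x => ev x (lead_coef P)).
  by apply: filterS => x /= hx; rewrite rmorphXn expf_neq0.
have evC x a (p : {poly A}) : adjoin_ev x (a *: p) = ev x a * adjoin_ev x p.
  by rewrite -mul_polyC (rmorphM (adjoin_ev x)) adjoin_evC.
have R0 : null (fun x => adjoin_ev x R).
  apply: filterS2 P0 Q0 => x /= hP hQ.
  have := congr1 (adjoin_ev x) eqQ; rewrite evC hQ mulr0 (rmorphD (adjoin_ev x)).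
  by rewrite (rmorphM (adjoin_ev x)) hP mulr0 add0r => <-.
have sR : (size R < n)%N by rewrite -sP Pdiv.Idomain.ltn_modp.
have dR := adjoin_der_null d (null_coefs hlead sR R0).
have h1 : F (fun x => adjoin_ev x P = 0 /\ adjoin_ev x Q = 0).
  by apply: filterS2 P0 Q0.
have h2 : F (fun x => adjoin_der_fun d x P = 0 /\ adjoin_der_fun d x R = 0).
  by apply: filterS2 dP dR.
apply: filterS3 h1 h2 lknz => x /= [hP hQ] [hdP hdR] hlk.
have := congr1 (adjoin_der_fun d x) eqQ.
rewrite -mul_polyC -!D'E raddfD !D'E !adjoin_derM hP hQ mulr0 addr0.
rewrite hdP hdR !mulr0 !addr0 adjoin_evC.
by move=> /eqP; rewrite mulf_eq0 (negPf hlk) /= => /eqP.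
Qed.

End Adjoin.
End DerivationTower.

Lemma mpoly_ring_ind (R : comNzRingType) n (P : {mpoly R[n]} -> Prop) :
  (forall c, P c%:MP) -> (forall i, P 'X_i) ->
  (forall p q, P p -> P q -> P (p + q)) ->
  (forall p q, P p -> P q -> P (p * q)) -> forall p, P p.
Proof.
move=> PC PX PD PM.
have Pprod (I : Type) (r : seq I) (G : I -> {mpoly R[n]}) :
    (forall i, P (G i)) -> P (\prod_(i <- r) G i).
  by move=> PG; elim/big_ind: _ => //; rewrite -mpolyC1.
have Pexp p k : P p -> P (p ^+ k).
  by move=> Pp; elim: k => [|k IHk]; rewrite ?exprS ?expr0 -?mpolyC1 //; apply: PM.
elim/mpolyind => [|c m p _ _ Pp]; first by rewrite -mpolyC0.
apply: PD => //; rewrite -mul_mpolyC mpolyXE_id; apply: PM => //.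
by apply: Pprod => i; apply: Pexp.
Qed.

Lemma mderivXU (R : comNzRingType) n (i j : 'I_n) :
  ('X_j : {mpoly R[n]})^`M(i) = (i == j)%:R.
Proof.
rewrite mderivX mnm1E eq_sym; case: eqVneq => [->|_]; last by rewrite scale0r.
have -> : (U_(j) - U_(j) = 0)%MM by apply/mnmP => k; rewrite mnmBE subnn mnm0E.
by rewrite mpolyX0 scale1r.
Qed.

(** The chain rule: a derivation [delta] over [phi] which kills the constants,
    applied to the value of a polynomial [f] at [u]. *)
Lemma derivation_mmap (K A : comNzRingType) n (phi : {rmorphism A -> K})
    (delta : {additive A -> K}) (h : {rmorphism K -> A}) (u : 'I_n -> A) :
  (forall a b, delta (a * b) = phi a * delta b + delta a * phi b) ->
  (forall c, phi (h c) = c) -> (forall c, delta (h c) = 0) ->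
  forall f : {mpoly K[n]}, phi (mmap h u f) = f.@[phi \o u] /\
    delta (mmap h u f) = \sum_i f^`M(i).@[phi \o u] * delta (u i).
Proof.
move=> deltaM phih deltah; elim/mpoly_ring_ind => [c|i|p q [p1 p2] [q1 q2]|p q [p1 p2] [q1 q2]].
- rewrite mmapC mevalC phih deltah big1 // => i _.
  by rewrite mderivC meval0 mul0r.
- rewrite mmapX mmap1U mevalXU; split=> //.
  rewrite (bigD1 i) //= mderivXU eqxx meval1 mul1r big1 ?addr0 // => j ji.
  by rewrite mderivXU (negPf ji) meval0 mul0r.
- rewrite mmapD !raddfD /= p1 p2 q1 q2; split=> //.
  rewrite -big_split; apply: eq_bigr => i _ /=.
  by rewrite mderivD mevalD mulrDl.
- rewrite !rmorphM deltaM p1 p2 q1 q2; split=> //.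
  rewrite mulr_sumr mulr_suml -big_split; apply: eq_bigr => i _ /=.
  by rewrite mderivM mevalD !mevalM; ring.
Qed.

Section GenericSmoothness.
Variables (K : numClosedFieldType).

(** Iteration of [adjoin_derivation]: the derivation extends to a ring which
    contains elements [Y j] with arbitrary prescribed values [y j]. *)
Lemma derivation_tower (X : Type) (F : set_system X) (ultraF : UltraFilter F)
    (A : idomainType) (ev : X -> {rmorphism A -> K}) (D : X -> {additive A -> K})
    m (y : 'I_m -> X -> K) :
  null_derivation F ev D ->
  exists (B : idomainType) (ev' : X -> {rmorphism B -> K})
    (D' : X -> {additive B -> K}) (inj : {rmorphism A -> B}) (Y : 'I_m -> B),
  [/\ null_derivation F ev' D', forall x a, ev' x (inj a) = ev x a,
      forall x a, D' x (inj a) = D x a & forall x j, ev' x (Y j) = y j x].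
Proof.
elim: m y => [|m IHm] y evD.
  exists A, ev, D, idfun, (fun=> 0).
  by split=> // x [].
have [B [ev1 [D1 [inj [Y [[D1M D1n] ev1E D1E Y1]]]]]] :=
  IHm (fun j => y (widen_ord (leqnSn m) j)) evD.
pose ev2 x : {rmorphism {poly B} -> K} :=
  horner_eval (y ord_max x) \o map_poly (ev1 x).
have ev2C x a : ev2 x a%:P = ev1 x a by rewrite /= /horner_eval map_polyC hornerC.
have ev2X x : ev2 x 'X = y ord_max x by rewrite /= /horner_eval map_polyX hornerX.
have [D2 [evD2 D2E]] := adjoin_derivation ultraF ev2C ev2X D1M D1n.
pose Y2 (j : 'I_m.+1) : {poly B} :=
  if unlift ord_max j is Some k then (Y k)%:P else 'X.
exists {poly B}, ev2, D2, (polyC \o inj), Y2; split=> //.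
- by move=> x a; rewrite ev2C ev1E.
- by move=> x a; rewrite D2E D1E.
move=> x j; rewrite /Y2; case: unliftP => [k ->|->]; last by rewrite ev2X.
rewrite ev2C Y1; congr (y _ x); apply: val_inj.
by rewrite /= /bump leqNgt ltn_ord.
Qed.

(** Zariski density in the affine space of row vectors. *)
Definition dense n (S : 'rV[K]_n -> Prop) :=
  forall G : {mpoly K[n]}, G != 0 -> exists2 t, S t & G.@[t 0] != 0.

(** An ultrafilter on a dense set which avoids all proper closed subsets; it
    plays the role of a generic point. *)
Lemma ultrafilter_of_dense n (S : 'rV[K]_n -> Prop) : dense S ->
  exists F : set_system 'rV[K]_n, [/\ UltraFilter F, F S &
    forall G : {mpoly K[n]}, G != 0 -> F (fun t => G.@[t 0] != 0)].
Proof.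
move=> dS.
pose B : set_system 'rV[K]_n := fun U =>
  exists2 G : {mpoly K[n]}, G != 0 & forall t, S t -> G.@[t 0] != 0 -> U t.
have BF : ProperFilter B.
  split=> [[G /dS[t St Gt] /(_ t St Gt)]//|]; split.
  - by exists 1 => //; apply: oner_neq0.
  - move=> U V [G G0 GU] [H H0 HV]; exists (G * H); first by rewrite mulf_neq0.
    by move=> t St; rewrite mevalM mulf_eq0 negb_or => /andP[Gt Ht]; split; auto.
  - by move=> U V UV [G G0 GU]; exists G => // t St Gt; apply: UV; apply: GU.
have [F [ultraF BsubF]] := ultraFilterLemma BF.
exists F; split=> //.
  by apply: BsubF; exists 1 => //; apply: oner_neq0.
by move=> G G0; apply: BsubF; exists G.
Qed.

Lemma filter_forall_ord (X : Type) (F : set_system X) (FF : Filter F) m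
    (P : 'I_m -> X -> Prop) :
  (forall i, F (P i)) -> F (fun x => forall i, P i x).
Proof.
elim: m P => [|m IHm] P FP; first by apply: filterS filterT => x _ [].
apply: filterS2 (FP ord0) (IHm (fun i => P (lift ord0 i)) (fun i => FP _)).
by move=> x h0 h1 i; case: (unliftP ord0 i) => [j|] ->.
Qed.

(** Generic smoothness for the hypersurface [f = 0] restricted to a family of
    linear subspaces, spanned by the rows of [At t]. If for a dense set of
    parameters the restriction has a singular point [y t], then for some
    parameter the differential of [(t, y) |-> f (y *m At t)] vanishes at
    [(t, y t)], that is, the incidence variety is singular there. No regularity
    of the function [y] is assumed: the derivation [d/dt_i] is extended to the
    coordinates of [y] in an ultrapower, and applied to [f (y *m At t) = 0]. The
    derivatives of [y] do not contribute, by the singularity of [y t]. *)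
Theorem generic_smoothness n m N (f : {mpoly K[N]})
    (A : 'M[{mpoly K[n]}]_(m, N)) (S : 'rV[K]_n -> Prop)
    (y : 'rV[K]_n -> 'rV[K]_m) (At := fun t => map_mx (meval (t 0)) A) :
  dense S ->
  (forall t, S t -> f.@[(y t *m At t) 0] = 0 /\
     At t *m (grad f (y t *m At t))^T = 0) ->
  exists2 t, S t & forall i : 'I_n,
    y t *m map_mx (fun p => p^`M(i).@[t 0]) A *m (grad f (y t *m At t))^T = 0.
Proof.
move=> dS sing; have [F [ultraF FS FG]] := ultrafilter_of_dense dS.
have FF : Filter F by exact: filter_filter.
have key i : F (fun t => S t /\
    y t *m map_mx (fun p => p^`M(i).@[t 0]) A *m (grad f (y t *m At t))^T = 0).
  pose ev0 (t : 'rV[K]_n) : {rmorphism {mpoly K[n]} -> K} := meval (t 0).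
  pose D0 (t : 'rV[K]_n) : {additive {mpoly K[n]} -> K} := ev0 t \o mderiv i.
  have evD0 : null_derivation F ev0 D0.
    split=> [t a b|a a0].
      by rewrite /= mderivM mevalD !mevalM addrC; congr (_ + _); rewrite mulrC.
    have [->|/FG /(nullNF ultraF a0)//] := eqVneq a 0.
    by apply: filterS filterT => t _; rewrite raddf0.
  have [B [ev [D [inj [Y [[DM Dn] evE DE YE]]]]]] :=
    derivation_tower ultraF (fun j t => y t 0 j) evD0.
  pose h : {rmorphism K -> B} := inj \o @mpolyC n K.
  pose u k := \sum_j Y j * inj (A j k).
  have evh t c : ev t (h c) = c by rewrite /= evE /= mevalC.
  have Dh t c : D t (h c) = 0 by rewrite /= DE /= mderivC meval0.
  have evu t k : ev t (u k) = (y t *m At t) 0 k.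
    rewrite rmorph_sum mxE; apply: eq_bigr => j _.
    by rewrite rmorphM /= YE evE mxE.
  have chain t := derivation_mmap u (DM t) (evh t) (Dh t) f.
  have evf t : ev t (mmap h u f) = f.@[(y t *m At t) 0].
    by case: (chain t) => -> _; apply: meval_eq => k /=; rewrite evu.
  have null_f : null F (fun t => ev t (mmap h u f)).
    by apply: filterS FS => t /sing[ft _]; rewrite evf.
  apply: filterS2 FS (Dn _ null_f) => t St; case: (chain t) => _ -> Dft.
  split=> //; have [_ sing_t] := sing t St.
  apply/matrixP => a b; rewrite !ord1 {a b} [RHS]mxE -{}Dft mxE.
  set g := grad f _.
  have gE k : f^`M(k).@[ev t \o u] = g 0 k.
    by rewrite mxE; apply: meval_eq => l /=; rewrite evu.
  transitivity (\sum_k g 0 k * D t (u k)); last by apply: eq_bigr => k _; rewrite gE.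
  have Du k : D t (u k) = \sum_j D t (Y j) * (At t) j k +
      (y t *m map_mx (fun p => p^`M(i).@[t 0]) A) 0 k.
    rewrite raddf_sum mxE -big_split; apply: eq_bigr => j _ /=.
    by rewrite DM DE YE evE !mxE /= addrC.
  under [RHS]eq_bigr do rewrite Du mulrDr.
  rewrite big_split /= [X in X + _](_ : _ = 0) ?add0r.
    by apply: eq_bigr => k _; rewrite [_^T _ _]mxE mulrC.
  under eq_bigr do rewrite mulr_sumr.
  rewrite exchange_big big1 // => j _ /=.
  have /matrixP/(_ j 0) := sing_t; rewrite !mxE => h0.
  transitivity (D t (Y j) * \sum_k At t j k * g 0 k).
    by rewrite mulr_sumr; apply: eq_bigr => k _; ring.
  rewrite [X in _ * X](_ : _ = 0) ?mulr0 // -[RHS]h0.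
  by apply: eq_bigr => k _; rewrite [_^T _ _]mxE.
have /filter_ex[t ht] := filter_forall_ord FF key.
case: n => [|n] in f A S y At dS sing F ultraF FS FG FF key t ht *.
  by have [t' St'] := dS 1 (oner_neq0 _); exists t' => // - [].
by exists t => [|i]; case: (ht i) || case: (ht ord0).
Qed.

End GenericSmoothness.

(** * Polynomials, quadratic forms and restriction to a plane *)

Section PolynomialFacts.
Variables (K : numClosedFieldType).

Lemma meval_at0 n (p : {mpoly K[n]}) : p.@[fun=> 0] = p@_0%MM.
Proof.
elim/mpoly_ring_ind: p => [c|i|p q hp hq|p q hp hq].
- by rewrite mevalC mcoeffC eqxx mulr1.
- by rewrite mevalXU mcoeffX mnm1_eq0.
- by rewrite mevalD mcoeffD hp hq.
by rewrite mevalM rmorphM /= hp hq.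
Qed.

Lemma poly_all_roots (p : {poly K}) : (forall c, p.[c] = 0) -> p = 0.
Proof.
move=> p0; apply: (@roots_geq_poly_eq0 _ _ [seq i%:R | i <- iota 0 (size p)]).
- by apply/allP => c _; apply/rootP.
- by rewrite map_inj_uniq ?iota_uniq // => i j /eqP; rewrite eqr_nat => /eqP.
- by rewrite size_map size_iota.
Qed.

Lemma meval_deriv_eq0 n (p : {mpoly K[n]}) i :
  (forall x, p.@[x] = 0) -> forall x, p^`M(i).@[x] = 0.
Proof.
move=> p0 x; pose u k : {poly K} := (x k)%:P + (k == i)%:R *: 'X.
pose D : {additive {poly K} -> K} := horner_eval 0 \o (@deriv K).
have DM a b : D (a * b) = horner_eval 0 a * D b + D a * horner_eval 0 b.
  by rewrite /D /= derivM horner_evalE hornerD !hornerM addrC.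
have [|c|_] := derivation_mmap (h := polyC) u DM _ _ p.
- by move=> c; exact: hornerC.
- by rewrite /D /= derivC horner_evalE hornerC.
have -> : mmap polyC u p = 0.
  apply: poly_all_roots => c.
  have DcM a b : (\0%R : {additive {poly K} -> K}) (a * b) =
      horner_eval c a * (\0%R : {additive {poly K} -> K}) b +
      (\0%R : {additive {poly K} -> K}) a * horner_eval c b.
    by rewrite /= mulr0 mul0r addr0.
  have [|//|h _] := derivation_mmap (h := polyC) u DcM _ _ p.
    by move=> d; exact: hornerC.
  by rewrite -[LHS]/(horner_eval c _) h p0.
rewrite raddf0 (bigD1 i) //= big1 => [|k ki].
  rewrite /u eqxx scale1r /D /= derivD derivC derivX add0r horner_evalE hornerC.
  rewrite mulr1 addr0 => /esym h; rewrite -[RHS]h; apply: meval_eq => k /=.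
  by rewrite /u horner_evalE hornerD hornerC hornerZ hornerX mulr0 addr0.
by rewrite /D /= /u (negPf ki) scale0r addr0 derivC horner_evalE hornerC mulr0.
Qed.

Lemma mpoly_all_zeros n (p : {mpoly K[n]}) : (forall x, p.@[x] = 0) -> p = 0.
Proof.
move=> p0; apply/mpolyP => m; rewrite mcoeff0.
have [k hk] : exists k, k = mdeg m by exists (mdeg m).
elim: k m hk p p0 => [|k IHk] m hk p p0.
  have /eqP : mdeg m = 0%N by [].
  by rewrite mdeg_eq0 => /eqP ->; rewrite -meval_at0 p0.
have [i mi] : exists i, m i != 0%N.
  apply/existsP; rewrite -negb_forall; apply/negP => /forallP m0.
  by move: hk; rewrite mdegE big1 // => i _; exact/eqP/m0.
have hm : m = (m - U_(i) + U_(i))%MM by rewrite submK // lep1mP.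
have := IHk (m - U_(i))%MM _ _ (meval_deriv_eq0 i p0).
rewrite mcoeff_deriv -hm => /(_ _)/eqP; rewrite mulrn_eq0 /= => h; apply/eqP/h.
by have := congr1 (@mdeg n) hm; rewrite mdegD mdeg1 -hk addn1 => -[].
Qed.

Lemma mpoly_nonzero_point n (p : {mpoly K[n]}) :
  p != 0 -> exists x : 'rV[K]_n, p.@[x 0] != 0.
Proof.
move=> p0; apply: contrapT => h; case/eqP: p0; apply: mpoly_all_zeros => x.
apply: contrapT => px; apply: h; exists (\row_i x i); apply/eqP.
by rewrite (@meval_eq _ _ _ x) // => i; rewrite mxE.
Qed.

Lemma dhomog_deriv n d (p : {mpoly K[n]}) i :
  p \is d.+1.-homog -> p^`M(i) \is d.-homog.
Proof.
move=> /dhomogP hp; apply/dhomogP => m; rewrite mcoeff_msupp mcoeff_deriv => h.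
have /hp : (m + U_(i))%MM \in msupp p.
  by rewrite mcoeff_msupp; apply: contraNneq h => ->; rewrite mul0rn.
by rewrite /= mdegD mdeg1 addn1 => -[].
Qed.

Lemma euler_identity n d (p : {mpoly K[n]}) (x : 'I_n -> K) : p \is d.-homog ->
  \sum_i x i * p^`M(i).@[x] = d%:R * p.@[x].
Proof.
move=> /dhomogP hp; rewrite {1 2}[p]mpolyE raddf_sum mulr_sumr.
transitivity (\sum_(m <- msupp p) \sum_i x i * (p@_m *: 'X_[m])^`M(i).@[x]).
  rewrite exchange_big; apply: eq_bigr => i _.
  by rewrite (raddf_sum (mderiv i)) (raddf_sum (meval x)) mulr_sumr.
rewrite [LHS]big_seq [RHS]big_seq; apply: eq_bigr => m /hp <-.
rewrite /= mdegE natr_sum mulr_suml; apply: eq_bigr => i _.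
rewrite mderivZ mderivX !mevalZ.
have [->|mi] := eqVneq (m i) 0%N; first by rewrite !(mul0r, mulr0).
have -> : 'X_[m] = 'X_[m - U_(i)] * 'X_i :> {mpoly K[n]}.
  by rewrite -mpolyXD submK // lep1mP.
rewrite mevalM mevalXU; ring.
Qed.

(** The matrix of second derivatives of a quadratic form, which is twice its
    Gram matrix. *)
Definition hessian n (q : {mpoly K[n]}) : 'M[K]_n :=
  \matrix_(i, j) (q^`M(i)^`M(j))@_0%MM.

Lemma hessian_sym n (q : {mpoly K[n]}) : (hessian q)^T = hessian q.
Proof. by apply/matrixP => i j; rewrite !mxE mderiv_comm. Qed.

Lemma grad_quadratic n (q : {mpoly K[n]}) x : q \is 2.-homog ->
  grad q x = x *m hessian q.
Proof.
move=> hq; apply/rowP => i; rewrite !mxE.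
have := euler_identity (x 0) (dhomog_deriv i hq); rewrite mul1r => <-.
apply: eq_bigr => j _; rewrite mxE; congr (_ * _).
rewrite mderiv_comm.
have /dhomogP := dhomog_deriv i (dhomog_deriv j hq) => h0.
set p := q^`M(j)^`M(i) in h0 *.
have -> : p = (p@_0)%:MP.
  apply/mpolyP => m; rewrite mcoeffC; case: eqVneq => [->|m0]; rewrite ?mulr1 // mulr0.
  apply/eqP; rewrite mcoeff_eq0; apply/negP => /h0/eqP.
  by rewrite mdeg_eq0 (negPf m0).
by rewrite mevalC mcoeffC eqxx mulr1.
Qed.

Lemma quadraticE n (q : {mpoly K[n]}) (x : 'rV_n) : q \is 2.-homog ->
  2%:R * q.@[x 0] = (x *m hessian q *m x^T) 0 0.
Proof.
move=> hq; rewrite -(euler_identity _ hq) -(grad_quadratic x hq) [RHS]mxE.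
by apply: eq_bigr => i _; rewrite !mxE mulrC.
Qed.

Lemma two_neq0 : (2%:R : K) != 0.
Proof. by rewrite pnatr_eq0. Qed.

Lemma quadratic_eq0 n (q : {mpoly K[n]}) (x : 'rV_n) : q \is 2.-homog ->
  q.@[x 0] = 0 <-> (x *m hessian q *m x^T) 0 0 = 0.
Proof.
move=> hq; rewrite -quadraticE //; split=> [->|/eqP]; first by rewrite mulr0.
by rewrite mulf_eq0 (negPf two_neq0) => /eqP.
Qed.

End PolynomialFacts.

Section Restriction.
Variables (K : numClosedFieldType).
Implicit Types (p q f : {mpoly K[6]}) (A : 'M[K]_(3, 6)).

Lemma meval_restrict p A (y : 'rV_3) : (restrict p A).@[y 0] = p.@[(y *m A) 0].
Proof.
rewrite comp_mpoly_meval; apply: meval_eq => i; rewrite tnth_mktuple.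
rewrite raddf_sum mxE; apply: eq_bigr => j _ /=.
by rewrite mevalZ mevalXU mulrC.
Qed.

Lemma grad_restrict p A (y : 'rV_3) :
  grad (restrict p A) y = grad p (y *m A) *m A^T.
Proof.
apply/rowP => i; rewrite [LHS]mxE.
pose D : {additive {mpoly K[3]} -> K} := meval (y 0) \o mderiv i.
set lq := [tuple \sum_(j < 3) A j k *: 'X_j | k < 6].
have DM a b : D (a * b) = meval (y 0) a * D b + D a * meval (y 0) b.
  by rewrite /D /= mderivM mevalD !mevalM addrC.
have [|c|_] := derivation_mmap (h := @mpolyC 3 K) (tnth lq) DM _ _ p.
- by move=> c; rewrite /= mevalC.
- by rewrite /D /= mderivC meval0.
rewrite -[LHS]/((restrict p A)^`M(i).@[y 0]) => ->; rewrite mxE.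
apply: eq_bigr => k _; rewrite !mxE; congr (_ * _).
  apply: meval_eq => l /=; rewrite tnth_mktuple raddf_sum mxE.
  by apply: eq_bigr => j _ /=; rewrite mevalZ mevalXU mulrC.
rewrite tnth_mktuple raddf_sum (bigD1 i) //= mderivZ mderivXU eqxx big1 => [|j ji].
  by rewrite addr0 mevalZ meval1 mulr1.
by rewrite mderivZ mderivXU eq_sym (negPf ji) scaler0 meval0.
Qed.

Lemma restrict_homog d p A : p \is d.-homog -> restrict p A \is d.-homog.
Proof.
move=> /dhomogP hp; rewrite /restrict comp_mpolyEX.
rewrite big_seq; apply: rpred_sum => m /hp hm; apply: dhomogZ.
rewrite comp_mpolyX -hm /= mdegE.
pose P (a : {mpoly K[3]}) (b : nat) := a \is b.-homog.
apply: (big_ind2 P) => [|a b a' b'|i _]; first exact: dhomog1.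
  exact: dhomogM.
rewrite /P -[X in X.-homog]mul1n; apply: dhomogMn; rewrite tnth_mktuple.
by apply: rpred_sum => j _; apply: dhomogZ; rewrite dhomogX /= mdeg1.
Qed.

Lemma restrict_eq0 q A : q \is 2.-homog ->
  restrict q A = 0 <-> A *m hessian q *m A^T = 0.
Proof.
move=> hq; split=> h.
  apply/row_matrixP => i; rewrite row0 !rowE -[in RHS](mul0mx _ A^T).
  rewrite -!mulmxA [_ *m (A *m _)]mulmxA mulmxA -grad_quadratic // -grad_restrict h.
  by rewrite mul0mx; apply/rowP => j; rewrite !mxE mderiv0 meval0.
apply: mpoly_all_zeros => x; pose y : 'rV[K]_3 := \row_i x i.
rewrite (@meval_eq _ _ _ (y 0)) => [|i]; last by rewrite mxE.
rewrite meval_restrict; apply/quadratic_eq0 => //.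
have -> : y *m A *m hessian q *m (y *m A)^T = y *m (A *m hessian q *m A^T) *m y^T.
  by rewrite trmx_mul !mulmxA.
by rewrite h mulmx0 mul0mx mxE.
Qed.

Lemma restrict_cuts_cubic q f A : row_free A -> restrict q A = 0 ->
  f \is 3.-homog -> restrict f A != 0 -> cuts_cubic q f A (restrict f A).
Proof.
move=> rA qA hf fA; split=> //; first exact: restrict_homog.
move=> h; rewrite qA; split=> [[a [b ->]]|[a ->]].
  by exists b; rewrite mulr0 add0r.
by exists 0, a; rewrite mulr0 add0r.
Qed.

End Restriction.

(** * Symmetric matrices up to congruence *)

Section Congruence.
Variables (K : numClosedFieldType).

(** A row-free matrix completes to an invertible one. *)
Lemma row_free_complete m n (A : 'M[K]_(m, m + n)) : row_free A ->
  exists2 P, P \in unitmx & usubmx P = A.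
Proof.
move=> /eqP rA.
exists (block_mx (col_ebase A) 0 0 1%:M *m row_ebase A).
  rewrite unitmx_mul row_ebase_unit andbT unitmxE det_lblock det1 mulr1.
  by rewrite -unitmxE col_ebase_unit.
rewrite -mul_usub_mx /block_mx col_mxKu -[RHS]mulmx_ebase rA pid_mx_row.
by rewrite mul_mx_row mulmx1 mulmx0.
Qed.

Lemma pid_mxS n r :
  block_mx 1%:M 0 0 (pid_mx r) = pid_mx r.+1 :> 'M[K]_(1 + n).
Proof.
apply/matrixP => a b; rewrite -[a]splitK -[b]splitK.
by case: (split a) (split b) => i' [] j'; rewrite /= ?block_mxEul ?block_mxEur
  ?block_mxEdl ?block_mxEdr !mxE ?ord1 //= ?andbT ?andbF.
Qed.

Lemma symmetric_nonisotropic n (B : 'M[K]_n) : B^T = B -> B != 0 ->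
  exists v : 'rV[K]_n, (v *m B *m v^T) 0 0 != 0.
Proof.
move=> symB Bnz; apply: contrapT => h; case/eqP: Bnz.
have h0 (v : 'rV[K]_n) : (v *m B *m v^T) 0 0 = 0.
  by apply: contrapT => /eqP hv; apply: h; exists v.
apply/matrixP => i j; rewrite [RHS]mxE.
pose e k : 'rV[K]_n := delta_mx 0 k.
have eE k l : (e k *m B *m (e l)^T) 0 0 = B k l.
  by rewrite -rowE trmx_delta -colE !mxE.
have Bji : B j i = B i j by rewrite -{1}symB mxE.
have := h0 (e i + e j); rewrite linearD /= !(mulmxDl, mulmxDr).
have addE (M N : 'M[K]_1) : (M + N) 0 0 = M 0 0 + N 0 0 by rewrite mxE.
rewrite !addE !h0 !eE add0r addr0 Bji -mulr2n => /eqP.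
by rewrite mulrn_eq0 => /eqP.
Qed.

(** Symmetric matrices over an algebraically closed field are classified up to
    congruence by their rank. *)
Lemma congruence_pid n (B : 'M[K]_n) : B^T = B ->
  exists2 P, P \in unitmx & P *m B *m P^T = pid_mx (\rank B).
Proof.
elim: n B => [|n IHn] B symB.
  by exists 1%:M; rewrite ?unitmx1 //; apply/matrixP => -[].
have [->|Bnz] := eqVneq B 0.
  by exists 1%:M; rewrite ?unitmx1 // mulmx0 mul0mx mxrank0 pid_mx_0.
have [v vB] := symmetric_nonisotropic symB Bnz.
set c := (v *m B *m v^T) 0 0 in vB.
pose w := (sqrtC c)^-1 *: v.
have wB : w *m B *m w^T = 1%:M.
  rewrite /w linearZ /= -!scalemxAl -scalemxAr scalerA; apply/matrixP => i j.
  rewrite !ord1 mxE -/c mxE -invfM -expr2 sqrtCK mulVf //.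
have wnz : w != 0.
  apply: contraNneq (oner_neq0 K) => w0.
  by move/matrixP/(_ 0 0): wB; rewrite w0 !mul0mx !mxE => ->.
have [|P1 P1u P1w] := @row_free_complete 1 n w.
  by rewrite /row_free rank_rV wnz.
pose B1 := P1 *m B *m P1^T.
have symB1 : B1^T = B1 by rewrite /B1 !trmx_mul trmxK symB mulmxA.
have B1ul : ulsubmx B1 = 1%:M.
  by rewrite /B1 /ulsubmx -!mul_usub_mx -mulmx_lsub -trmx_usub P1w.
have B1ur : ursubmx B1 = (dlsubmx B1)^T by rewrite trmx_dlsub symB1.
(* Row and column elimination with the pivot w B w^T = 1.                     *)
pose P2 : 'M[K]_(1 + n) := block_mx 1%:M 0 (- dlsubmx B1) 1%:M.
have P2u : P2 \in unitmx by rewrite unitmxE det_lblock !det1 mulr1 unitr1.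
pose S := drsubmx B1 - dlsubmx B1 *m ursubmx B1.
have B2 : P2 *m B1 *m P2^T = block_mx 1%:M 0 0 S.
  rewrite -[B1]submxK /P2 tr_block_mx !mulmx_block.
  rewrite !(trmx1, trmx0, mul1mx, mul0mx, mulmx1, mulmx0, addr0, add0r).
  rewrite B1ul !mulmx1 mul1mx [- dlsubmx B1 + _]addrC subrr mul0mx add0r.
  by rewrite linearN /= -B1ur [- _ + ursubmx B1]addrC subrr mulNmx addrC.
have symS : S^T = S.
  by rewrite /S linearB /= trmx_mul trmx_drsub symB1 -B1ur -[in dlsubmx _]symB1 -trmx_ursub.
have [P3 P3u P3S] := IHn S symS.
pose P4 : 'M[K]_(1 + n) := block_mx 1%:M 0 0 P3.
have P4u : P4 \in unitmx by rewrite unitmxE det_lblock det1 mul1r -unitmxE.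
pose P := P4 *m P2 *m P1.
have Pu : P \in unitmx by rewrite !unitmx_mul P4u P2u.
have PB : P *m B *m P^T = block_mx 1%:M 0 0 (pid_mx (\rank S)).
  have -> : P *m B *m P^T = P4 *m (P2 *m B1 *m P2^T) *m P4^T.
    by rewrite /P /B1 !trmx_mul !mulmxA.
  rewrite B2 tr_block_mx !mulmx_block.
  by rewrite !(trmx1, trmx0, mul1mx, mul0mx, mulmx1, mulmx0, addr0, add0r) P3S.
exists P => //; rewrite PB.
have -> : \rank B = (\rank S).+1.
  have <- : \rank (P *m B *m P^T) = \rank B.
    by rewrite mxrankMfree ?row_free_unit ?unitmx_tr // (eqmxMfull B) ?row_full_unit.
  rewrite PB rank_diag_block_mx mxrank1 rank_pid_mx ?rank_leq_row //.
exact: pid_mxS.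
Qed.

End Congruence.

(** * Eigenvectors of quadratic maps *)

Section CubicResultant.
Variable R : comNzRingType.
Implicit Types g p : R.

(** The resultant of the monic cubic [G = v^3 + g2 v^2 + g1 v + g0] and of
    [P = p2 v^2 + p1 v + p0], as the determinant whose rows are the coordinates
    of [P], [v P] and [v^2 P] modulo [G]. *)
Definition res3 g0 g1 g2 p0 p1 p2 : R :=
  let a0 := - (p2 * g0) in let a1 := p0 - p2 * g1 in let a2 := p1 - p2 * g2 in
  let b0 := - (a2 * g0) in let b1 := a0 - a2 * g1 in let b2 := a1 - a2 * g2 in
  p0 * (a1 * b2 - a2 * b1) - p1 * (a0 * b2 - a2 * b0) + p2 * (a0 * b1 - a1 * b0).

Lemma res3_roots v1 v2 v3 p0 p1 p2 :
  res3 (- (v1 * v2 * v3)) (v1 * v2 + v1 * v3 + v2 * v3) (- (v1 + v2 + v3)) p0 p1 p2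
  = (p0 + p1 * v1 + p2 * v1 ^+ 2) * (p0 + p1 * v2 + p2 * v2 ^+ 2)
    * (p0 + p1 * v3 + p2 * v3 ^+ 2).
Proof. rewrite /res3 /=; ring. Qed.

Lemma res3_homog l g0 g1 g2 p0 p1 p2 :
  res3 (l ^+ 3 * g0) (l ^+ 2 * g1) (l * g2) (l ^+ 3 * p0) (l ^+ 2 * p1) (l * p2) =
  l ^+ 9 * res3 g0 g1 g2 p0 p1 p2.
Proof. rewrite /res3 /=; ring. Qed.

Lemma res3_scale l g0 g1 g2 p0 p1 p2 :
  res3 g0 g1 g2 (l * p0) (l * p1) (l * p2) = l ^+ 3 * res3 g0 g1 g2 p0 p1 p2.
Proof. rewrite /res3 /=; ring. Qed.

(** Multiplicativity of the resultant, for [- v P] modulo [G]. *)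
Lemma res3_mulv g0 g1 g2 p0 p1 p2 :
  res3 g0 g1 g2 (p2 * g0) (p2 * g1 - p0) (p2 * g2 - p1) =
  g0 * res3 g0 g1 g2 p0 p1 p2.
Proof. rewrite /res3 /=; ring. Qed.

End CubicResultant.

Lemma rmorph_res3 (R S : comNzRingType) (f : {rmorphism R -> S}) g0 g1 g2 p0 p1 p2 :
  f (res3 g0 g1 g2 p0 p1 p2) = res3 (f g0) (f g1) (f g2) (f p0) (f p1) (f p2).
Proof. by rewrite /res3 !(rmorphD, rmorphN, rmorphM). Qed.

Section QuadraticMaps.
Variable K : numClosedFieldType.

Lemma closed_root (p : {poly K}) : (1 < size p)%N -> exists x, p.[x] = 0.
Proof.
by move=> sp; have /closed_rootP[x /rootP] : size p != 1%N; [case: size sp => [|[]]|exists x].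
Qed.

Lemma monic_cubic_split (g0 g1 g2 : K) : exists v1 v2 v3,
  [/\ g0 = - (v1 * v2 * v3), g1 = v1 * v2 + v1 * v3 + v2 * v3 &
      g2 = - (v1 + v2 + v3)].
Proof.
have [v1 h1] : exists v, v ^+ 3 + g2 * v ^+ 2 + g1 * v + g0 = 0.
  have [|v] := @closed_root (Poly [:: g0; g1; g2; 1]).
    by rewrite (PolyK (c := 0)) //= oner_eq0.
  rewrite horner_Poly /= => h; exists v; rewrite -[RHS]h; ring.
have [v2 h2] : exists v, v ^+ 2 + (g2 + v1) * v + (g1 + (g2 + v1) * v1) = 0.
  have [|v] := @closed_root (Poly [:: g1 + (g2 + v1) * v1; g2 + v1; 1]).
    by rewrite (PolyK (c := 0)) //= oner_eq0.
  rewrite horner_Poly /= => h; exists v; rewrite -[RHS]h; ring.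
exists v1, v2, (- (g2 + v1 + v2)); split; last by ring.
- apply/eqP; rewrite -subr_eq0; apply/eqP.
  transitivity ((v1 ^+ 3 + g2 * v1 ^+ 2 + g1 * v1 + g0) -
    v1 * (v2 ^+ 2 + (g2 + v1) * v2 + (g1 + (g2 + v1) * v1))); first by ring.
  by rewrite h1 h2 mulr0 subrr.
- apply/eqP; rewrite -subr_eq0; apply/eqP.
  by rewrite -[RHS]h2; ring.
Qed.

Lemma res3_eq0 (g0 g1 g2 p0 p1 p2 : K) : res3 g0 g1 g2 p0 p1 p2 = 0 ->
  exists v, v ^+ 3 + g2 * v ^+ 2 + g1 * v + g0 = 0 /\
            p0 + p1 * v + p2 * v ^+ 2 = 0.
Proof.
have [v1 [v2 [v3 [-> -> ->]]]] := monic_cubic_split g0 g1 g2.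
rewrite res3_roots => /eqP; rewrite !mulf_eq0.
by case/orP => [/orP[]|] /eqP h; [exists v1|exists v2|exists v3]; split=> //; ring.
Qed.

(** The quadratic form in [(s, t, v)] with coefficients [c] on
    [s^2, s t, t^2, s v, t v, v^2]. *)
Definition qform (R : comNzRingType) (c : 'I_6 -> R) (s t v : R) : R :=
  c 0 * s ^+ 2 + c 1 * (s * t) + c 2%:R * t ^+ 2 + (c 3%:R * s + c 4%:R * t) * v
  + c 5%:R * v ^+ 2.

(** A quadratic map of [K^3] with components [c1], [c2], [c3], in coordinates
    where the coefficient of [v^2] in the first component is one and that of
    [t^2] in the third one is nonzero. *)
Section Coordinates.
Variables c1 c2 c3 : 'I_6 -> K.
Hypothesis c15 : c1 5%:R = 1.
Hypothesis c32 : c3 2%:R != 0.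

Section Coefficients.
Variables (R : comNzRingType) (f : K -> R) (s t : R).

(** The parts of degree zero and one in [v] of the form with coefficients [c],
    with coefficients mapped to the ring [R] by [f]. *)
Definition low (c : 'I_6 -> K) : R := f (c 0) * s ^+ 2 + f (c 1) * (s * t) + f (c 2%:R) * t ^+ 2.
Definition mid (c : 'I_6 -> K) : R := f (c 3%:R) * s + f (c 4%:R) * t.

(** Write [q1], [q2], [q3] for the three components. The coefficients in [v] of
    the monic cubic [G = v q1 - s q3] are [gc0], [gc1], [gc2], those of
    [s q2 - t q1] are [pc0], [pc1], [pc2], and those of [q3 - v q2] reduced
    modulo [G], for [t = 1], are [ec0], [ec1], [ec2]. *)
Definition gc0 := - (s * low c3).
Definition gc1 := low c1 - s * mid c3.
Definition gc2 := mid c1 - s * f (c3 5%:R).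
Definition pc0 := s * low c2 - t * low c1.
Definition pc1 := s * mid c2 - t * mid c1.
Definition pc2 := s * f (c2 5%:R) - t.
Definition ec0 := low c3 + f (c2 5%:R) * gc0.
Definition ec1 := mid c3 - low c2 + f (c2 5%:R) * gc1.
Definition ec2 := f (c3 5%:R) - mid c2 + f (c2 5%:R) * gc2.

(** The resultants in [v] of [G] with [s q2 - t q1] and with [q3 - v q2]; the
    first one is a form of degree nine in [(s, t)], by [resP_homog]. *)
Definition resP := res3 gc0 gc1 gc2 pc0 pc1 pc2.
Definition resE := res3 gc0 gc1 gc2 ec0 ec1 ec2.

End Coefficients.

Lemma resE_resP (R : comNzRingType) (f : K -> R) s :
  s ^+ 3 * resE f s 1 = gc0 f s 1 * resP f s 1.
Proof.
rewrite -res3_scale -res3_mulv /resE.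
by congr res3; rewrite /pc0 /pc1 /pc2 /ec0 /ec1 /ec2 /gc0 /gc1 /gc2; ring.
Qed.

Lemma resP_homog l s t : resP id (l * s) (l * t) = l ^+ 9 * resP id s t.
Proof.
have lowM c : low id (l * s) (l * t) c = l ^+ 2 * low id s t c by rewrite /low; ring.
have midM c : mid id (l * s) (l * t) c = l * mid id s t c by rewrite /mid; ring.
rewrite -res3_homog /resP /pc0 /pc1 /pc2 /gc0 /gc1 /gc2 !lowM !midM.
congr res3; ring.
Qed.

Section Specialization.
Variables (R S : comNzRingType) (f : K -> R) (h : {rmorphism R -> S}) (s t : R).

Let lowE c : h (low f s t c) = low (h \o f) (h s) (h t) c.
Proof. by rewrite /low !(rmorphD, rmorphM, rmorphXn). Qed.

Let midE c : h (mid f s t c) = mid (h \o f) (h s) (h t) c.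
Proof. by rewrite /mid !(rmorphD, rmorphM). Qed.

Lemma rmorph_resP : h (resP f s t) = resP (h \o f) (h s) (h t).
Proof.
rewrite rmorph_res3 /resP /gc0 /gc1 /gc2 /pc0 /pc1 /pc2 -!lowE -!midE.
by rewrite !(rmorphB, rmorphN, rmorphM).
Qed.

Lemma rmorph_resE : h (resE f s t) = resE (h \o f) (h s) (h t).
Proof.
rewrite rmorph_res3 /resE /ec0 /ec1 /ec2 /gc0 /gc1 /gc2 -!lowE -!midE.
by rewrite !(rmorphD, rmorphB, rmorphN, rmorphM).
Qed.

End Specialization.

Lemma horner_eval_polyC (u : K) : horner_eval u \o polyC = id.
Proof. by apply: funext => c; rewrite /= horner_evalE hornerC. Qed.

Lemma resP_eval (s t : {poly K}) u : (resP polyC s t).[u] = resP id s.[u] t.[u].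
Proof. by rewrite -[LHS]/(horner_eval u _) rmorph_resP horner_eval_polyC. Qed.

Lemma resE_eval (s t : {poly K}) u : (resE polyC s t).[u] = resE id s.[u] t.[u].
Proof. by rewrite -[LHS]/(horner_eval u _) rmorph_resE horner_eval_polyC. Qed.

(** The vector [(s, t, v)] is an eigenvector, with eigenvalue [l]. *)
Definition eigen s t v l :=
  [/\ qform c1 s t v = l * s, qform c2 s t v = l * t & qform c3 s t v = l * v].

Lemma qform_low_mid c s t v : qform c s t v =
  low id s t c + mid id s t c * v + c 5%:R * v ^+ 2.
Proof. by []. Qed.

Lemma resP_root s t : resP id s t = 0 -> exists v,
  v * qform c1 s t v = s * qform c3 s t v /\
  s * qform c2 s t v = t * qform c1 s t v.
Proof.
case/res3_eq0 => v [hg hp]; exists v; rewrite !qform_low_mid c15.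
split; apply/eqP; rewrite -subr_eq0; apply/eqP.
  by rewrite -[RHS]hg /gc0 /gc1 /gc2 /=; ring.
by rewrite -[RHS]hp /pc0 /pc1 /pc2 /=; ring.
Qed.

Lemma resE_root : resE id 0 1 = 0 -> exists v,
  v * qform c1 0 1 v = 0 /\ qform c3 0 1 v = v * qform c2 0 1 v.
Proof.
case/res3_eq0 => v [hg he]; exists v; rewrite !qform_low_mid c15.
split; first by rewrite -[RHS]hg /gc0 /gc1 /gc2 /=; ring.
apply/eqP; rewrite -subr_eq0; apply/eqP.
transitivity ((ec0 id 0 1 + ec1 id 0 1 * v + ec2 id 0 1 * v ^+ 2) - c2 5%:R * (v ^+ 3 + gc2 id 0 1 * v ^+ 2 + gc1 id 0 1 * v
   + gc0 id 0 1)); last by rewrite hg he mulr0 subr0.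
by rewrite /ec0 /ec1 /ec2 /gc0 /gc1 /gc2 /=; ring.
Qed.

(** A zero [(s, t)] of [resP] with [s != 0] gives an eigenvector, hence if there
    is none then [resP] at [(s, 1)] is a monomial [c s^k]. The relation
    [resE_resP] compares it with [resE], which does not vanish at [(0, 1)]
    for the same reason, and yields [k = 2]. By homogeneity [resP] is [c s^2 t^7], which
    vanishes at [(1, 0)], a contradiction. *)
Lemma exists_eigenvector_coord : exists s t v l,
  [|| s != 0, t != 0 | v != 0] /\ eigen s t v l.
Proof.
apply: contrapT => noeig.
have eig s t v l : [|| s != 0, t != 0 | v != 0] -> ~ eigen s t v l.
  by move=> h1 h2; apply: noeig; exists s, t, v, l.
have P_nz (s t : K) : s != 0 -> resP id s t != 0.
  move=> s0; apply/eqP => /resP_root[v [h1 h2]].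
  apply: (eig s t v (qform c1 s t v / s)); rewrite ?s0 //; split.
  - by rewrite mulfVK.
  - by rewrite mulrAC -[_ * t]mulrC -h2 mulrAC mulfV // mul1r.
  - by rewrite mulrAC -[_ * v]mulrC h1 mulrAC mulfV // mul1r.
have E_nz : resE id 0 1 != 0.
  apply/eqP => /resE_root[v [/eqP]]; rewrite mulf_eq0 => /orP[/eqP-> h|/eqP h1 h2].
    case/eqP: c32; transitivity (qform c3 0 1 0); last by rewrite h mul0r.
    by rewrite /qform; ring.
  apply: (eig 0 1 v (qform c2 0 1 v)); first by rewrite oner_neq0 orbT.
  by split; rewrite ?h1 ?h2; ring.
pose N := resP polyC 'X 1; pose E := resE polyC 'X 1; pose Q3 := low polyC 'X 1 c3.
have N_eval u : N.[u] = resP id u 1.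
  by rewrite resP_eval hornerX hornerC.
have E_eval u : E.[u] = resE id u 1.
  by rewrite resE_eval hornerX hornerC.
have NE : 'X ^+ 2 * E = - (Q3 * N).
  apply: (@mulfI _ 'X); first by rewrite polyX_eq0.
  by rewrite mulrA -exprS resE_resP /gc0 -/Q3 -/N; ring.
have Nnz : N != 0.
  apply: contraNneq (P_nz 1 1 (oner_neq0 _)) => N0.
  by rewrite -N_eval N0 horner0.
have hornEE := (hornerM, hornerN, hornerD, hornerXn, hornerX, @hornerC K).
have Q30 : Q3.[0] = c3 2%:R.
  by rewrite /Q3 /low !hornerE /=; ring.
clearbody Q3 E N.
have [k [M M0 NM]] := multiplicity_XsubC N 0.
rewrite Nnz /= in M0; rewrite subr0 in NM.
have N_root u : N.[u] = 0 -> u = 0.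
  by move=> Nu; apply: contrapT => /eqP/(P_nz _ 1)/eqP[]; rewrite -N_eval Nu.
have [c Mc] : exists c, M = c%:P.
  have [sM|/closed_root[u Mu]] := leqP (size M) 1; first by exists M`_0; apply: size1_polyC.
  have u0 : u = 0 by apply: N_root; rewrite NM hornerM Mu mul0r.
  by case/negP: M0; rewrite u0 in Mu; apply/rootP.
have c0 : c != 0 by apply: contraNneq Nnz => c0; rewrite NM Mc c0 mul0r.
have k2 : k = 2%N.
  have [k2|k2|//] := ltngtP k 2%N.
    have : 'X ^+ (2 - k) * E = - (Q3 * c%:P).
      apply: (@mulfI _ ('X ^+ k)); first by rewrite expf_neq0 ?polyX_eq0.
      by rewrite mulrA -exprD subnKC 1?ltnW // NE NM Mc; ring.
    move/(congr1 (horner^~ 0)) => /=; rewrite !hornEE Q30 expr0n subn_eq0 leqNgt k2 mul0r.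
    by move/esym/eqP; rewrite oppr_eq0 mulf_eq0 (negPf c32) (negPf c0).
  have : E = - (Q3 * c%:P * 'X ^+ (k - 2)).
    apply: (@mulfI _ ('X ^+ 2)); first by rewrite expf_neq0 ?polyX_eq0.
    rewrite NE NM Mc -{1}(subnKC (ltnW k2)) exprD; ring.
  move/(congr1 (horner^~ 0)) => /=; rewrite !hornEE E_eval expr0n subn_eq0 leqNgt k2 mulr0 oppr0.
  by move/eqP; rewrite (negPf E_nz).
pose N' := resP polyC 1 'X.
have N'_eval u : N'.[u] = resP id 1 u by rewrite resP_eval hornerX hornerC.
clearbody N'.
have N'E : 'X * (N' - c%:P * 'X ^+ 7) = 0.
  apply: poly_all_roots => u; rewrite hornerM hornerX.
  have [->|u0] := eqVneq u 0; first by rewrite mul0r.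
  rewrite !hornEE N'_eval.
  have := N_eval u^-1; rewrite NM Mc k2 !hornEE => h.
  have := resP_homog u u^-1 1; rewrite mulfV // mulr1 => ->; rewrite -h.
  by field.
move: N'E => /eqP; rewrite mulf_eq0 polyX_eq0 /= subr_eq0 => /eqP N'E.
have /resP_root[v [h1 h2]] : resP id 1 0 = 0.
  by rewrite -N'_eval N'E !hornEE; ring.
apply: (eig 1 0 v (qform c1 1 0 v)); first by rewrite oner_neq0.
split; first by rewrite mulr1.
  by rewrite -[LHS]mul1r h2 mul0r mulr0.
by rewrite -[LHS]mul1r -h1 mulrC.
Qed.

End Coordinates.
End QuadraticMaps.

Section QuadraticMapEigenvector.
Variables (K : numClosedFieldType) (Q : 'I_3 -> 'M[K]_3).

(** The quadratic map of [K^3] whose components have the matrices [Q i]. *)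
Definition quadratic_map (y : 'rV[K]_3) : 'rV[K]_3 :=
  \row_i (y *m Q i *m y^T) 0 0.

Lemma notin_proper (m : nat) (U : 'M[K]_(m, 3)) : (\rank U < 3)%N ->
  exists v : 'rV[K]_3, ~~ (v <= U)%MS.
Proof.
move=> rU; have /row_subPn[i hi] : ~~ (1%:M <= U)%MS.
  by apply/negP => /mxrankS; rewrite mxrank1 leqNgt rU.
by exists (row i 1%:M).
Qed.

Lemma notin_two_proper (m1 m2 : nat) (U1 : 'M[K]_(m1, 3)) (U2 : 'M[K]_(m2, 3)) :
  (\rank U1 < 3)%N -> (\rank U2 < 3)%N ->
  exists v : 'rV[K]_3, ~~ (v <= U1)%MS /\ ~~ (v <= U2)%MS.
Proof.
move=> /notin_proper[v1 h1] /notin_proper[v2 h2].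
have [v12|] := boolP (v1 <= U2)%MS; last by exists v1.
have [v21|] := boolP (v2 <= U1)%MS; last by exists v2.
exists (v1 + v2); split.
  by apply: contra h1 => h; rewrite -(addrK v2 v1) addmx_sub // eqmx_opp.
by apply: contra h2 => h; rewrite -(addKr v1 v2) addmx_sub // eqmx_opp.
Qed.

Lemma rank_col2_lt3 (u v : 'rV[K]_3) : (\rank (col_mx u v) < 3)%N.
Proof. by rewrite (leq_ltn_trans (rank_leq_row _)). Qed.

Lemma comb_sub_col2 (x y : K) (u v : 'rV[K]_3) :
  ((x *: u + y *: v)%R <= col_mx u v)%MS.
Proof.
apply/submxP; exists (row_mx x%:M y%:M).
by rewrite mul_row_col !mul_scalar_mx.
Qed.

Lemma dependent_comb (x y z : K) (u v w : 'rV[K]_3) : x != 0 ->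
  x *: u + y *: v + z *: w = 0 -> (u <= col_mx v w)%MS.
Proof.
move=> x0 h; have -> : u = (- (y / x)) *: v + (- (z / x)) *: w.
  apply: (scalerI x0); rewrite scalerDr !scalerA !mulrN ![x * _]mulrC !divfK //.
  by apply/eqP; rewrite -subr_eq0 !scaleNr opprD !opprK addrA h.
exact: comb_sub_col2.
Qed.

(** The coefficients of [z *m M *m z^T] in the coordinates [z = (s, t, v)], in
    the order of [qform]. *)
Definition qcoefs (M : 'M[K]_3) (k : 'I_6) : K :=
  nth 0 [:: M 0 0; M 0 1 + M 1 0; M 1 1; M 0 2%:R + M 2%:R 0;
            M 1 2%:R + M 2%:R 1; M 2%:R 2%:R] k.

Lemma sum3 (V : nmodType) (F : 'I_3 -> V) : \sum_i F i = F 0 + F 1 + F 2%:R.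
Proof.
rewrite !big_ord_recl big_ord0 addr0 addrA.
by congr (F _ + F _ + F _); apply: val_inj.
Qed.

Lemma qform_qcoefs (M : 'M[K]_3) (z : 'rV[K]_3) :
  qform (qcoefs M) (z 0 0) (z 0 1) (z 0 2%:R) = (z *m M *m z^T) 0 0.
Proof.
rewrite mxE sum3 !mxE !sum3 /qform /qcoefs /=; ring.
Qed.

(** Every quadratic map of [K^3] to itself has an eigenvector; the eigenvalue is
    allowed to be zero. *)
Lemma exists_eigenvector :
  exists2 y, y != 0 & exists l, quadratic_map y = l *: y.
Proof.
apply: contrapT => noeig.
have eig y l : y != 0 -> quadratic_map y <> l *: y.
  by move=> h1 h2; apply: noeig; exists y => //; exists l.
set r := quadratic_map in eig.
(* If there is no eigenvector, then in a suitable basis (c, b, a) the vector  *)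
(* r(a) has a nonzero component on c and r(b) one on a.                       *)
pose a : 'rV[K]_3 := delta_mx 0 0.
have a0 : a != 0.
  by apply/eqP => /matrixP/(_ 0 0)/eqP; rewrite !mxE eqxx oner_eq0.
have [b hb] := notin_proper (rank_col2_lt3 a (r a)).
have [c [hc1 hc2]] := notin_two_proper (rank_col2_lt3 b a) (rank_col2_lt3 b (r b)).
have b0 : b != 0 by apply: contraNneq hb => ->; apply: sub0mx.
pose B : 'M[K]_3 := \matrix_(i < 3) nth 0 [:: c; b; a] i.
have zB (z : 'rV[K]_3) : z *m B = z 0 0 *: c + z 0 1 *: b + z 0 2%:R *: a.
  by rewrite mulmx_sum_row sum3 !rowK.
have Bu : B \in unitmx.
  rewrite -row_free_unit; apply: inj_row_free => z; rewrite zB => h.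
  have z0 : z 0 0 = 0.
    by apply: contraNeq hc1 => /dependent_comb; apply; apply: h.
  rewrite z0 scale0r add0r in h.
  have z1 : z 0 1 = 0.
    apply: contraNeq hb => /dependent_comb; apply.
    by rewrite -[RHS]h -[in RHS](addr0 (_ + _)); congr (_ + _); apply: (scale0r (r a)).
  rewrite z1 scale0r add0r in h.
  have z2 : z 0 2%:R = 0.
    by apply/eqP; move/eqP: h; rewrite scaler_eq0 (negPf a0) orbF.
  apply/rowP => i; rewrite mxE; case: i => -[|[|[|//]]] hi.
  - by rewrite -[RHS]z0; congr (z 0 _); apply: val_inj.
  - by rewrite -[RHS]z1; congr (z 0 _); apply: val_inj.
  - by rewrite -[RHS]z2; congr (z 0 _); apply: val_inj.
pose r' z := r (z *m B) *m invmx B.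
pose Q' j : 'M[K]_3 := \sum_i invmx B i j *: (B *m Q i *m B^T).
have r'E z j : r' z 0 j = (z *m Q' j *m z^T) 0 0.
  rewrite /r' mxE /Q' mulmx_sumr mulmx_suml summxE; apply: eq_bigr => i _.
  rewrite -scalemxAr -scalemxAl [RHS]mxE mulrC; congr (_ * _).
  by rewrite mxE trmx_mul !mulmxA.
have r'B z : r' z *m B = r (z *m B) by rewrite /r' mulmxKV.
pose e (k : 'I_3) : 'rV[K]_3 := delta_mx 0 k.
have eE j k : r' (e k) 0 j = Q' j k k.
  by rewrite r'E -rowE trmx_delta -colE !mxE.
have eB k : e k *m B = nth 0 [:: c; b; a] k by rewrite -rowE rowK.
set d := Q' 0 2%:R 2%:R.
have d0 : d != 0.
  rewrite /d -eE; apply: contraNneq hb => h.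
  have := r'B (e 2%:R); rewrite eB /= zB h scale0r add0r => ra.
  have ha1 : r' (e 2%:R) 0 1 != 0.
    apply/eqP => h1; apply: (eig a (r' (e 2%:R) 0 2%:R)) => //.
    by rewrite -ra h1 scale0r add0r.
  apply: (dependent_comb (y := r' (e 2%:R) 0 2%:R) (z := -1) ha1).
  by rewrite ra scaleN1r subrr.
have d1 : Q' 2%:R 1 1 != 0.
  rewrite -eE; apply: contraNneq hc2 => h.
  have := r'B (e 1); rewrite eB /= zB h scale0r addr0 => rb.
  have hb0 : r' (e 1) 0 0 != 0.
    apply/eqP => h1; apply: (eig b (r' (e 1) 0 1)) => //.
    by rewrite -rb h1 scale0r add0r.
  apply: (dependent_comb (y := r' (e 1) 0 1) (z := -1) hb0).
  by rewrite rb scaleN1r subrr.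
pose cf j k := d^-1 * qcoefs (Q' j) k.
have cf1 : cf 0 5%:R = 1 by rewrite /cf /qcoefs /= mulVf.
have cf3 : cf 2%:R 2%:R != 0 by rewrite /cf /qcoefs /= mulf_neq0 ?invr_eq0.
have [s [t [v [l [nz [h1 h2 h3]]]]]] := exists_eigenvector_coord (cf 1) cf1 cf3.
pose z : 'rV[K]_3 := \row_i nth 0 [:: s; t; v] i.
have cfE j : qform (cf j) s t v = d^-1 * r' z 0 j.
  by rewrite r'E -qform_qcoefs !mxE /qform /cf /=; ring.
have zE : r' z = (d * l) *: z.
  apply/rowP => j; rewrite [RHS]mxE -mulrA.
  have -> : r' z 0 j = d * qform (cf j) s t v by rewrite cfE mulrA divff // mul1r.
  congr (_ * _); rewrite mxE; case: j => -[|[|[|//]]] hj /=.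
  - by rewrite -h1; congr (qform (cf _) _ _ _); apply: val_inj.
  - by rewrite -h2; congr (qform (cf _) _ _ _); apply: val_inj.
  - by rewrite -h3; congr (qform (cf _) _ _ _); apply: val_inj.
apply: (eig (z *m B) (d * l)); last by rewrite -r'B zE scalemxAl.
apply: contraTneq nz => /(congr1 (mulmx^~ (invmx B))); rewrite mul0mx mulmxK // => z0.
have z0E i : z 0 i = 0 by rewrite z0 mxE.
have := z0E 0; have := z0E 1; have := z0E 2%:R; rewrite !mxE /= => -> -> ->.
by rewrite eqxx.
Qed.

End QuadraticMapEigenvector.

(** * Planes and their Pluecker coordinates *)

Section ThreeByThree.
Variable R : comNzRingType.

(** The determinant of three column vectors. *)
Definition det3 (x y z : 'cV[R]_3) : R :=
  x 0 0 * (y 1 0 * z 2%:R 0 - y 2%:R 0 * z 1 0)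
  - y 0 0 * (x 1 0 * z 2%:R 0 - x 2%:R 0 * z 1 0)
  + z 0 0 * (x 1 0 * y 2%:R 0 - x 2%:R 0 * y 1 0).

Lemma det_mx33 (A : 'M[R]_3) : \det A = det3 (col 0 A) (col 1 A) (col 2%:R A).
Proof.
rewrite (expand_det_row _ 0) sum3 /cofactor.
rewrite !(expand_det_row _ 0) !big_ord_recl !big_ord0 /cofactor !det_mx11 !mxE /=.
have l00 : lift ord0 (0 : 'I_1) = 1 :> 'I_2 by apply: val_inj.
have e1 : lift 0 (0 : 'I_2) = 1 :> 'I_3 by apply: val_inj.
have e2 : lift 0 (1 : 'I_2) = 2%:R :> 'I_3 by apply: val_inj.
have e3 : lift 1 (0 : 'I_2) = 0 :> 'I_3 by apply: val_inj.
have e4 : lift 1 (1 : 'I_2) = 2%:R :> 'I_3 by apply: val_inj.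
have e5 : lift 2%:R (0 : 'I_2) = 0 :> 'I_3 by apply: val_inj.
have e6 : lift 2%:R (1 : 'I_2) = 1 :> 'I_3 by apply: val_inj.
have e7 : lift 0 (0 : 'I_1) = 1 :> 'I_2 by apply: val_inj.
have e8 : lift 1 (0 : 'I_1) = 0 :> 'I_2 by apply: val_inj.
rewrite ?l00 ?e7 ?e8 ?e1 ?e2 ?e3 ?e4 ?e5 ?e6 /det3 !mxE.
rewrite !(addr0, expr0, expr1, mul1r) /=.
ring.
Qed.

Lemma det_colsub n (A : 'M[R]_(3, n)) (s : {ffun 'I_3 -> 'I_n}) :
  \det (colsub s A) = det3 (col (s 0) A) (col (s 1) A) (col (s 2%:R) A).
Proof. by rewrite det_mx33 /det3 !mxE. Qed.

Lemma sum4 (V : nmodType) (F : 'I_4 -> V) :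
  \sum_i F i = F 0 + F 1 + F 2%:R + F 3%:R.
Proof.
rewrite !big_ord_recl big_ord0 addr0 !addrA.
by congr (F _ + F _ + F _ + F _); apply: val_inj.
Qed.

Lemma sum6 (V : nmodType) (F : 'I_6 -> V) :
  \sum_i F i = F 0 + F 1 + F 2%:R + F 3%:R + F 4%:R + F 5%:R.
Proof.
rewrite !big_ord_recl big_ord0 addr0 !addrA.
by congr (F _ + F _ + F _ + F _ + F _ + F _); apply: val_inj.
Qed.

End ThreeByThree.

Lemma ord3P (P : 'I_3 -> Prop) : P 0 -> P 1 -> P 2%:R -> forall i, P i.
Proof.
move=> P0 P1 P2 [[|[|[|//]]] hi].
- by move: P0; congr P; apply: val_inj.
- by move: P1; congr P; apply: val_inj.
- by move: P2; congr P; apply: val_inj.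
Qed.

Section Pluecker.
Variable K : fieldType.

Lemma det3_mulmx (B : 'M[K]_3) x y z :
  det3 (B *m x) (B *m y) (B *m z) = \det B * det3 x y z.
Proof. rewrite det_mx33 /det3 !mxE !sum3; ring. Qed.

(** Matrices with proportional Pluecker coordinates have the same row space. *)
Lemma pluecker_span n (A A' : 'M[K]_(3, n)) c : row_free A -> c != 0 ->
  (forall s : {ffun 'I_3 -> 'I_n}, \det (colsub s A) = c * \det (colsub s A')) ->
  exists2 B, B \in unitmx & A = B *m A'.
Proof.
move=> rA c0 h.
have rAT : row_full A^T by rewrite /row_full mxrank_tr.
have [s sA] : exists s : {ffun 'I_3 -> 'I_n}, colsub s A \in unitmx.
  exists (fullrankfun rAT); rewrite -unitmx_tr.
  have -> : (colsub (fullrankfun rAT) A)^T = rowsub (fullrankfun rAT) A^T.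
    by apply/matrixP => i j; rewrite !mxE.
  exact: fullrowsub_unit.
have sA' : colsub s A' \in unitmx.
  move: sA; rewrite !unitmxE !unitfE h; apply: contraNneq => ->.
  by rewrite mulr0.
pose Y := invmx (colsub s A) *m A; pose Y' := invmx (colsub s A') *m A'.
have YA : colsub s A *m Y = A by rewrite mulKVmx.
have YA' : colsub s A' *m Y' = A' by rewrite mulKVmx.
suff YY' : Y = Y'.
  exists (colsub s A *m invmx (colsub s A')); first by rewrite unitmx_mul unitmx_inv sA.
  by rewrite -mulmxA -/Y' -YY' YA.
have d0 : \det (colsub s A') != 0 by rewrite -unitfE -unitmxE.
(* The coordinates in the basis given by the columns s are quotients of       *)
(* Pluecker coordinates.                                                      *)
have cramer (D : 'M[K]_(3, n)) (X : 'M[K]_(3, n)) : colsub s D *m X = D ->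
    forall i j, X i j * \det (colsub s D) =
      \det (colsub [ffun k => if k == i then j else s k] D).
  move=> DX i j.
  have DE k : D k j = \sum_l D k (s l) * X l j.
    by rewrite -[in LHS]DX mxE; apply: eq_bigr => l _; rewrite mxE.
  rewrite !det_colsub !ffunE.
  by move: i; apply: ord3P => /=; rewrite /det3 !mxE !DE !sum3; ring.
apply/matrixP => i j; apply: (mulIf d0); apply: (mulfI c0).
by rewrite !(cramer _ _ YA') mulrCA -h (cramer _ _ YA) h.
Qed.

End Pluecker.

Section QuadraticFamilies.
Variable K : numClosedFieldType.

(** Families of planes whose Pluecker coordinates are quadratic forms in the
    parameter. They are given by a function [Psi S u v w] which is linear in
    each argument; for [S = t^T *m t] it is the Pluecker coordinate, on the
    linear forms [u], [v], [w], of the plane with parameter [t]. *)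
Definition multilinear (Psi : 'M[K]_4 -> 'cV[K]_6 -> 'cV[K]_6 -> 'cV[K]_6 -> K) :=
  [/\ forall x S S' u v w, Psi (x *: S + S') u v w = x * Psi S u v w + Psi S' u v w,
      forall x S u u' v w, Psi S (x *: u + u') v w = x * Psi S u v w + Psi S u' v w,
      forall x S u v v' w, Psi S u (x *: v + v') w = x * Psi S u v w + Psi S u v' w &
      forall x S u v w w', Psi S u v (x *: w + w') = x * Psi S u v w + Psi S u v w'].

(** Injectivity of [Psi] on symmetric matrices. It makes the family an embedding
    of the projective space, since [t^T *m t] is the second Veronese map. *)
Definition separating (Psi : 'M[K]_4 -> 'cV[K]_6 -> 'cV[K]_6 -> 'cV[K]_6 -> K) :=
  forall S, S^T = S -> (forall u v w, Psi S u v w = 0) -> S = 0.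

(** The Pluecker coordinates of the family transported by [g], which maps the
    coordinates of [Psi] to those of the ambient space. *)
Definition family_forms (Psi : 'M[K]_4 -> 'cV[K]_6 -> 'cV[K]_6 -> 'cV[K]_6 -> K)
    (g : 'M[K]_6) : pluecker_forms K := fun s =>
  \sum_i \sum_j Psi (delta_mx i j) (col (s 0) g) (col (s 1) g) (col (s 2%:R) g)
    *: ('X_i * 'X_j).

Lemma linear_sum (V : lmodType K) (f : V -> K) :
  (forall x u v, f (x *: u + v) = x * f u + f v) ->
  forall (I : finType) (c : I -> K) (u : I -> V),
    f (\sum_i c i *: u i) = \sum_i c i * f (u i).
Proof.
move=> fL I c u; have f0 : f 0 = 0.
  by have := fL (-1) 0 0; rewrite scaler0 addr0 mulN1r addNr.
by elim/big_rec2: _ => // i y x _ <-; rewrite fL.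
Qed.

Section Family.
Variables (Psi : 'M[K]_4 -> 'cV[K]_6 -> 'cV[K]_6 -> 'cV[K]_6 -> K) (g : 'M[K]_6).
Hypotheses (PsiL : multilinear Psi) (g_unit : g \in unitmx).

(** A trilinear map is zero if it is zero on the columns of an invertible
    matrix. *)
Lemma trilinear_zero (T : 'cV[K]_6 -> 'cV[K]_6 -> 'cV[K]_6 -> K) :
  (forall x u u' v w, T (x *: u + u') v w = x * T u v w + T u' v w) ->
  (forall x u v v' w, T u (x *: v + v') w = x * T u v w + T u v' w) ->
  (forall x u v w w', T u v (x *: w + w') = x * T u v w + T u v w') ->
  (forall s : {ffun 'I_3 -> 'I_6}, T (col (s 0) g) (col (s 1) g) (col (s 2%:R) g) = 0) ->
  forall u v w, T u v w = 0.
Proof.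
move=> L1 L2 L3 h.
have gE (u : 'cV[K]_6) : u = \sum_k (invmx g *m u) k 0 *: col k g.
  rewrite -[LHS](mulKVmx g_unit); apply/colP => i; rewrite mxE summxE.
  by apply: eq_bigr => k _; rewrite !mxE mulrC.
have h1 i j k : T (col i g) (col j g) (col k g) = 0.
  by have := h [ffun l : 'I_3 => nth i [:: i; j; k] l]; rewrite !ffunE.
move=> u v w; rewrite (gE u) (linear_sum (fun x u u' => L1 x u u' v w)).
rewrite big1 // => i _; rewrite (gE v).
rewrite (linear_sum (fun x v v' => L2 x (col i g) v v' w)) big1 ?mulr0 // => j _.
rewrite (gE w) (linear_sum (fun x w w' => L3 x (col i g) (col j g) w w')).
by rewrite big1 ?mulr0 // => k _; rewrite h1 mulr0.
Qed.

Lemma Psi_zero S :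
  (forall s : {ffun 'I_3 -> 'I_6},
     Psi S (col (s 0) g) (col (s 1) g) (col (s 2%:R) g) = 0) ->
  forall u v w, Psi S u v w = 0.
Proof. by case: PsiL => _ L1 L2 L3; apply: trilinear_zero. Qed.

Lemma Psi_sum_delta (c : 'I_4 -> 'I_4 -> K) u v w :
  \sum_i \sum_j c i j * Psi (delta_mx i j) u v w = Psi (\matrix_(i, j) c i j) u v w.
Proof.
have [L0 _ _ _] := PsiL; rewrite pair_big /=.
rewrite -(linear_sum (fun x S S' => L0 x S S' u v w)); congr Psi.
rewrite [RHS]matrix_sum_delta pair_big /=.
by apply: eq_bigr => p _; rewrite mxE.
Qed.

Lemma family_forms_homog s : family_forms Psi g s \is 2.-homog.
Proof.
apply: rpred_sum => i _; apply: rpred_sum => j _; apply: dhomogZ.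
by apply: (@dhomogM _ _ _ 1%N _ 1%N); rewrite dhomogX /= mdeg1.
Qed.

Lemma family_forms_eval s (t : 'rV[K]_4) : (family_forms Psi g s).@[t 0] =
  Psi (t^T *m t) (col (s 0) g) (col (s 1) g) (col (s 2%:R) g).
Proof.
rewrite raddf_sum; transitivity (\sum_i \sum_j t 0 i * t 0 j *
    Psi (delta_mx i j) (col (s 0) g) (col (s 1) g) (col (s 2%:R) g)).
  apply: eq_bigr => i _; rewrite raddf_sum; apply: eq_bigr => j _ /=.
  by rewrite mevalZ mevalM !mevalXU mulrC.
rewrite Psi_sum_delta; congr Psi; apply/matrixP => i j.
by rewrite !mxE big_ord1 mxE.
Qed.

Lemma family_forms_diff s (t v : 'rV[K]_4) :
  \sum_(i < 4) v 0 i * ((family_forms Psi g s)^`M(i)).@[t 0] =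
  Psi (t^T *m v + v^T *m t) (col (s 0) g) (col (s 1) g) (col (s 2%:R) g).
Proof.
pose c i j := v 0 i * t 0 j + t 0 i * v 0 j.
transitivity (\sum_i \sum_j c i j *
    Psi (delta_mx i j) (col (s 0) g) (col (s 1) g) (col (s 2%:R) g)).
  pose G i j := Psi (delta_mx i j) (col (s 0) g) (col (s 1) g) (col (s 2%:R) g).
  transitivity (\sum_k \sum_i \sum_j G i j *
      (v 0 k * (((k == i)%:R * t 0 j) + t 0 i * (k == j)%:R))).
    apply: eq_bigr => k _; rewrite (raddf_sum (mderiv k)) (raddf_sum (meval _)) mulr_sumr.
    apply: eq_bigr => i _; rewrite (raddf_sum (mderiv k)) (raddf_sum (meval _)) mulr_sumr.
    apply: eq_bigr => j _ /=; rewrite mderivZ mderivM !mderivXU mevalZ mevalD !mevalM.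
    by rewrite !mevalXU !rmorph_nat -/(G i j); ring.
  rewrite exchange_big; apply: eq_bigr => i _ /=.
  rewrite exchange_big; apply: eq_bigr => j _ /=.
  rewrite -mulr_sumr mulrC; congr (_ * _); rewrite /c.
  under eq_bigr do rewrite mulrDr.
  rewrite big_split /=; congr (_ + _).
    rewrite (bigD1 i) //= eqxx mul1r big1 ?addr0 // => k ki.
    by rewrite (negPf ki) mul0r mulr0.
  rewrite (bigD1 j) //= eqxx mulr1 big1 ?addr0 1?mulrC // => k ki.
  by rewrite (negPf ki) !mulr0.
rewrite Psi_sum_delta; congr Psi; apply/matrixP => i j.
by rewrite !mxE !big_ord1 !mxE /c addrC.
Qed.

(** For every parameter there is a plane, spanned by the rows of [W], with the
    prescribed Pluecker coordinates. *)
Definition representable := forall t : 'rV[K]_4, t != 0 ->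
  exists (W : 'M[K]_(3, 6)) c, c != 0 /\
    forall u v w, det3 (W *m u) (W *m v) (W *m w) = c * Psi (t^T *m t) u v w.

Hypothesis Psi_sep : separating Psi.

Lemma square_neq0 (t : 'rV[K]_4) : t != 0 -> t^T *m t != 0.
Proof.
case/rV0Pn => i ti; apply: contra ti => /eqP/matrixP/(_ i i).
by rewrite !mxE big_ord1 mxE => /eqP; rewrite mulf_eq0 orbb.
Qed.

Lemma square_sym (t : 'rV[K]_4) : (t^T *m t)^T = t^T *m t.
Proof. by rewrite trmx_mul trmxK. Qed.

Lemma represented_row_free (t : 'rV[K]_4) (W : 'M[K]_(3, 6)) c : t != 0 -> c != 0 ->
  (forall u v w, det3 (W *m u) (W *m v) (W *m w) = c * Psi (t^T *m t) u v w) ->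
  row_free W.
Proof.
move=> t0 c0 hW; apply: inj_row_free => x xW.
apply: contrapT => /eqP xnz; case/eqP: (square_neq0 t0).
apply: Psi_sep => [|u v w]; first exact: square_sym.
apply: (mulfI c0); rewrite -hW mulr0.
pose M : 'M[K]_3 := \matrix_(i, j) nth 0 [:: (W *m u) i 0; (W *m v) i 0; (W *m w) i 0] j.
have -> : det3 (W *m u) (W *m v) (W *m w) = \det M by rewrite det_mx33 /det3 !mxE.
have xM : x *m M = 0.
  have xWu (u' : 'cV[K]_6) : \sum_i x 0 i * (W *m u') i 0 = 0.
    have /matrixP/(_ 0 0) := congr1 (fun M : 'rV[K]_6 => M *m u') xW.
    by rewrite -mulmxA mul0mx mxE [RHS]mxE.
  apply/rowP => j; rewrite !mxE; move: j.
  by apply: ord3P; under eq_bigr do rewrite mxE /=; apply: xWu.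
apply: contrapT => /eqP; rewrite -unitfE -unitmxE => Mu.
by case/eqP: xnz; rewrite -(mulmxK Mu x) xM mul0mx.
Qed.

Lemma col_mulmx m n p (A : 'M[K]_(m, n)) (B : 'M[K]_(n, p)) j :
  col j (A *m B) = A *m col j B.
Proof. by rewrite !colE mulmxA. Qed.

Lemma det_colsub_mul (W : 'M[K]_(3, 6)) (s : {ffun 'I_3 -> 'I_6}) :
  \det (colsub s (W *m g)) =
  det3 (W *m col (s 0) g) (W *m col (s 1) g) (W *m col (s 2%:R) g).
Proof. by rewrite det_colsub !col_mulmx. Qed.

(** The planes with parameter [t], in terms of one matrix [W] with the right
    Pluecker coordinates. *)
Lemma plane_atP (t : 'rV[K]_4) (W : 'M[K]_(3, 6)) c A : t != 0 -> c != 0 ->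
  (forall u v w, det3 (W *m u) (W *m v) (W *m w) = c * Psi (t^T *m t) u v w) ->
  plane_at (family_forms Psi g) t A <->
  exists2 B, B \in unitmx & A = B *m W *m g.
Proof.
move=> t0 c0 hW; split=> [[rA [d [d0 hA]]]|[B Bu ->]].
  have [|s|B Bu AE] := @pluecker_span _ _ A (W *m g) (d / c) rA.
  - by rewrite mulf_neq0 ?invr_eq0.
  - by rewrite hA family_forms_eval det_colsub_mul hW mulrA divfK.
  by exists B => //; rewrite -mulmxA.
split.
  have fB : row_full B by rewrite row_full_unit.
  rewrite /row_free mxrankMfree ?row_free_unit // (eqmxMfull W fB).
  exact: represented_row_free hW.
exists (\det B * c); split.
  by rewrite mulf_neq0 // -unitfE -unitmxE.
by move=> s; rewrite det_colsub_mul -!mulmxA !det3_mulmx hW family_forms_eval mulrA.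
Qed.

(** The map from parameters to Pluecker coordinates is the second Veronese
    embedding followed by the injective linear map [Psi]. *)
Lemma family_P3 : representable -> P3_family_of_planes (family_forms Psi g).
Proof.
move=> rep; split.
- by exists 2 => s; apply: family_forms_homog.
- move=> t t0; have [W [c [c0 hW]]] := rep t t0.
  exists (W *m g); apply/(plane_atP _ t0 c0 hW).
  by exists 1%:M; rewrite ?unitmx1 ?mul1mx.
- move=> t t' A t0 t0' [rA [c [c0 hA]]] [_ [c' [c0' hA']]].
  have : t'^T *m t' - (c / c') *: (t^T *m t) = 0.
    apply: Psi_sep; first by rewrite linearB linearZ /= !square_sym.
    apply: Psi_zero => s; have [L0 _ _ _] := PsiL.
    rewrite addrC -scaleNr L0 -!family_forms_eval; apply: (mulfI c0').
    by rewrite mulrDr mulr0 -hA' hA mulNr mulrN mulrA mulrCA divff // mulr1 addNr.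
  move/eqP; rewrite subr_eq0 => /eqP h.
  have hij i j : t' 0 i * t' 0 j = c / c' * (t 0 i * t 0 j).
    by move/matrixP/(_ i j): h; rewrite !mxE !big_ord1 !mxE.
  have [i ti] := rV0Pn _ t0'.
  exists (c / c' * t 0 i / t' 0 i); apply/rowP => j; rewrite mxE.
  by apply: (mulfI ti); rewrite hij; field; rewrite c0' ti.
- move=> t v t0 h.
  have hS : t^T *m v + v^T *m t = 0.
    apply: Psi_sep; first by rewrite linearD /= !trmx_mul !trmxK addrC.
    by apply: Psi_zero => s; rewrite -family_forms_diff h.
  have hij i j : t 0 i * v 0 j + v 0 i * t 0 j = 0.
    by move/matrixP/(_ i j): hS; rewrite !mxE !big_ord1 !mxE.
  have [i ti] := rV0Pn _ t0.
  have vi : v 0 i = 0.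
    have /eqP := hij i i; rewrite mulrC -mulr2n mulrn_eq0 /= mulf_eq0 (negPf ti) orbF.
    by move/eqP.
  apply/rowP => j; rewrite mxE; have /eqP := hij i j.
  by rewrite vi mul0r addr0 mulf_eq0 (negPf ti) => /eqP.
Qed.

End Family.
End QuadraticFamilies.

(** * The two families of planes on a smooth quadric *)

Lemma ord4P (P : 'I_4 -> Prop) : P 0 -> P 1 -> P 2%:R -> P 3%:R -> forall i, P i.
Proof.
move=> P0 P1 P2 P3 [[|[|[|[|//]]]] hi].
- by move: P0; congr P; apply: val_inj.
- by move: P1; congr P; apply: val_inj.
- by move: P2; congr P; apply: val_inj.
- by move: P3; congr P; apply: val_inj.
Qed.

Lemma ord6P (P : 'I_6 -> Prop) :
  P 0 -> P 1 -> P 2%:R -> P 3%:R -> P 4%:R -> P 5%:R -> forall i, P i.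
Proof.
move=> P0 P1 P2 P3 P4 P5 [[|[|[|[|[|[|//]]]]]] hi].
- by move: P0; congr P; apply: val_inj.
- by move: P1; congr P; apply: val_inj.
- by move: P2; congr P; apply: val_inj.
- by move: P3; congr P; apply: val_inj.
- by move: P4; congr P; apply: val_inj.
- by move: P5; congr P; apply: val_inj.
Qed.

Section ExplicitFamily.
Variable R : comNzRingType.
Implicit Types (u v w : 'cV[R]_6) (x y : 'rV[R]_6).

(** The coordinates of [R^6] are [(a, b)] with [a] and [b] in [R^3]; this is the
    matrix of the quadratic form [2 a.b]. With the coordinates [a] on
    [e0 ^ e1, e0 ^ e2, e0 ^ e3] and [b] on [e2 ^ e3, e3 ^ e1, e1 ^ e2], the
    quadric is the Grassmannian of lines of [P^3]. *)
Definition hyperbolic : 'M[R]_6 := \matrix_(i, j) ((j == i + 3%:R)%:R).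

(** The rows are the bivectors [t ^ e_i], for the standard basis of [R^4]; their
    span is the plane of the lines which pass through the point [t]. *)
Definition wedge_mx (t : 'I_4 -> R) : 'M[R]_(4, 6) := \matrix_(i, j)
  nth 0 (nth [::] [:: [:: - t 1; - t 2%:R; - t 3%:R; 0; 0; 0];
                      [:: t 0; 0; 0; 0; t 3%:R; - t 2%:R];
                      [:: 0; t 0; 0; - t 3%:R; 0; t 1];
                      [:: 0; 0; t 0; t 2%:R; - t 1; 0]] i) j.

(** The alternating matrix of the dual of the bivector [x], so that [t ^ x = 0]
    amounts to [t *m skew_mx x = 0]. *)
Definition skew_mx x : 'M[R]_4 := \matrix_(i, j)
  nth 0 (nth [::]
    [:: [:: 0; x 0 3%:R; x 0 4%:R; x 0 5%:R];
        [:: - x 0 3%:R; 0; x 0 2%:R; - x 0 1];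
        [:: - x 0 4%:R; - x 0 2%:R; 0; x 0 0];
        [:: - x 0 5%:R; x 0 1; - x 0 0; 0]] i) j.

(** The determinant of the [a] parts of three linear forms. *)
Definition det_a (u v w : 'I_6 -> R) : R :=
  u 0 * (v 1 * w 2%:R - v 2%:R * w 1)
  - v 0 * (u 1 * w 2%:R - u 2%:R * w 1)
  + w 0 * (u 1 * v 2%:R - u 2%:R * v 1).

(** The product of the [a] part of [u] with the [b] part of [v]. *)
Definition dot_ab (u v : 'I_6 -> R) : R := u 0 * v 3%:R + u 1 * v 4%:R + u 2%:R * v 5%:R.

(** One of the three terms of [psi6] which are obtained from each other by cyclic
    permutation of [u], [v], [w]. *)
Definition psi6_part (S : 'M[R]_4) (u v w : 'I_6 -> R) : R :=
  S 0 1 * (dot_ab u w * v 0 - u 0 * dot_ab v w)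
  + S 0 2%:R * (dot_ab u w * v 1 - u 1 * dot_ab v w)
  + S 0 3%:R * (dot_ab u w * v 2%:R - u 2%:R * dot_ab v w)
  + (S 1 1 * u 0 + S 2%:R 1 * u 1 + S 3%:R 1 * u 2%:R)
    * (v 4%:R * w 5%:R - v 5%:R * w 4%:R)
  + (S 1 2%:R * u 0 + S 2%:R 2%:R * u 1 + S 3%:R 2%:R * u 2%:R)
    * (v 5%:R * w 3%:R - v 3%:R * w 5%:R)
  + (S 1 3%:R * u 0 + S 2%:R 3%:R * u 1 + S 3%:R 3%:R * u 2%:R)
    * (v 3%:R * w 4%:R - v 4%:R * w 3%:R).

(** The function linear in [S] which, at [S = t^T *m t], gives the Pluecker
    coordinates of the plane spanned by the bivectors [t ^ y]. The minors of
    three rows of [wedge_mx t] contain, up to sign, the additional factor [t_i],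
    where [i] is the row left out; see [det3_wedge]. *)
Definition psi6 (S : 'M[R]_4) (u v w : 'I_6 -> R) : R :=
  S 0 0 * det_a u v w + psi6_part S u v w + psi6_part S v w u + psi6_part S w u v.

Definition Psi6 (S : 'M[R]_4) u v w : R := psi6 S (u^~ 0) (v^~ 0) (w^~ 0).

Lemma det3_wedge (t : 'rV[R]_4) (i : 'I_4) u v w (W := row' i (wedge_mx (t 0))) :
  det3 (W *m u) (W *m v) (W *m w) = (-1) ^+ i * t 0 i * Psi6 (t^T *m t) u v w.
Proof.
have mxEE j (z : 'cV[R]_6) : (W *m z) j 0 = \sum_k wedge_mx (t 0) (lift i j) k * z k 0.
  by rewrite mxE; apply: eq_bigr => k _; rewrite mxE.
have SE j k : (t^T *m t) j k = t 0 j * t 0 k by rewrite mxE big_ord1 mxE.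
rewrite /det3 !mxEE /Psi6 /psi6 /psi6_part /det_a /dot_ab !SE {SE mxEE W}.
by move: i; apply: ord4P; rewrite !sum6 !mxE /=; ring.
Qed.

End ExplicitFamily.

Section RankSix.
Variable K : numClosedFieldType.
Implicit Types (x y : 'rV[K]_6).
Local Notation J := (hyperbolic K).

Lemma hyperbolic_mulE x (k : 'I_6) : (x *m J) 0 k = x 0 (k + 3%:R).
Proof.
rewrite mxE (bigD1 (k + 3%:R)) //= mxE big1 => [|l lk].
  by rewrite -addrA (_ : 3%:R + 3%:R = 0) ?addr0 ?eqxx ?mulr1 ?addr0 //; apply: val_inj.
rewrite mxE (_ : _ == _ = false) ?mulr0 //; apply: contraNF lk => /eqP ->.
by rewrite -addrA (_ : 3%:R + 3%:R = 0) ?addr0 //; apply: val_inj.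
Qed.

Lemma hyperbolic_nth x (k : 'I_6) : (x *m J) 0 k =
  nth 0 [:: x 0 3%:R; x 0 4%:R; x 0 5%:R; x 0 0; x 0 1; x 0 2%:R] k.
Proof.
by rewrite hyperbolic_mulE; move: k; apply: ord6P; congr (x 0 _); apply: val_inj.
Qed.

Lemma hyperbolic_sym : J^T = J.
Proof.
by apply/matrixP => i j; rewrite !mxE; move: i; apply: ord6P; move: j; apply: ord6P.
Qed.

Lemma hyperbolic_sqr : J *m J = 1%:M.
Proof.
apply/row_matrixP => i; rewrite row_mul; apply/rowP => k.
by rewrite hyperbolic_mulE !mxE (inj_eq (addIr _)) eq_sym.
Qed.

Lemma hyperbolic_unit : J \in unitmx.
Proof. by have [] := mulmx1_unit hyperbolic_sqr. Qed.

Lemma hyperbolic_formE x y : (x *m J *m y^T) 0 0 =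
  x 0 3%:R * y 0 0 + x 0 4%:R * y 0 1 + x 0 5%:R * y 0 2%:R
  + x 0 0 * y 0 3%:R + x 0 1 * y 0 4%:R + x 0 2%:R * y 0 5%:R.
Proof.
rewrite mxE sum6 !hyperbolic_mulE ![y^T _ _]mxE.
by congr (x 0 _ * _ + x 0 _ * _ + x 0 _ * _ + x 0 _ * _ + x 0 _ * _ + x 0 _ * _);
  apply: val_inj.
Qed.

(** The alternating matrix of the bivector [x] itself. The matrices [skew_mx x]
    and [dual_skew x] describe the action of [x], as an element of the Clifford
    algebra of the hyperbolic form, from each of the two half-spin
    representations to the other. *)
Definition dual_skew x := skew_mx (x *m J).

Lemma dual_skewE x : dual_skew x = \matrix_(i, j)
  nth 0 (nth [::]
    [:: [:: 0; x 0 0; x 0 1; x 0 2%:R];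
        [:: - x 0 0; 0; x 0 5%:R; - x 0 4%:R];
        [:: - x 0 1; - x 0 5%:R; 0; x 0 3%:R];
        [:: - x 0 2%:R; x 0 4%:R; - x 0 3%:R; 0]] i) j.
Proof.
have E k l : l = k + 3%:R -> (x *m J) 0 k = x 0 l by move=> ->; rewrite hyperbolic_mulE.
rewrite /dual_skew /skew_mx; apply/matrixP => i j; rewrite ![(\matrix_(_, _) _) _ _]mxE.
rewrite (E 0 3%:R) ?(E 1 4%:R) ?(E 2%:R 5%:R) ?(E 3%:R 0) ?(E 4%:R 1) ?(E 5%:R 2%:R) //;
  exact: val_inj.
Qed.

Lemma clifford x y : skew_mx x *m dual_skew y + skew_mx y *m dual_skew x =
  - (x *m J *m y^T) 0 0 *: 1%:M.
Proof.
apply/matrixP => i j; rewrite hyperbolic_formE !dual_skewE !mxE !sum4 !mxE.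
by move: i; apply: ord4P; move: j; apply: ord4P; rewrite /=; ring.
Qed.

Lemma clifford_dual x y : dual_skew x *m skew_mx y + dual_skew y *m skew_mx x =
  - (x *m J *m y^T) 0 0 *: 1%:M.
Proof.
apply/matrixP => i j; rewrite hyperbolic_formE !dual_skewE !mxE !sum4 !mxE.
by move: i; apply: ord4P; move: j; apply: ord4P; rewrite /=; ring.
Qed.

Lemma dual_skew_inj x : dual_skew x = 0 -> x = 0.
Proof.
rewrite dual_skewE => /matrixP h.
apply/rowP; apply: ord6P; rewrite [RHS]mxE.
- by have := h 0 1; rewrite !mxE.
- by have := h 0 2%:R; rewrite !mxE.
- by have := h 0 3%:R; rewrite !mxE.
- by have := h 2%:R 3%:R; rewrite !mxE.
- by have := h 3%:R 1; rewrite !mxE.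
- by have := h 1 2%:R; rewrite !mxE.
Qed.

(** A bivector [x] with [t ^ x = 0] is divisible by [t]: one has [t_i x = t ^ y]
    for [y] the [i]-th row of the matrix of [x]. *)
Lemma skew_ker_wedge (t : 'rV[K]_4) x (i : 'I_4) : t *m skew_mx x = 0 ->
  t 0 i *: x = row i (dual_skew x) *m wedge_mx (t 0).
Proof.
move=> h.
have e j : \sum_k t 0 k * skew_mx x k j = 0.
  by move/matrixP/(_ 0 j): h; rewrite !mxE.
have := e 0; have := e 1; have := e 2%:R; have := e 3%:R.
rewrite !sum4 !mxE /= => e3 e2 e1 e0.
have n3 := congr1 -%R e3; have n2 := congr1 -%R e2.
have n1 := congr1 -%R e1; have n0 := congr1 -%R e0.
rewrite !oppr0 in n3 n2 n1 n0.
apply/rowP => k; rewrite dual_skewE !mxE sum4 !mxE.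
apply/eqP; rewrite -subr_eq0; apply/eqP.
by move: i; apply: ord4P; move: k; apply: ord6P; rewrite /=;
 first [ring | rewrite -[RHS]e0; ring | rewrite -[RHS]e1; ring | rewrite -[RHS]e2; ring
  | rewrite -[RHS]e3; ring | rewrite -[RHS]n0; ring | rewrite -[RHS]n1; ring
  | rewrite -[RHS]n2; ring | rewrite -[RHS]n3; ring].
Qed.

Lemma skew_ker_sub (t : 'rV[K]_4) m (X : 'M[K]_(m, 6)) (i : 'I_4) : t 0 i != 0 ->
  (forall k, t *m skew_mx (row k X) = 0) -> (X <= row' i (wedge_mx (t 0)))%MS.
Proof.
move=> ti h; apply/row_subP => k.
rewrite -(scalerK ti (row k X)) (skew_ker_wedge i (h k)) scalemx_sub //.
rewrite mulmx_sum_row; apply: summx_sub => j _.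
case: (unliftP i j) => [l ->|->].
  rewrite scalemx_sub // (_ : row _ _ = row l (row' i (wedge_mx (t 0)))) ?row_sub //.
  by apply/rowP => c; rewrite !mxE.
by rewrite dual_skewE; move: i ti; apply: ord4P => _; rewrite !mxE /= scale0r sub0mx.
Qed.

Lemma dual_vector m (X : 'M[K]_(m, 6)) (c : 'I_m -> K) : row_free X ->
  exists y, forall k, (row k X *m J *m y^T) 0 0 = c k.
Proof.
move=> rX; have rXJ : row_free (X *m J).
  by rewrite /row_free mxrankMfree ?row_free_unit ?hyperbolic_unit.
have [B XB] := row_freeP rXJ.
exists (B *m \col_k c k)^T => k; rewrite trmxK -row_mul -row_mul mulmxA XB mul1mx.
by rewrite !mxE.
Qed.

Lemma row_free_row_neq0 m n (X : 'M[K]_(m, n)) k : row_free X -> row k X != 0.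
Proof.
move=> /row_free_inj/(_ (delta_mx 0 k) 0) h; apply/eqP => Xk.
have : delta_mx 0 k = 0 :> 'rV[K]_m by apply: h; rewrite mul0mx -rowE.
by move/matrixP/(_ 0 k)/eqP; rewrite !mxE !eqxx oner_eq0.
Qed.

Section Isotropic.
Variables (m : nat) (X : 'M[K]_(m, 6)).
Hypotheses (rX : row_free X) (X_iso : X *m J *m X^T = 0).
Local Notation L k := (skew_mx (row k X)).
Local Notation L' k := (dual_skew (row k X)).

Let XJX k l : (row k X *m J *m (row l X)^T) 0 0 = 0.
Proof.
have h0 : (X *m J *m X^T) k l = 0 by rewrite X_iso mxE.
rewrite -[RHS]h0.
rewrite -row_mul [LHS]mxE [RHS]mxE; apply: eq_bigr => j _.
by congr (_ * _); rewrite !mxE.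
Qed.

Lemma skew_anti k l : L k *m L' l = - (L l *m L' k).
Proof.
by apply/eqP; rewrite -addr_eq0 clifford XJX oppr0 scale0r.
Qed.

Lemma dual_skew_anti k l : L' k *m L l = - (L' l *m L k).
Proof.
by apply/eqP; rewrite -addr_eq0 clifford_dual XJX oppr0 scale0r.
Qed.

Lemma opp_eq0 n p (M : 'M[K]_(n, p)) : M = - M -> M = 0.
Proof.
move=> MN; apply/matrixP => i j; rewrite mxE; apply/eqP.
have /eqP : M i j = - M i j by rewrite {1}MN mxE.
by rewrite -addr_eq0 -mulr2n mulrn_eq0.
Qed.

Lemma skew_sqr k : L k *m L' k = 0.
Proof. exact/opp_eq0/skew_anti. Qed.

Lemma dual_skew_sqr k : L' k *m L k = 0.
Proof. exact/opp_eq0/dual_skew_anti. Qed.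

Lemma nonzero_row n p (M : 'M[K]_(n, p)) : M != 0 -> exists i, row i M != 0.
Proof.
move=> M0; apply: contrapT => h; case/eqP: M0; apply/row_matrixP => i.
by rewrite row0; apply/eqP; apply: contrapT => /negP hi; apply: h; exists i.
Qed.

Lemma skew_tr x : (skew_mx x)^T = - skew_mx x.
Proof.
apply/matrixP => i j; rewrite !mxE.
by move: i; apply: ord4P; move: j; apply: ord4P; rewrite /= ?oppr0 ?opprK.
Qed.

Lemma dual_skew_tr x : (dual_skew x)^T = - dual_skew x.
Proof. exact: skew_tr. Qed.

Lemma skew_commute k y : skew_mx y *m L' k =
  - ((row k X *m J *m y^T) 0 0 *: 1%:M) - L k *m dual_skew y.
Proof. by rewrite -scaleNr -clifford addrC addKr. Qed.

Lemma dual_skew_commute k y : dual_skew y *m L k =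
  - ((row k X *m J *m y^T) 0 0 *: 1%:M) - L' k *m skew_mx y.
Proof. by rewrite -scaleNr -clifford_dual addrC addKr. Qed.

Lemma skew_product_tr k l : (L k *m L' l)^T = - (L' k *m L l).
Proof.
rewrite trmx_mul dual_skew_tr skew_tr mulNmx mulmxN opprK; exact: dual_skew_anti.
Qed.

(** The anticommutator with a vector [y] which is dual to one of the rows
    removes this row from a Clifford product. *)
Lemma clifford_pair_neq0 k l : k != l -> L k *m L' l != 0.
Proof.
move=> kl; apply/eqP => h.
have [y hy] := dual_vector (fun j => (j == k)%:R) rX.
have : L' l = 0; last first.
  by move/dual_skew_inj => h0; case/eqP: (row_free_row_neq0 l rX).
apply/eqP; rewrite -oppr_eq0; apply/eqP.
transitivity (dual_skew y *m (L k *m L' l)); last by rewrite h mulmx0.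
rewrite mulmxA (dual_skew_commute k y) hy eqxx scale1r mulmxBl mulNmx mul1mx.
rewrite -mulmxA (skew_commute l y) hy eq_sym (negPf kl) scale0r oppr0 sub0r mulmxN mulmxA.
have -> : L' k *m L l = 0; last by rewrite mul0mx oppr0 subr0.
by apply/eqP; rewrite -oppr_eq0 -skew_product_tr h trmx0.
Qed.

(** Two lines of [P^3] which meet have a common point: it is found in the image
    of the Clifford product of the two bivectors. *)
Lemma isotropic_line k l : k != l ->
  exists2 t : 'rV[K]_4, t != 0 & t *m L k = 0 /\ t *m L l = 0.
Proof.
move=> /clifford_pair_neq0/nonzero_row[i hi]; exists (row i (L k *m L' l)) => //.
rewrite -!row_mul -!mulmxA dual_skew_sqr dual_skew_anti mulmxN mulmxA skew_sqr.
by rewrite mul0mx mulmx0 oppr0 row0.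
Qed.

End Isotropic.

Section IsotropicPlane.
Variable X : 'M[K]_(3, 6).
Hypotheses (rX : row_free X) (X_iso : X *m J *m X^T = 0).
Local Notation L k := (skew_mx (row k X)).
Local Notation L' k := (dual_skew (row k X)).

(* The Clifford product of the three rows, on each of the two half-spin       *)
(* representations.                                                           *)
Let N1 := L' 0 *m L 1 *m L' 2%:R.
Let N2 := L 0 *m L' 1 *m L 2%:R.

Lemma N1_kill : [/\ N1 *m L 0 = 0, N1 *m L 1 = 0 & N1 *m L 2%:R = 0].
Proof.
have h1 : N1 *m L 1 = 0.
  by rewrite /N1 -mulmxA (dual_skew_anti X_iso 2%:R 1) mulmxN -!mulmxA (mulmxA (L 1)) (skew_sqr X_iso)
    mul0mx mulmx0 oppr0.
split=> //; last by rewrite /N1 -mulmxA (dual_skew_sqr X_iso) mulmx0.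
rewrite /N1 -mulmxA (dual_skew_anti X_iso 2%:R 0) mulmxN -!mulmxA (mulmxA (L 1)) (skew_anti X_iso 1 0).
by rewrite mulNmx !mulmxN -!mulmxA (mulmxA (L' 0)) (dual_skew_sqr X_iso) mul0mx !oppr0.
Qed.

Lemma N2_kill : [/\ N2 *m L' 0 = 0, N2 *m L' 1 = 0 & N2 *m L' 2%:R = 0].
Proof.
have h1 : N2 *m L' 1 = 0.
  by rewrite /N2 -mulmxA (skew_anti X_iso 2%:R 1) mulmxN -!mulmxA (mulmxA (L' 1)) (dual_skew_sqr X_iso)
    mul0mx mulmx0 oppr0.
split=> //; last by rewrite /N2 -mulmxA (skew_sqr X_iso) mulmx0.
rewrite /N2 -mulmxA (skew_anti X_iso 2%:R 0) mulmxN -!mulmxA (mulmxA (L' 1)) (dual_skew_anti X_iso 1 0).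
by rewrite mulNmx !mulmxN -!mulmxA (mulmxA (L 0)) (skew_sqr X_iso) mul0mx !oppr0.
Qed.

Lemma clifford_products_not_both_zero : N1 = 0 -> N2 = 0 -> False.
Proof.
move=> N10 N20.
have [y0 hy0] := dual_vector (fun k => (k == 0)%:R) rX.
have h12 : L 1 *m L' 2%:R = 0.
  apply/eqP; rewrite -oppr_eq0; apply/eqP.
  transitivity (skew_mx y0 *m N1); last by rewrite N10 mulmx0.
  rewrite /N1 !mulmxA (skew_commute X 0 y0) hy0 eqxx scale1r !mulmxBl !mulNmx mul1mx.
  rewrite -(mulmxA (L 0)) (dual_skew_commute X 1 y0) hy0 /= scale0r oppr0 sub0r mulmxN mulNmx opprK.
  rewrite -!mulmxA (skew_commute X 2%:R y0) hy0 /= scale0r oppr0 sub0r !mulmxN !mulmxA -/N2 N20.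
  by rewrite !(mul0mx, oppr0, addr0).
by case/eqP: (clifford_pair_neq0 rX X_iso (isT : (1 : 'I_3) != 2%:R)).
Qed.

(** A plane of the smooth quadric consists of lines of [P^3] which pairwise
    meet. Either they all pass through a point [t] or they all lie in a plane
    [t] of [P^3]; in Clifford terms, [t] is the pure spinor of the isotropic
    subspace. *)
Lemma isotropic_plane : exists2 t : 'rV[K]_4, t != 0 &
  (forall k, t *m L k = 0) \/ (forall k, t *m L' k = 0).
Proof.
have [N10|/nonzero_row[i hi]] := eqVneq N1 0; last first.
  exists (row i N1) => //; left; have [h0 h1 h2] := N1_kill.
  by apply: ord3P; rewrite -row_mul ?h0 ?h1 ?h2 row0.
have [/(clifford_products_not_both_zero N10)//|/nonzero_row[i hi]] := eqVneq N2 0.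
exists (row i N2) => //; right; have [h0 h1 h2] := N2_kill.
by apply: ord3P; rewrite -row_mul ?h0 ?h1 ?h2 row0.
Qed.

End IsotropicPlane.

End RankSix.

Section RankSixFamilies.
Variable K : numClosedFieldType.
Local Notation J := (hyperbolic K).

Lemma multilinear_Psi6 : multilinear (@Psi6 K).
Proof.
by split=> *; rewrite /Psi6 /psi6 /psi6_part /det_a /dot_ab !mxE; ring.
Qed.

Lemma Psi6_zero u v w : Psi6 0 u v w = 0 :> K.
Proof. by rewrite /Psi6 /psi6 /psi6_part !mxE; ring. Qed.

(** The standard basis of the space of linear forms. *)
Definition basis_vec (k : 'I_6) : 'cV[K]_6 := delta_mx k 0.

Lemma basis_vecE k : (basis_vec k)^~ 0 = fun i => (i == k)%:R.
Proof. by apply: funext => i; rewrite mxE andbT. Qed.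

Lemma hyperbolic_basis k : J *m basis_vec k = basis_vec (k + 3%:R).
Proof.
rewrite -[J]trmxK hyperbolic_sym -[LHS]trmxK trmx_mul trmxK trmx_delta -rowE.
by apply/colP => i; rewrite !mxE eqxx andbT.
Qed.

Ltac psi_eval := rewrite /Psi6 !basis_vecE /psi6 /psi6_part /det_a /dot_ab /=.

(** The Pluecker coordinates of the two families span complementary subspaces of
    the third exterior power of [K^6], namely the symmetric squares of [K^4] and
    of its dual. Hence no plane belongs to both. *)
Lemma Psi6_separated (S S' : 'M[K]_4) : S^T = S -> S'^T = S' ->
  (forall u v w, Psi6 S u v w = Psi6 S' (J *m u) (J *m v) (J *m w)) -> S = 0.
Proof.
move=> symS symS' h.
have sS i j : S j i = S i j by rewrite -[in LHS]symS mxE.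
have sS' i j : S' j i = S' i j by rewrite -[in LHS]symS' mxE.
have {}h i j k : Psi6 S (basis_vec i) (basis_vec j) (basis_vec k) =
    Psi6 S' (basis_vec (i + 3%:R)) (basis_vec (j + 3%:R)) (basis_vec (k + 3%:R)).
  by rewrite h !hyperbolic_basis.
pose T i j k := Psi6 S (basis_vec i) (basis_vec j) (basis_vec k).
have half (x : K) : x + x = 0 -> x = 0.
  by move/eqP; rewrite -mulr2n mulrn_eq0 => /eqP.
have [sS21 sS31 sS32] := And3 (sS 1 2%:R) (sS 1 3%:R) (sS 2%:R 3%:R).
have [sS'21 sS'31 sS'32] := And3 (sS' 1 2%:R) (sS' 1 3%:R) (sS' 2%:R 3%:R).
have h00 : S 0 0 = 0.
  transitivity (T 0 1 2%:R); first by rewrite /T; psi_eval; ring.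
  by rewrite /T h; psi_eval; ring.
have h11 : S 1 1 = 0.
  transitivity (T 0 4%:R 5%:R); first by rewrite /T; psi_eval; ring.
  by rewrite /T h; psi_eval; ring.
have h22 : S 2%:R 2%:R = 0.
  transitivity (T 1 5%:R 3%:R); first by rewrite /T; psi_eval; ring.
  by rewrite /T h; psi_eval; ring.
have h33 : S 3%:R 3%:R = 0.
  transitivity (T 2%:R 3%:R 4%:R); first by rewrite /T; psi_eval; ring.
  by rewrite /T h; psi_eval; ring.
have h01 : S 0 1 = 0.
  apply: half; transitivity (T 1 0 4%:R + T 2%:R 0 5%:R).
    by rewrite /T; psi_eval; rewrite ?sS21 ?sS31 ?sS32; ring.
  by rewrite /T !h; psi_eval; rewrite ?sS'21 ?sS'31 ?sS'32; ring.
have h02 : S 0 2%:R = 0.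
  apply: half; transitivity (T 0 1 3%:R + T 2%:R 1 5%:R).
    by rewrite /T; psi_eval; rewrite ?sS21 ?sS31 ?sS32; ring.
  by rewrite /T !h; psi_eval; rewrite ?sS'21 ?sS'31 ?sS'32; ring.
have h03 : S 0 3%:R = 0.
  apply: half; transitivity (T 0 2%:R 3%:R + T 1 2%:R 4%:R).
    by rewrite /T; psi_eval; rewrite ?sS21 ?sS31 ?sS32; ring.
  by rewrite /T !h; psi_eval; rewrite ?sS'21 ?sS'31 ?sS'32; ring.
have h12 : S 1 2%:R = 0.
  apply: half; transitivity (T 0 5%:R 3%:R + T 1 4%:R 5%:R).
    by rewrite /T; psi_eval; rewrite ?sS21 ?sS31 ?sS32; ring.
  by rewrite /T !h; psi_eval; rewrite ?sS'21 ?sS'31 ?sS'32; ring.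
have h13 : S 1 3%:R = 0.
  apply: half; transitivity (T 0 3%:R 4%:R + T 2%:R 4%:R 5%:R).
    by rewrite /T; psi_eval; rewrite ?sS21 ?sS31 ?sS32; ring.
  by rewrite /T !h; psi_eval; rewrite ?sS'21 ?sS'31 ?sS'32; ring.
have h23 : S 2%:R 3%:R = 0.
  apply: half; transitivity (T 1 3%:R 4%:R + T 2%:R 5%:R 3%:R).
    by rewrite /T; psi_eval; rewrite ?sS21 ?sS31 ?sS32; ring.
  by rewrite /T !h; psi_eval; rewrite ?sS'21 ?sS'31 ?sS'32; ring.
apply/matrixP => i j; rewrite mxE.
by move: i; apply: ord4P; move: j; apply: ord4P; rewrite // sS.
Qed.

Lemma separating_Psi6 : separating (@Psi6 K).
Proof.
move=> S symS h; apply: (Psi6_separated (S' := 0) symS); first by rewrite trmx0.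
by move=> u v w; rewrite h Psi6_zero.
Qed.

Lemma representable_Psi6 : representable (@Psi6 K).
Proof.
move=> t /rV0Pn[i ti]; exists (row' i (wedge_mx (t 0))), ((-1) ^+ i * t 0 i).
split=> [|u v w]; first by rewrite mulf_neq0 // signr_eq0.
exact: det3_wedge.
Qed.

Lemma wedge_isotropic (t : 'I_4 -> K) : wedge_mx t *m J *m (wedge_mx t)^T = 0.
Proof.
apply/matrixP => i j; rewrite [RHS]mxE.
transitivity ((row i (wedge_mx t) *m J *m (row j (wedge_mx t))^T) 0 0).
  by rewrite -row_mul [LHS]mxE [RHS]mxE; apply: eq_bigr => k _; congr (_ * _); rewrite !mxE.
rewrite hyperbolic_formE ![row _ _ _ _]mxE ![wedge_mx _ _ _]mxE.
by move: i; apply: ord4P; move: j; apply: ord4P; rewrite /=; ring.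
Qed.

Lemma row'_mulmx m n (i : 'I_m) (M : 'M[K]_(m, n)) : row' i M = row' i 1%:M *m M.
Proof.
rewrite -[in LHS](mul1mx M); apply/matrixP => k l; rewrite !mxE.
by apply: eq_bigr => j _; rewrite !mxE.
Qed.

Section Quadric.
Variables (q : {mpoly K[6]}) (g : 'M[K]_6).
Hypotheses (hq : q \is 2.-homog) (gq : g *m hessian q *m g^T = J).
Hypothesis g_unit : g \in unitmx.

Lemma belongs_plane_on A : belongs_to (family_forms (@Psi6 K) g) A -> plane_on q A.
Proof.
case=> t [t0 hA]; have [rA _] := hA; split=> //; apply/restrict_eq0 => //.
have [i ti] := rV0Pn _ t0.
have c0 : (-1) ^+ i * t 0 i != 0 by rewrite mulf_neq0 // signr_eq0.
have [B Bu ->] := (plane_atP multilinear_Psi6 g_unit separating_Psi6 A t0 c0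
  (det3_wedge t i)).1 hA.
set M := wedge_mx (t 0); rewrite [row' i M]row'_mulmx.
rewrite !trmx_mul.
transitivity (B *m row' i 1%:M *m (M *m (g *m hessian q *m g^T) *m M^T)
  *m (row' i 1%:M)^T *m B^T); first by rewrite !mulmxA.
by rewrite gq wedge_isotropic mulmx0 !mul0mx.
Qed.

(** The planes of the first family are recognized by their pure spinor. *)
Lemma belongs_of_kernel (A : 'M[K]_(3, 6)) (t : 'rV[K]_4) : row_free A -> t != 0 ->
  (forall k, t *m skew_mx (row k (A *m invmx g)) = 0) ->
  belongs_to (family_forms (@Psi6 K) g) A.
Proof.
move=> rA t0 h; exists t; split=> //.
have [i ti] := rV0Pn _ t0.
have c0 : (-1) ^+ i * t 0 i != 0 by rewrite mulf_neq0 // signr_eq0.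
have /submxP[B AB] := skew_ker_sub ti h.
apply/(plane_atP multilinear_Psi6 g_unit separating_Psi6 A t0 c0 (det3_wedge t i)).
have AE : A = B *m row' i (wedge_mx (t 0)) *m g by rewrite -AB mulmxKV.
exists B => //; rewrite -row_free_unit; apply: inj_row_free => x xB.
apply: (row_free_inj rA); rewrite mul0mx AE !mulmxA xB !mul0mx //.
Qed.

End Quadric.

(** The exchange of [a] and [b] is an isometry which exchanges the families. *)
Lemma swap_congruence (q : {mpoly K[6]}) g : g *m hessian q *m g^T = J ->
  (J *m g) *m hessian q *m (J *m g)^T = J.
Proof.
move=> gq; rewrite trmx_mul hyperbolic_sym.
transitivity (J *m (g *m hessian q *m g^T) *m J); first by rewrite !mulmxA.
by rewrite gq hyperbolic_sqr mul1mx.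
Qed.

(** A smooth quadric carries exactly two families of planes, disjoint and each
    embedded as a projective space. *)
Lemma smooth_quadric_families (q : {mpoly K[6]}) g : q \is 2.-homog ->
  g *m hessian q *m g^T = J -> g \in unitmx ->
  two_P3_families q (family_forms (@Psi6 K) g) (family_forms (@Psi6 K) (J *m g)).
Proof.
move=> hq gq gu; have gu' : J *m g \in unitmx by rewrite unitmx_mul hyperbolic_unit.
have gq' := swap_congruence gq.
split.
- exact: family_P3 multilinear_Psi6 gu separating_Psi6 representable_Psi6.
- exact: family_P3 multilinear_Psi6 gu' separating_Psi6 representable_Psi6.
- move=> A; split=> [[rA /(restrict_eq0 _ hq) isoA]|[|]]; last first.
  + exact: belongs_plane_on.
  + exact: belongs_plane_on.
  pose X := A *m invmx g.
  have rX : row_free X by rewrite /row_free mxrankMfree ?row_free_unit ?unitmx_inv.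
  have X_iso : X *m J *m X^T = 0.
    have XA : X *m g = A by rewrite mulmxKV.
    rewrite -gq; transitivity (X *m g *m hessian q *m (X *m g)^T).
      by rewrite (trmx_mul X g) !mulmxA.
    by rewrite XA.
  have [t t0 [h|h]] := isotropic_plane rX X_iso.
    by left; apply: (belongs_of_kernel gu rA t0).
  right; apply: (belongs_of_kernel gu' rA t0) => k.
  have -> : A *m invmx (J *m g) = X *m J; last by rewrite row_mul; apply: h.
  have XJE : X *m J *m (J *m g) = A.
    by rewrite -(mulmxA X) (mulmxA J) hyperbolic_sqr mul1mx mulmxKV.
  by rewrite -{1}XJE mulmxK.
- move=> A [[t [t0 [_ [c [c0 hc]]]]] [t' [t0' [_ [c' [c0' hc']]]]]].
  have [LS L1 L2 L3] := multilinear_Psi6.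
  pose T u v w := c * Psi6 (t^T *m t) u v w
    - c' * Psi6 (t'^T *m t') (J *m u) (J *m v) (J *m w).
  have T0 u v w : T u v w = 0.
    apply: (trilinear_zero gu (T := T)) => {u v w} [x u u' v w|x u v v' w|x u v w w'|s].
    + by rewrite /T mulmxDr -scalemxAr !L1; ring.
    + by rewrite /T mulmxDr -scalemxAr !L2; ring.
    + by rewrite /T mulmxDr -scalemxAr !L3; ring.
    rewrite /T -!col_mulmx -!family_forms_eval //; try exact: multilinear_Psi6.
    by rewrite -hc -hc' subrr.
  case/eqP: (square_neq0 t0); apply: (@Psi6_separated _ ((c' / c) *: (t'^T *m t'))).
  + exact: square_sym.
  + by rewrite linearZ /= square_sym.
  move=> u v w; have := T0 u v w; rewrite /T => /eqP; rewrite subr_eq0 => /eqP h.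
  have LZ x S a b d : Psi6 (x *: S) a b d = x * Psi6 S a b d :> K.
    by rewrite -[_ *: S]addr0 LS Psi6_zero addr0.
  by apply: (mulfI c0); rewrite h LZ mulrA mulrCA divff // mulr1.
Qed.

End RankSixFamilies.

(** * The family of planes on a quadric cone *)

Section RankFive.
Variable K : numClosedFieldType.
Local Notation J := (hyperbolic K).
Implicit Types (x y : 'rV[K]_6).

(** The map which sends [(a, b)] to [(a, (a0, b1, b2))]. Its image is the
    hyperplane [a0 = b0], and the inverse image of the smooth quadric [a.b = 0]
    is the quadric cone [a0^2 + a1 b1 + a2 b2 = 0], so that the base of the cone
    is a hyperplane section of the smooth quadric. *)
Definition fold_mx : 'M[K]_6 :=
  \matrix_(i, j) ((i == j) && (i != 3%:R) || (i == 0) && (j == 3%:R))%:R.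

(** The matrix of the quadratic form [2 (a0^2 + a1 b1 + a2 b2)]. *)
Definition cone_form : 'M[K]_6 := fold_mx *m J *m fold_mx^T.

(** The vertex of the cone is the basis vector with [b0 = 1]. *)
Definition vertex : 'rV[K]_6 := delta_mx 0 3%:R.

(** The linear form [a0 - b0]. *)
Definition hyperplane : 'cV[K]_6 := delta_mx 0 0 - delta_mx 3%:R 0.

(** The projection from the vertex to the hyperplane [b0 = 0]. *)
Definition drop_b0 : 'M[K]_6 := \matrix_(i, j) ((i == j) && (i != 3%:R))%:R.

(** A plane of the cone is spanned by the vertex and by the line of the base
    which is cut out by [a0 = b0] on a plane of the first family of the smooth
    quadric. Its Pluecker coordinates are obtained from [Psi6] by contraction
    with the linear form [a0 - b0] and exterior product with the vertex. *)
Definition Psi5_part (S : 'M[K]_4) (u v w : 'cV[K]_6) :=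
  u 3%:R 0 * Psi6 S hyperplane (drop_b0 *m v) (drop_b0 *m w).

Definition Psi5 (S : 'M[K]_4) (u v w : 'cV[K]_6) :=
  Psi5_part S u v w + Psi5_part S v w u + Psi5_part S w u v.

Lemma multilinear_Psi5 : multilinear Psi5.
Proof.
have [L0 L1 L2 L3] := multilinear_Psi6 K.
by split=> *; rewrite /Psi5 /Psi5_part ?mulmxDr -?scalemxAr ?L0 ?L1 ?L2 ?L3 ?mxE; ring.
Qed.

Lemma drop_b0_basis k : k != 3%:R -> drop_b0 *m basis_vec K k = basis_vec K k.
Proof.
move=> k3; apply/colP => i; rewrite mxE (bigD1 k) //= big1 => [|j jk].
  rewrite !mxE !eqxx mulr1 addr0 andbT; congr (_%:R).
  by case: (eqVneq i k) => [->|]; rewrite ?k3.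
by rewrite !mxE (negPf jk) mulr0.
Qed.

Lemma drop_b0_vertex : drop_b0 *m basis_vec K 3%:R = 0.
Proof.
apply/colP => i; rewrite mxE big1 ?mxE // => j _; rewrite !mxE eqxx andbT.
have [->|jk] := eqVneq j 3%:R; last by rewrite mulr0.
by case: (i == _); rewrite ?andbF ?mul0r // ; case: eqP => //; rewrite ?mul0r.
Qed.

Ltac psi_eval := rewrite /Psi6 !basis_vecE /psi6 /psi6_part /det_a /dot_ab /=.

(** Contraction with [a0 - b0] loses nothing: the lines on the smooth quadric
    threefold are parameterized by the same projective space. *)
Lemma Psi6_hyperplane_separating (S : 'M[K]_4) : S^T = S ->
  (forall v w, Psi6 S hyperplane (drop_b0 *m v) (drop_b0 *m w) = 0) -> S = 0.
Proof.
move=> symS h.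
have sS i j : S j i = S i j by rewrite -[in LHS]symS mxE.
have [L0 L1 L2 L3] := multilinear_Psi6 K.
pose T i j k := Psi6 S (basis_vec K i) (basis_vec K j) (basis_vec K k).
have {}h i j : i != 3%:R -> j != 3%:R -> T 0 i j = T 3%:R i j.
  move=> i3 j3; have := h (basis_vec K i) (basis_vec K j).
  rewrite !drop_b0_basis // /hyperplane addrC -scaleN1r L1 mulN1r addrC.
  by move/eqP; rewrite subr_eq0 => /eqP.
have half (x : K) : x + x = 0 -> x = 0.
  by move/eqP; rewrite -mulr2n mulrn_eq0 => /eqP.
have [sS21 sS31 sS32] := And3 (sS 1 2%:R) (sS 1 3%:R) (sS 2%:R 3%:R).
pose d i j := T 0 i j - T 3%:R i j.
have d0 i j : i != 3%:R -> j != 3%:R -> d i j = 0.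
  by move=> i3 j3; rewrite /d h // subrr.
have h00 : S 0 0 = 0.
  transitivity (d 1 2%:R); last by rewrite d0 ?oppr0.
  by rewrite /d /T; psi_eval; rewrite ?sS21 ?sS31 ?sS32; ring.
have h02 : S 0 2%:R = 0.
  transitivity (- d 0 1); last by rewrite d0 ?oppr0.
  by rewrite /d /T; psi_eval; rewrite ?sS21 ?sS31 ?sS32; ring.
have h03 : S 0 3%:R = 0.
  transitivity (- d 0 2%:R); last by rewrite d0 ?oppr0.
  by rewrite /d /T; psi_eval; rewrite ?sS21 ?sS31 ?sS32; ring.
have h13 : S 1 3%:R = 0.
  transitivity (d 0 4%:R); last by rewrite d0 ?oppr0.
  by rewrite /d /T; psi_eval; rewrite ?sS21 ?sS31 ?sS32; ring.
have h12 : S 1 2%:R = 0.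
  transitivity (- d 0 5%:R); last by rewrite d0 ?oppr0.
  by rewrite /d /T; psi_eval; rewrite ?sS21 ?sS31 ?sS32; ring.
have h22 : S 2%:R 2%:R = 0.
  transitivity (- d 1 5%:R); last by rewrite d0 ?oppr0.
  by rewrite /d /T; psi_eval; rewrite ?sS21 ?sS31 ?sS32; ring.
have h33 : S 3%:R 3%:R = 0.
  transitivity (d 2%:R 4%:R); last by rewrite d0 ?oppr0.
  by rewrite /d /T; psi_eval; rewrite ?sS21 ?sS31 ?sS32; ring.
have h11 : S 1 1 = 0.
  transitivity (d 4%:R 5%:R); last by rewrite d0 ?oppr0.
  by rewrite /d /T; psi_eval; rewrite ?sS21 ?sS31 ?sS32; ring.
have h01 : S 0 1 = 0.
  apply: half; transitivity (- (d 1 4%:R + d 2%:R 5%:R)).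
    by rewrite /d /T; psi_eval; rewrite ?sS21 ?sS31 ?sS32; ring.
  by rewrite !d0 // addr0 oppr0.
have h23 : S 2%:R 3%:R = 0.
  apply: half; transitivity (d 1 4%:R - d 2%:R 5%:R).
    by rewrite /d /T; psi_eval; rewrite ?sS21 ?sS31 ?sS32; ring.
  by rewrite !d0 // subrr.
apply/matrixP => i j; rewrite mxE.
by move: i; apply: ord4P; move: j; apply: ord4P; rewrite // sS.
Qed.

Lemma separating_Psi5 : separating Psi5.
Proof.
move=> S symS h; apply: Psi6_hyperplane_separating => // v w.
have [L0 L1 L2 L3] := multilinear_Psi6 K.
have z2 u w' : Psi6 S u 0 w' = 0.
  by have := L2 (-1) S u 0 0 w'; rewrite scaler0 addr0 mulN1r [- _ + _]addrC subrr.
have z3 u v' : Psi6 S u v' 0 = 0.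
  by have := L3 (-1) S u v' 0 0; rewrite scaler0 addr0 mulN1r [- _ + _]addrC subrr.
have NN : drop_b0 *m drop_b0 = drop_b0.
  apply/matrixP => i j; rewrite mxE (bigD1 j) //= big1 => [|k kj].
    by rewrite !mxE eqxx addr0; case: (eqVneq i j) => [->|]; case: (j == _);
      rewrite ?mulr0 ?mulr1 ?mul0r.
  by rewrite !mxE (negPf kj) mulr0.
have := h (basis_vec K 3%:R) (drop_b0 *m v) (drop_b0 *m w).
rewrite /Psi5 /Psi5_part drop_b0_vertex z2 z3 !mulr0 !addr0 !mulmxA NN.
by rewrite mxE eqxx mul1r.
Qed.

Lemma mul_hyperplane x : (x *m hyperplane) 0 0 = x 0 0 - x 0 3%:R.
Proof. by rewrite mulmxBr -!colE !mxE. Qed.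

Lemma mul_fold x (k : 'I_6) : (x *m fold_mx) 0 k =
  x 0 (if k == 3%:R then 0 else k).
Proof.
rewrite mxE sum6 !mxE; move: k; apply: ord6P; rewrite /=; ring.
Qed.

Lemma mul_cone_form x (k : 'I_6) : (x *m cone_form) 0 k =
  nth 0 [:: 2%:R * x 0 0; x 0 4%:R; x 0 5%:R; 0; x 0 1; x 0 2%:R] k.
Proof.
rewrite /cone_form !mulmxA; set y := x *m fold_mx *m J.
have yE j : y 0 j = nth 0
    [:: x 0 0; x 0 4%:R; x 0 5%:R; x 0 0; x 0 1; x 0 2%:R] j.
  by rewrite /y hyperbolic_nth !mul_fold; move: j; apply: ord6P.
clearbody y; rewrite mxE sum6 ![fold_mx^T _ _]mxE ![fold_mx _ _]mxE !yE.
by move: k; apply: ord6P; rewrite /=; ring.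
Qed.

Lemma mul_drop x (k : 'I_6) : (x *m drop_b0) 0 k =
  if k == 3%:R then 0 else x 0 k.
Proof.
rewrite mxE sum6 !mxE; move: k; apply: ord6P; rewrite /=; ring.
Qed.

Lemma fold_hyperplane : fold_mx *m hyperplane = 0.
Proof.
apply/row_matrixP => i; rewrite row_mul row0; apply/rowP => j.
rewrite ord1 mul_hyperplane !mxE; move: i; apply: ord6P; rewrite /=; ring.
Qed.

Lemma vertex_fold : vertex *m fold_mx = 0.
Proof. by apply/rowP; apply: ord6P; rewrite mul_fold !mxE. Qed.

Lemma fold_kernel x : x *m fold_mx = 0 -> x = x 0 3%:R *: vertex.
Proof.
move=> /rowP h; apply/rowP; apply: ord6P; rewrite !mxE /= ?mulr0 ?mulr1 //.
- by have := h 0; rewrite mul_fold mxE.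
- by have := h 1; rewrite mul_fold mxE.
- by have := h 2%:R; rewrite mul_fold mxE.
- by have := h 4%:R; rewrite mul_fold mxE.
- by have := h 5%:R; rewrite mul_fold mxE.
Qed.

Lemma fold_drop x : x = x 0 3%:R *: vertex + x *m fold_mx *m drop_b0.
Proof.
apply/rowP => k; rewrite mxE mul_drop mul_fold !mxE.
by move: k; apply: ord6P; rewrite /= ?mulr0 ?mulr1 ?add0r ?addr0.
Qed.

Lemma drop_fold x : x *m hyperplane = 0 -> x *m drop_b0 *m fold_mx = x.
Proof.
move=> /matrixP/(_ 0 0); rewrite mul_hyperplane mxE => /eqP; rewrite subr_eq0 => /eqP h.
by apply/rowP; apply: ord6P; rewrite mul_fold mul_drop.
Qed.

(** The plane of the cone with parameter [t], spanned by the rows of [W]. It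
    contains every point whose image in the base lies on the plane [t] of the
    smooth quadric. *)
Lemma cone_plane (t : 'rV[K]_4) : t != 0 -> exists (W : 'M[K]_(3, 6)) c,
  [/\ c != 0,
      forall u v w, det3 (W *m u) (W *m v) (W *m w) = c * Psi5 (t^T *m t) u v w,
      W *m cone_form *m W^T = 0 &
      forall x, t *m skew_mx (x *m fold_mx) = 0 -> (x <= W)%MS].
Proof.
move=> t0; have [i ti] := rV0Pn _ t0.
set M := row' i (wedge_mx (t 0)); have detM := det3_wedge t i.
have c0 : (-1) ^+ i * t 0 i != 0 by rewrite mulf_neq0 // signr_eq0.
set c := _ * t 0 i in c0 detM; rewrite -/M in detM.
have Mh : M *m hyperplane != 0.
  apply/eqP => Mh; case/eqP: (square_neq0 t0).
  apply: Psi6_hyperplane_separating => [|v w]; first exact: square_sym.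
  by apply: (mulfI c0); rewrite -detM Mh /det3 !mxE; ring.
(* A basis of the plane in which the last two vectors span its line in the    *)
(* hyperplane a0 = b0.                                                        *)
have [|R Ru RM] := @row_free_complete K 1 2 (M *m hyperplane)^T.
  rewrite /row_free rank_rV (_ : _ != 0) //.
  by apply: contra_neq Mh => /(congr1 trmx); rewrite trmxK trmx0.
pose P : 'M[K]_3 := invmx R^T; have Pu : P \in unitmx by rewrite unitmx_inv unitmx_tr.
have Ph : P *m (M *m hyperplane) = delta_mx 0 0.
  rewrite -[M *m _]trmxK -RM; apply: (can_inj (mulKmx (_ : R^T \in unitmx))).
    by rewrite unitmx_tr.
  rewrite mulKVmx ?unitmx_tr // -colE; apply/colP => k; rewrite !mxE.
  by congr (R _ k); apply: val_inj.
pose M' : 'M[K]_(3, 6) := P *m M; have M'h : M' *m hyperplane = delta_mx 0 0 by rewrite -mulmxA.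
pose W : 'M[K]_(3, 6) :=
  \matrix_(k < 3) nth 0 [:: vertex; row 1 M' *m drop_b0; row 2%:R M' *m drop_b0] k.
have Wu (u : 'cV[K]_6) : [/\ (W *m u) 0 0 = u 3%:R 0, (W *m u) 1 0 = (M' *m (drop_b0 *m u)) 1 0 &
    (W *m u) 2%:R 0 = (M' *m (drop_b0 *m u)) 2%:R 0].
  have E k (N : 'M[K]_(3, 6)) v : (N *m v) k 0 = (row k N *m v) 0 0.
    by rewrite -row_mul [RHS]mxE.
  rewrite !E !rowK /=; split.
  - by rewrite /vertex -rowE mxE.
  - by rewrite mulmxA.
  - by rewrite mulmxA.
exists W, (\det P * c); split.
- by rewrite mulf_neq0 // -unitfE -unitmxE.
- move=> u v w; rewrite /det3.
  have [-> -> ->] := Wu u; have [-> -> ->] := Wu v; have [-> -> ->] := Wu w.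
  have key (v' w' : 'cV[K]_6) : \det P * c * Psi6 (t^T *m t) hyperplane (drop_b0 *m v') (drop_b0 *m w')
    = (M' *m (drop_b0 *m v')) 1 0 * (M' *m (drop_b0 *m w')) 2%:R 0
    - (M' *m (drop_b0 *m v')) 2%:R 0 * (M' *m (drop_b0 *m w')) 1 0.
    have d j : (delta_mx 0 0 : 'cV[K]_3) j 0 = (j == 0)%:R by rewrite mxE andbT.
    by rewrite -mulrA -detM -det3_mulmx !(mulmxA P) -/M' M'h /det3 !d /=; ring.
  move: (key v w) (key w u) (key u v); rewrite /Psi5 /Psi5_part.
  generalize (\det P * c)
    (Psi6 (t^T *m t) hyperplane (drop_b0 *m v) (drop_b0 *m w))
    (Psi6 (t^T *m t) hyperplane (drop_b0 *m w) (drop_b0 *m u))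
    (Psi6 (t^T *m t) hyperplane (drop_b0 *m u) (drop_b0 *m v))
    ((M' *m (drop_b0 *m u)) 1 0) ((M' *m (drop_b0 *m u)) 2%:R 0)
    ((M' *m (drop_b0 *m v)) 1 0) ((M' *m (drop_b0 *m v)) 2%:R 0)
    ((M' *m (drop_b0 *m w)) 1 0) ((M' *m (drop_b0 *m w)) 2%:R 0).
  move=> a X1 X2 X3 u1 u2 v1 v2 w1 w2 e1 e2 e3.
  transitivity (u 3%:R 0 * (a * X1) + v 3%:R 0 * (a * X2) + w 3%:R 0 * (a * X3)).
    by rewrite e1 e2 e3; ring.
  by ring.
- have M_iso : M' *m J *m M'^T = 0.
    have ME : M = row' i 1%:M *m wedge_mx (t 0) by rewrite /M row'_mulmx.
    pose Q : 'M[K]_(3, 4) := P *m row' i 1%:M.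
    have -> : M' = Q *m wedge_mx (t 0) by rewrite /M' ME mulmxA.
    rewrite (trmx_mul Q); transitivity (Q *m (wedge_mx (t 0) *m J *m (wedge_mx (t 0))^T) *m Q^T).
      by rewrite !mulmxA.
    by rewrite wedge_isotropic mulmx0 mul0mx.
  pose E : 'M[K]_3 := \matrix_(k, l) ((k == l) && (k != 0))%:R.
  have Mk k : k != 0 -> row k M' *m drop_b0 *m fold_mx = row k M'.
    move=> k0; apply: drop_fold; rewrite -row_mul M'h.
    by apply/rowP => j; rewrite !mxE (negPf k0).
  have WF : W *m fold_mx = E *m M'.
    apply/row_matrixP; apply: ord3P; rewrite !row_mul rowK /=.
    + rewrite vertex_fold (_ : row 0 E = 0) ?mul0mx //.
      by apply/rowP => j; rewrite !mxE eqxx andbF.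
    + rewrite Mk // (_ : row 1 E = delta_mx 0 1) -?rowE //.
      by apply/rowP => j; rewrite !mxE eq_sym andbT.
    + rewrite Mk // (_ : row 2%:R E = delta_mx 0 2%:R) -?rowE //.
      by apply/rowP => j; rewrite !mxE eq_sym andbT.
  transitivity ((W *m fold_mx) *m J *m (W *m fold_mx)^T).
    by rewrite /cone_form trmx_mul !mulmxA.
  rewrite WF (trmx_mul E); transitivity (E *m (M' *m J *m M'^T) *m E^T).
    by rewrite !mulmxA.
  by rewrite M_iso mulmx0 mul0mx.
- move=> x hx; set y := x *m fold_mx in hx.
  have /submxP[D yD] : (y <= M)%MS.
    by apply: (skew_ker_sub ti) => k; rewrite ord1 (_ : row 0 y = y) //;
      apply/rowP => j; rewrite mxE.
  pose z : 'rV[K]_3 := D *m invmx P; have yz : y = z *m M' by rewrite /M' mulmxA mulmxKV.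
  clearbody z.
  have z0 : z 0 0 = 0.
    have : y *m hyperplane = 0 by rewrite -mulmxA fold_hyperplane mulmx0.
    by rewrite yz -mulmxA M'h -colE => /matrixP/(_ 0 0); rewrite !mxE.
  apply/submxP; exists (\row_k nth 0 [:: x 0 3%:R; z 0 1; z 0 2%:R] k).
  rewrite mulmx_sum_row sum3 !rowK !mxE /= [LHS]fold_drop -/y -addrA; congr (_ + _).
  by rewrite yz (mulmx_sum_row z) sum3 z0 scale0r add0r mulmxDl -!scalemxAl.
Qed.

End RankFive.

Section Cone.
Variable K : numClosedFieldType.
Local Notation J := (hyperbolic K).
Local Notation vertex := (vertex K).
Local Notation fold_mx := (fold_mx K).
Local Notation cone_form := (cone_form K).

(** Every plane of the cone contains the vertex. Otherwise it maps isomorphically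
    to a plane of the smooth quadric in the hyperplane [a0 = b0], which would
    contain the normal vector of this hyperplane, but that is not isotropic. *)
Lemma vertex_sub_isotropic (X : 'M[K]_(3, 6)) : row_free X ->
  X *m cone_form *m X^T = 0 -> (vertex <= X)%MS.
Proof.
move=> rX isoX; apply: contrapT => /negP vX.
pose M := X *m fold_mx.
have rM : row_free M.
  apply: inj_row_free => z; rewrite mulmxA => /fold_kernel zX.
  apply: (row_free_inj rX); rewrite mul0mx; apply/eqP; apply: contraR vX => nz.
  have c0 : (z *m X) 0 3%:R != 0.
    by apply: contraNneq nz => c0; rewrite zX c0 scale0r.
  by rewrite -(scalerK c0 vertex) -zX scalemx_sub // submxMl.
have isoM : M *m J *m M^T = 0.
  by rewrite -[RHS]isoX /M /cone_form trmx_mul !mulmxA.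
(* The normal vector of the hyperplane lies in the orthogonal of M, hence in  *)
(* M, which is its own orthogonal.                                            *)
pose n : 'rV[K]_6 := (hyperplane K)^T *m J.
have nJ : n *m J = (hyperplane K)^T by rewrite -mulmxA hyperbolic_sqr mulmx1.
have nM : n *m J *m M^T = 0.
  by rewrite nJ -trmx_mul /M -mulmxA fold_hyperplane mulmx0 trmx0.
have rMT : \rank (J *m M^T) = 3%N.
  rewrite eqmxMfull ?row_full_unit ?hyperbolic_unit // mxrank_tr.
  exact/eqP.
have sM : (M <= kermx (J *m M^T))%MS by apply/sub_kermxP; rewrite mulmxA.
have eM : (M == kermx (J *m M^T))%MS.
  by rewrite -mxrank_leqif_eq // mxrank_ker rMT (eqP rM).
have /submxP[z nz] : (n <= M)%MS.
  by rewrite (eqmxP eM); apply/sub_kermxP; rewrite mulmxA.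
have n0 : n *m J *m n^T = 0 by rewrite {2}nz trmx_mul mulmxA nM mul0mx.
have /eqP : (2%:R : K) = - (n *m J *m n^T) 0 0.
  by rewrite hyperbolic_formE /n !hyperbolic_mulE !mxE /=; ring.
by rewrite n0 mxE oppr0 pnatr_eq0.
Qed.

Section Quadric.
Variables (q : {mpoly K[6]}) (g : 'M[K]_6).
Hypotheses (hq : q \is 2.-homog) (gq : g *m hessian q *m g^T = cone_form).
Hypothesis g_unit : g \in unitmx.

Lemma cone_isotropic A : A *m hessian q *m A^T = 0 ->
  (A *m invmx g) *m cone_form *m (A *m invmx g)^T = 0 :> 'M[K]_3.
Proof.
have E (X : 'M[K]_(3, 6)) :
    X *m (g *m hessian q *m g^T) *m X^T = X *m g *m hessian q *m (X *m g)^T.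
  by rewrite (trmx_mul X) !mulmxA.
by move=> isoA; rewrite -gq E mulmxKV.
Qed.

Lemma row_free_mul_unit A : row_free A -> row_free (A *m invmx g : 'M[K]_(3, 6)).
Proof. by move=> rA; rewrite /row_free mxrankMfree ?row_free_unit ?unitmx_inv. Qed.

Lemma cone_belongs_plane_on A : belongs_to (family_forms (@Psi5 K) g) A -> plane_on q A.
Proof.
case=> t [t0 hA]; have [rA _] := hA; split=> //; apply/restrict_eq0 => //.
have [W [c [c0 detW isoW _]]] := cone_plane t0.
have [B Bu ->] := (plane_atP (multilinear_Psi5 K) g_unit (@separating_Psi5 K) A t0 c0
  detW).1 hA.
rewrite !trmx_mul.
transitivity (B *m (W *m (g *m hessian q *m g^T) *m W^T) *m B^T).
  by rewrite !mulmxA.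
by rewrite gq isoW mulmx0 mul0mx.
Qed.

(** The base of the plane is an isotropic line of the smooth quadric, for which
    [isotropic_line] gives the parameter. *)
Lemma cone_plane_on_belongs A : plane_on q A -> belongs_to (family_forms (@Psi5 K) g) A.
Proof.
case=> rA /(restrict_eq0 _ hq)/cone_isotropic isoX.
have rX := row_free_mul_unit rA; set X := A *m invmx g in isoX rX.
have /submxP[b bX] := vertex_sub_isotropic rX isoX.
have b0 : b != 0.
  apply/eqP => bz; move/matrixP/(_ 0 3%:R)/eqP: bX.
  by rewrite bz mul0mx !mxE /= oner_eq0.
have [|B Bu Bb] := @row_free_complete K 1 2 b; first by rewrite /row_free rank_rV b0.
pose X' : 'M[K]_(3, 6) := B *m X.
have rX' : row_free X' by rewrite /row_free eqmxMfull ?row_full_unit.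
have X'0 : row 0 X' = vertex.
  rewrite row_mul bX -Bb; congr (_ *m X); apply/rowP => j; rewrite !mxE.
  by congr (B _ j); apply: val_inj.
pose Y : 'M[K]_(2, 6) := row' 0 X' *m fold_mx.
have rowY k : row k Y = row (lift 0 k) X' *m fold_mx.
  by rewrite row_mul; congr (_ *m _); apply/rowP => j; rewrite !mxE.
have isoX' : X' *m cone_form *m X'^T = 0.
  rewrite /X' trmx_mul; transitivity (B *m (X *m cone_form *m X^T) *m B^T).
    by rewrite !mulmxA.
  by rewrite isoX mulmx0 mul0mx.
have isoY : Y *m J *m Y^T = 0.
  have E : row' 0 X' = row' 0 1%:M *m X' by apply: row'_mulmx.
  rewrite /Y E; transitivity (row' 0 1%:M *m (X' *m cone_form *m X'^T) *m (row' 0 1%:M)^T).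
    by rewrite /cone_form !trmx_mul !mulmxA.
  by rewrite isoX' mulmx0 mul0mx.
have rY : row_free Y.
  apply: inj_row_free => z; rewrite mulmxA => /fold_kernel zX'.
  set d := (_ *m _) 0 3%:R in zX'.
  pose y : 'rV[K]_3 := \row_k if unlift 0 k is Some l then z 0 l else - d.
  have y0 : y = 0.
    apply: (row_free_inj rX'); rewrite mul0mx mulmx_sum_row big_ord_recl mxE unlift_none.
    rewrite X'0 scaleNr -zX' mulmx_sum_row addrC.
    apply/eqP; rewrite subr_eq0; apply/eqP; apply: eq_bigr => k _.
    by rewrite mxE liftK; congr (_ *: _); apply/rowP => j; rewrite !mxE.
  apply/rowP => l; rewrite mxE; have /rowP/(_ (lift 0 l)) := y0.
  by rewrite !mxE liftK.
have [t t0 [h0 h1]] := isotropic_line rY isoY (isT : (0 : 'I_2) != 1).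
exists t; split=> //.
have [W [c [c0 detW _ subW]]] := cone_plane t0.
have X'W : (X' <= W)%MS.
  apply/row_subP => k; apply: subW.
  case: (unliftP 0 k) => [l|] ->.
    rewrite -rowY; case: l => -[|[|//]] hl.
    - by rewrite -[RHS]h0; congr (_ *m skew_mx (row _ _)); apply: val_inj.
    - by rewrite -[RHS]h1; congr (_ *m skew_mx (row _ _)); apply: val_inj.
  rewrite X'0 vertex_fold; apply/rowP => j; rewrite !mxE big1 // => i _.
  by rewrite !mxE; move: i; apply: ord4P; move: j; apply: ord4P; rewrite /= ?oppr0 mulr0.
have XX' : X = invmx B *m X' by rewrite mulKmx.
have /submxP[D XD] : (X <= W)%MS by rewrite XX' (submx_trans (submxMl _ _)).
apply/(plane_atP (multilinear_Psi5 K) g_unit (@separating_Psi5 K) A t0 c0 detW).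
have AE : A = D *m W *m g by rewrite -XD mulmxKV.
exists D => //; rewrite -row_free_unit; apply: inj_row_free => x xD.
by apply: (row_free_inj rA); rewrite mul0mx AE !mulmxA xD !mul0mx.
Qed.

Lemma cone_family : unique_P3_family q (family_forms (@Psi5 K) g).
Proof.
split.
  apply: (family_P3 (multilinear_Psi5 K) g_unit (@separating_Psi5 K)) => t t0.
  by have [W [c [c0 detW _ _]]] := cone_plane t0; exists W, c.
by move=> A; split; [apply: cone_plane_on_belongs | apply: cone_belongs_plane_on].
Qed.

Lemma cone_vertex_grad : grad q (vertex *m g) = 0.
Proof.
have : vertex *m cone_form = 0 by rewrite /cone_form !mulmxA vertex_fold !mul0mx.
rewrite grad_quadratic // -gq !mulmxA => /(congr1 (mulmx^~ (invmx g^T))).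
by rewrite mulmxK ?unitmx_tr // mul0mx.
Qed.

(** The cubic does not pass through the vertex, where [q] is singular. *)
Lemma prime_Fano_vertex f c : prime_Fano_genus4 q f -> c != 0 ->
  f.@[((c *: vertex) *m g) 0] != 0.
Proof.
case=> _ _ sm c0; apply/eqP => fv.
have v0 : (c *: vertex) *m g != 0.
  apply/eqP => /(congr1 (mulmx^~ (invmx g))); rewrite mulmxK // mul0mx.
  by move/matrixP/(_ 0 3%:R)/eqP; rewrite !mxE /= mulr1 (negPf c0).
have gv : grad q ((c *: vertex) *m g) = 0.
  rewrite grad_quadratic // -!scalemxAl -grad_quadratic // cone_vertex_grad.
  by rewrite scaler0.
have qv : q.@[((c *: vertex) *m g) 0] = 0.
  by apply/quadratic_eq0 => //; rewrite -grad_quadratic // gv mul0mx mxE.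
have := sm _ v0 qv fv; rewrite gv => /(row_free_row_neq0 (lshift 1 0))/eqP; apply.
by apply/rowP => j; rewrite mxE col_mxEu.
Qed.

Lemma cone_restrict_neq0 f A : prime_Fano_genus4 q f -> plane_on q A -> restrict f A != 0.
Proof.
move=> /(prime_Fano_vertex (c := 1))/(_ (oner_neq0 _)) fv [rA /(restrict_eq0 _ hq)/cone_isotropic isoX].
have /submxP[y yX] := vertex_sub_isotropic (row_free_mul_unit rA) isoX.
apply: contraNneq fv => fA; have := meval_restrict f A y.
by rewrite fA meval0 scale1r yX mulmxA mulmxKV // => <-.
Qed.

End Quadric.
End Cone.

(** * Normal forms of quadratic forms of rank six and five *)

Section NormalForms.
Variable K : numClosedFieldType.

Lemma congruent_same_rank n (H H' : 'M[K]_n) : H^T = H -> H'^T = H' ->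
  \rank H = \rank H' -> exists2 g, g \in unitmx & g *m H *m g^T = H'.
Proof.
move=> sH sH' rH; have [P Pu PH] := congruence_pid sH.
have [P' Pu' PH'] := congruence_pid sH'.
exists (invmx P' *m P); first by rewrite unitmx_mul unitmx_inv Pu'.
rewrite trmx_mul trmx_inv; apply: (can_inj (mulKmx Pu')).
apply: (can_inj (mulmxK (_ : P'^T \in unitmx))); rewrite ?unitmx_tr //.
rewrite PH' -rH -PH !mulmxA mulmxV // mul1mx mulmxKV ?unitmx_tr //.
Qed.

Lemma rank_hyperbolic : \rank (hyperbolic K) = 6%N.
Proof. exact/mxrank_unit/hyperbolic_unit. Qed.

Lemma cone_form_sym : (cone_form K)^T = cone_form K.
Proof. by rewrite /cone_form !trmx_mul trmxK hyperbolic_sym mulmxA. Qed.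

Lemma rank_cone_form : \rank (cone_form K) = 5%N.
Proof.
have kC : (kermx (cone_form K) == vertex K)%MS.
  apply/andP; split; last first.
    by apply/sub_kermxP; rewrite /cone_form !mulmxA vertex_fold !mul0mx.
  apply/row_subP => i.
  have : row i (kermx (cone_form K)) *m cone_form K = 0 by rewrite -row_mul mulmx_ker row0.
  move: (row i _) => x /rowP xC.
  have h0 : x 0 0 = 0.
    by have /eqP := xC 0; rewrite mul_cone_form mxE mulf_eq0 pnatr_eq0 => /eqP.
  have h1 : x 0 1 = 0 by have := xC 4%:R; rewrite mul_cone_form mxE.
  have h2 : x 0 2%:R = 0 by have := xC 5%:R; rewrite mul_cone_form mxE.
  have h4 : x 0 4%:R = 0 by have := xC 1; rewrite mul_cone_form mxE.
  have h5 : x 0 5%:R = 0 by have := xC 2%:R; rewrite mul_cone_form mxE.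
  rewrite (_ : x = x 0 3%:R *: vertex K) ?scalemx_sub //.
  by apply/rowP; apply: ord6P; rewrite [RHS]mxE [in RHS]mxE ?h0 ?h1 ?h2 ?h4 ?h5 /= ?mulr0 ?mulr1.
have : \rank (kermx (cone_form K)) = 1%N.
  rewrite (eqmxP kC) rank_rV (_ : vertex K != 0) //.
  by apply/eqP => /matrixP/(_ 0 3%:R)/eqP; rewrite !mxE /= oner_eq0.
rewrite mxrank_ker => h; have := rank_leq_row (cone_form K).
by move: h; case: (\rank _) => [|[|[|[|[|[|[|k]]]]]]].
Qed.

End NormalForms.

(** * Smoothness of the general plane cubic *)

Section GeneralCubic.
Variables (K : numClosedFieldType) (q f : {mpoly K[6]}) (g : 'M[K]_6).
Hypotheses (Fano : prime_Fano_genus4 q f) (g_unit : g \in unitmx).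

(** Smoothness in terms of proportionality of the differentials. *)
Lemma prime_Fano_grad (x : 'rV[K]_6) (l : K) :
  x != 0 -> q.@[x 0] = 0 -> f.@[x 0] = 0 -> grad f x <> l *: grad q x.
Proof.
case: Fano => _ _ sm x0 qx fx h.
have /row_free_inj := sm x x0 qx fx => /(_ 1%N (row_mx l%:M (- 1%:M)) 0).
rewrite mul0mx mul_row_col mul_scalar_mx mulNmx mul1mx h subrr => /(_ erefl).
move/(congr1 rsubmx); rewrite row_mxKr linear0 => /matrixP/(_ 0 0)/eqP.
by rewrite !mxE oppr_eq0 oner_eq0.
Qed.

(** The same in the coordinates where the quadratic form has matrix [H]. *)
Lemma prime_Fano_conormal (H : 'M[K]_6) (x : 'rV[K]_6) (l : K) :
  g *m hessian q *m g^T = H -> x != 0 -> (x *m H *m x^T) 0 0 = 0 ->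
  f.@[(x *m g) 0] = 0 -> g *m (grad f (x *m g))^T <> l *: (x *m H)^T.
Proof.
move=> gq x0 xH fx h; have [hq _ _] := Fano.
have xg0 : x *m g != 0.
  by apply: contraNneq x0 => xg; rewrite -(mulmxK g_unit x) xg mul0mx.
have qx : q.@[(x *m g) 0] = 0.
  by apply/quadratic_eq0 => //; rewrite -xH -gq trmx_mul !mulmxA.
apply: (prime_Fano_grad (l := l) xg0 qx fx).
have gTu : g^T \in unitmx by rewrite unitmx_tr.
have e : grad f (x *m g) *m g^T = l *: grad q (x *m g) *m g^T.
  have := congr1 trmx h; rewrite trmx_mul trmxK => ->; rewrite linearZ /= trmxK.
  by rewrite grad_quadratic // -scalemxAl -gq !mulmxA.
by rewrite -[LHS](mulmxK gTu) e mulmxK.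
Qed.

Variables (Psi : 'M[K]_4 -> 'cV[K]_6 -> 'cV[K]_6 -> 'cV[K]_6 -> K).
Hypotheses (PsiL : multilinear Psi) (Psi_sep : separating Psi).
Hypothesis planes_ok : forall A,
  belongs_to (family_forms Psi g) A -> plane_on q A /\ restrict f A != 0.

Lemma family_cuts_cubics : cuts_plane_cubics q f (family_forms Psi g).
Proof.
move=> t A t0 hA; have [|[rA qA] fA] := planes_ok (A := A); first by exists t.
split=> //; exists (restrict f A); apply: restrict_cuts_cubic => //.
by case: Fano.
Qed.

(* The matrix of polynomials W parameterizes the planes: its rows span the    *)
(* plane of parameter t wherever the polynomial c does not vanish. The        *)
(* hypothesis of submersivity says that the incidence variety of the points   *)
(* on the plane cubics is smooth there.                                       *)
Variables (W : 'M[{mpoly K[4]}]_(3, 6)) (c : {mpoly K[4]}).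
Local Notation Wt t := (map_mx (meval (t 0)) W).
Hypothesis c_neq0 : c != 0.
Hypothesis det_W : forall (t : 'rV[K]_4) u v w,
  det3 (Wt t *m u) (Wt t *m v) (Wt t *m w) = c.@[t 0] * Psi (t^T *m t) u v w.

Hypothesis submersive : forall (t : 'rV[K]_4) (y : 'rV[K]_3)
    (z := g *m (grad f (y *m Wt t *m g))^T),
  c.@[t 0] != 0 -> y != 0 -> f.@[(y *m Wt t *m g) 0] = 0 -> Wt t *m z = 0 ->
  ~ (forall i : 'I_4, y *m map_mx (fun p => p^`M(i).@[t 0]) W *m z = 0).

(** The point with coordinates [y] is a singular point of the cubic curve cut out
    on the plane of parameter [t]. *)
Let singular_at (t : 'rV[K]_4) (y : 'rV[K]_3) :=
  [/\ y != 0, f.@[(y *m Wt t *m g) 0] = 0 &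
      Wt t *m (g *m (grad f (y *m Wt t *m g))^T) = 0].

Lemma singular_not_dense : ~ dense (fun t => c.@[t 0] != 0 /\ exists y, singular_at t y).
Proof.
set S := (fun t => _) => dS.
have [y hy] : exists y, forall t, S t -> singular_at t (y t).
  suff /choice[y hy] : forall t, exists y, S t -> singular_at t y by exists y.
  move=> t; have [St|nSt] := pselect (S t); last by exists 0.
  by have [_ [y hy]] := St; exists y.
pose A := W *m map_mx (@mpolyC 4 K) g.
have At (t : 'rV[K]_4) : map_mx (meval (t 0)) A = Wt t *m g.
  rewrite map_mxM; congr (_ *m _); apply/matrixP => i j.
  by rewrite !mxE; exact: mevalC.
have dA (t : 'rV[K]_4) i : map_mx (fun p => p^`M(i).@[t 0]) A =
    map_mx (fun p => p^`M(i).@[t 0]) W *m g.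
  apply/matrixP => k l; rewrite !mxE (raddf_sum (mderiv i)) (raddf_sum (meval (t 0))).
  by apply: eq_bigr => j _ /=; rewrite !mxE mderivM mderivC mulr0 addr0 mevalM mevalC.
have sing t : S t -> f.@[(y t *m map_mx (meval (t 0)) A) 0] = 0 /\
    map_mx (meval (t 0)) A *m (grad f (y t *m map_mx (meval (t 0)) A))^T = 0.
  move=> St; have [_ f0 g0] := hy t St; rewrite At (mulmxA (y t)); split=> //.
  by rewrite -(mulmxA (Wt t)).
case: (generic_smoothness dS sing) => t St ht.
have [y0 f0 g0] := hy t St; have [ct _] := St.
apply: (submersive ct y0 f0 g0) => i; have := ht i.
by rewrite dA At (mulmxA (y t)) (mulmxA (y t)) -(mulmxA (y t *m _)).
Qed.

(** Otherwise the plane cubics would be singular for a dense set of parameters,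
    against generic smoothness. *)
Lemma family_general_smooth : general_cubic_smooth q f (family_forms Psi g).
Proof.
have [G G0 hG] : exists2 G : {mpoly K[4]}, G != 0 & forall t : 'rV[K]_4,
    G.@[t 0] != 0 -> c.@[t 0] != 0 -> forall y, ~ singular_at t y.
  apply: contrapT => h; apply: singular_not_dense => G G0; apply: contrapT => hG.
  apply: h; exists G => // t Gt ct y hy; apply: hG; exists t => //.
  by split=> //; exists y.
exists [:: G * c]; split.
  move=> H [t [_ Ht]].
  have H0 : H != 0 by apply: contraNneq Ht => ->; rewrite meval0.
  have X0 : 'X_(0 : 'I_4) != 0 :> {mpoly K[4]}.
    by rewrite -msupp_eq0 msuppX.
  have [x] := mpoly_nonzero_point (mulf_neq0 (mulf_neq0 H0 (mulf_neq0 G0 c_neq0)) X0).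
  rewrite !mevalM mevalXU !mulf_eq0 !negb_or => /andP[/andP[Hx Gcx] x0].
  exists x; split=> //.
    by apply: contraNneq x0 => ->; rewrite mxE.
  by rewrite /in_open /= mevalM mulf_eq0 negb_or Gcx.
move=> t t0; rewrite /in_open /= orbF mevalM mulf_eq0 negb_or => /andP[Gt ct] A hA.
have [|[rA qA] fA] := planes_ok (A := A); first by exists t.
split=> //; exists (restrict f A); split; first by apply: restrict_cuts_cubic => //; case: Fano.
have [B Bu AE] := (plane_atP PsiL g_unit Psi_sep A t0 ct (det_W t)).1 hA.
move=> y y0; rewrite meval_restrict grad_restrict => fy; apply/eqP => gy.
apply: (hG t Gt ct (y *m B)).
have xE : y *m B *m Wt t *m g = y *m A by rewrite AE !mulmxA.
split; rewrite ?xE //.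
  by apply: contraNneq y0 => yB; rewrite -(mulmxK Bu y) yB mul0mx.
apply: (can_inj (mulKmx Bu)); rewrite mulmx0 !mulmxA -AE.
by rewrite -[LHS]trmxK trmx_mul trmxK gy trmx0.
Qed.

End GeneralCubic.

(** * The plane cubics on a smooth quadric *)

Section RankSixCubics.
Variables (K : numClosedFieldType) (q f : {mpoly K[6]}) (g : 'M[K]_6).
Hypotheses (Fano : prime_Fano_genus4 q f) (g_unit : g \in unitmx).
Hypothesis gq : g *m hessian q *m g^T = hyperbolic K.
Local Notation J := (hyperbolic K).

(** A smooth threefold contains no plane of the quadric. If [f] vanished on the
    plane [A], then at the point [y *m A] the differential of [q] would be
    [y *m N] and that of [f] would be [r(y) *m N], with [r] a quadratic map and
    [N] a basis of the space of linear forms which vanish on [A]. An eigenvector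
    of [r] would then be a singular point of the threefold. *)
Lemma smooth_quadric_restrict_neq0 A : plane_on q A -> restrict f A != 0.
Proof.
case=> rA qA; apply/eqP => fA; have [hq hf _] := Fano.
have isoA := (restrict_eq0 A hq).1 qA.
have Hu : hessian q \in unitmx.
  have : g *m hessian q *m g^T \in unitmx by rewrite gq hyperbolic_unit.
  by rewrite !unitmx_mul => /andP[/andP[]].
pose N := A *m hessian q.
have rN : row_free N by rewrite /row_free mxrankMfree ?row_free_unit.
have gradA (y : 'rV[K]_3) : grad f (y *m A) *m A^T = 0.
  by rewrite -grad_restrict fA; apply/rowP => j; rewrite !mxE mderiv0 meval0.
have sN : (N <= kermx A^T)%MS by apply/sub_kermxP.
have eN : (N == kermx A^T)%MS.
  by rewrite -mxrank_leqif_eq // mxrank_ker mxrank_tr (eqP rA) (eqP rN).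
have gradN (y : 'rV[K]_3) : grad f (y *m A) = grad f (y *m A) *m pinvmx N *m N.
  by rewrite mulmxKpV // (eqmxP eN); apply/sub_kermxP.
pose Q j : 'M[K]_3 := \sum_k (2%:R^-1 * pinvmx N k j) *: (A *m hessian f^`M(k) *m A^T).
have [y y0 [l yQ]] := exists_eigenvector Q.
have rE : grad f (y *m A) *m pinvmx N = l *: y.
  rewrite -yQ; apply/rowP => j; rewrite mxE [RHS]mxE /Q mulmx_sumr mulmx_suml summxE.
  apply: eq_bigr => k _; rewrite -scalemxAr -scalemxAl [RHS]mxE [grad f _ _ _]mxE.
  have -> : y *m (A *m hessian f^`M(k) *m A^T) *m y^T =
      (y *m A) *m hessian f^`M(k) *m (y *m A)^T by rewrite trmx_mul !mulmxA.
  rewrite -[X in _ = _ * X]quadraticE; last exact: dhomog_deriv.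
  by rewrite mulrAC mulrA mulVf ?mul1r ?two_neq0.
have yA0 : y *m A != 0.
  by apply: contraNneq y0 => yA; apply/eqP/(row_free_inj rA); rewrite mul0mx yA.
apply: (prime_Fano_grad Fano (l := l) yA0); last first.
- by rewrite gradN rE -scalemxAl grad_quadratic // mulmxA.
- by rewrite -meval_restrict fA meval0.
by rewrite -meval_restrict qA meval0.
Qed.

(** The bivectors [t ^ e_1, t ^ e_2, t ^ e_3], with polynomial entries; they span
    the plane of parameter [t] where [t_0 != 0]. *)
Definition wedge_chart : 'M[{mpoly K[4]}]_(3, 6) := row' 0 (wedge_mx (fun i => 'X_i)).

Lemma wedge_chart_eval (t : 'rV[K]_4) :
  map_mx (meval (t 0)) wedge_chart = row' 0 (wedge_mx (t 0)).
Proof.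
apply/matrixP => i j; rewrite !mxE.
by move: i; apply: ord3P; move: j; apply: ord6P;
  rewrite /= ?mevalN ?mevalXU ?meval0.
Qed.

Lemma wedge_chart_deriv (t : 'rV[K]_4) k :
  map_mx (fun p => p^`M(k).@[t 0]) wedge_chart =
  row' 0 (wedge_mx (fun i => (k == i)%:R)).
Proof.
apply/matrixP => i j; rewrite !mxE.
by move: i; apply: ord3P; move: j; apply: ord6P;
  rewrite /= ?mderivN ?mderivXU ?mderiv0 ?mevalN ?meval0 ?rmorph_nat.
Qed.

(** The derivatives of [y *m W t] with respect to [t] and [y] span the tangent
    space of the quadric at the point [x = y *m W t], so that a covector [z]
    which kills them all is proportional to the differential of [q] at [x],
    against smoothness of the threefold. *)
Lemma wedge_chart_submersive (t : 'rV[K]_4) (y : 'rV[K]_3)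
    (z := g *m (grad f (y *m map_mx (meval (t 0)) wedge_chart *m g))^T) :
  ('X_0 : {mpoly K[4]}).@[t 0] != 0 -> y != 0 ->
  f.@[(y *m map_mx (meval (t 0)) wedge_chart *m g) 0] = 0 ->
  map_mx (meval (t 0)) wedge_chart *m z = 0 ->
  ~ (forall i : 'I_4, y *m map_mx (fun p => p^`M(i).@[t 0]) wedge_chart *m z = 0).
Proof.
rewrite mevalXU {}/z wedge_chart_eval; set W := row' 0 _; set x := y *m W.
set z := g *m _ => t0 y0 fx Wz dz.
have xE (k : 'I_6) : x 0 k = nth 0 [:: t 0 0 * y 0 0; t 0 0 * y 0 1; t 0 0 * y 0 2%:R;
    t 0 2%:R * y 0 2%:R - t 0 3%:R * y 0 1; t 0 3%:R * y 0 0 - t 0 1 * y 0 2%:R;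
    t 0 1 * y 0 1 - t 0 2%:R * y 0 0] k.
  rewrite mxE sum3 !mxE; move: k; apply: ord6P; rewrite /=; ring.
have x0 : x != 0.
  apply: contraNneq y0 => /rowP xz; apply/eqP/rowP; apply: ord3P; rewrite [RHS]mxE;
    apply: (mulfI t0); rewrite mulr0.
  - by have := xz 0; rewrite xE mxE.
  - by have := xz 1; rewrite xE mxE.
  - by have := xz 2%:R; rewrite xE mxE.
have xx : (x *m J *m x^T) 0 0 = 0.
  by rewrite hyperbolic_formE !xE /=; ring.
have zx l : z <> l *: (x *m J)^T := prime_Fano_conormal Fano g_unit gq x0 xx fx (l := l).
clearbody z; clear fx.
have W0 k : \sum_l W k l * z l 0 = 0.
  by have /matrixP/(_ k 0) := Wz; rewrite mxE [RHS]mxE.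
have dz' i : \sum_k y 0 k * (\sum_l wedge_mx (fun j => (i == j)%:R) (lift 0 k) l * z l 0) = 0.
  have /matrixP/(_ 0 0) := dz i; rewrite wedge_chart_deriv -mulmxA => h.
  transitivity ((0 : 'M[K]_1) 0 0); last by rewrite mxE.
  rewrite -h mxE; by apply: eq_bigr => k _; rewrite [in RHS]mxE; congr (_ * _); apply: eq_bigr => l _;
    rewrite [in RHS]mxE.
have := W0 0; have := W0 1; have := W0 2%:R.
rewrite !sum6 !mxE /= => w2 w1 w0.
have := dz' 1; have := dz' 2%:R; have := dz' 3%:R.
rewrite !sum3 !sum6 !mxE /= => d3 d2 d1.
move: W0 dz' => _ _.
have {}d1 : y 0 1 * z 5%:R 0 = y 0 2%:R * z 4%:R 0.
  by apply/eqP; rewrite -subr_eq0 -[X in _ == X]d1; apply/eqP; ring.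
have {}d2 : y 0 2%:R * z 3%:R 0 = y 0 0 * z 5%:R 0.
  by apply/eqP; rewrite -subr_eq0 -[X in _ == X]d2; apply/eqP; ring.
have {}d3 : y 0 0 * z 4%:R 0 = y 0 1 * z 3%:R 0.
  by apply/eqP; rewrite -subr_eq0 -[X in _ == X]d3; apply/eqP; ring.
have [m [m0 m1 m2]] : exists m, [/\ z 3%:R 0 = m * y 0 0, z 4%:R 0 = m * y 0 1
    & z 5%:R 0 = m * y 0 2%:R].
  have [k yk] := rV0Pn _ y0; move: k yk; apply: ord3P => yk.
  - by exists (z 3%:R 0 / y 0 0); split; apply: (mulfI yk); rewrite ?d3 -?d2; field.
  - by exists (z 4%:R 0 / y 0 1); split; apply: (mulfI yk); rewrite -?d3 ?d1; field.
  - by exists (z 5%:R 0 / y 0 2%:R); split; apply: (mulfI yk); rewrite ?d2 -?d1; field.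
apply: (zx (m / t 0 0)); apply/colP => k; rewrite mxE [_^T _ _]mxE hyperbolic_nth !xE.
have [{}w0 {}w1 {}w2] : [/\ t 0 0 * z 0 0 = m * (t 0 2%:R * y 0 2%:R - t 0 3%:R * y 0 1),
    t 0 0 * z 1 0 = m * (t 0 3%:R * y 0 0 - t 0 1 * y 0 2%:R) &
    t 0 0 * z 2%:R 0 = m * (t 0 1 * y 0 1 - t 0 2%:R * y 0 0)].
  split; apply/eqP; rewrite -subr_eq0.
  - by rewrite -[X in _ == X]w0 m1 m2; apply/eqP; ring.
  - by rewrite -[X in _ == X]w1 m0 m2; apply/eqP; ring.
  - by rewrite -[X in _ == X]w2 m0 m1; apply/eqP; ring.
move: k; apply: ord6P; rewrite /= ?m0 ?m1 ?m2.
- by apply: (mulfI t0); rewrite w0; field.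
- by apply: (mulfI t0); rewrite w1; field.
- by apply: (mulfI t0); rewrite w2; field.
- by field.
- by field.
- by field.
Qed.

End RankSixCubics.

(** * The plane cubics on a quadric cone *)

Section RankFiveCubics.
Variables (K : numClosedFieldType) (q f : {mpoly K[6]}) (g : 'M[K]_6).
Hypotheses (Fano : prime_Fano_genus4 q f) (g_unit : g \in unitmx).
Hypothesis gq : g *m hessian q *m g^T = cone_form K.

(** The vertex and the projections of two points spanning the line cut out by
    [a0 = b0] on the plane of parameter [t] of the smooth quadric, for
    [t_0 != 0]. *)
Definition cone_rows (R : comNzRingType) (t : 'I_4 -> R) : 'M[R]_(3, 6) :=
  \matrix_(i, j) nth 0 (nth [::]
    [:: [:: 0; 0; 0; 1; 0; 0];
        [:: - (t 0 * t 3%:R); t 0 * t 0; 0; 0; - (t 3%:R * t 3%:R);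
            t 1 * t 0 + t 2%:R * t 3%:R];
        [:: t 0 * t 2%:R; 0; t 0 * t 0; 0; t 2%:R * t 3%:R - t 1 * t 0;
            - (t 2%:R * t 2%:R)]] i) j.

(** The same with the coordinates of [t] as indeterminates. *)
Definition cone_chart_poly : 'M[{mpoly K[4]}]_(3, 6) := cone_rows (fun i => 'X_i).

Lemma cone_chart_eval (t : 'rV[K]_4) :
  map_mx (meval (t 0)) cone_chart_poly = cone_rows (t 0).
Proof.
apply/matrixP => i j; rewrite !mxE.
by move: i; apply: ord3P; move: j; apply: ord6P;
  rewrite /= ?(mevalN, mevalD, mevalB, mevalM, mevalXU, meval0, meval1).
Qed.

(** The differential of [cone_rows] at [t], in the direction [v]. *)
Definition cone_rows_diff (t v : 'I_4 -> K) : 'M[K]_(3, 6) :=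
  \matrix_(i, j) nth 0 (nth [::]
    [:: [:: 0; 0; 0; 0; 0; 0];
        [:: - (v 0 * t 3%:R + t 0 * v 3%:R); v 0 * t 0 + t 0 * v 0; 0; 0;
            - (v 3%:R * t 3%:R + t 3%:R * v 3%:R);
            v 1 * t 0 + t 1 * v 0 + (v 2%:R * t 3%:R + t 2%:R * v 3%:R)];
        [:: v 0 * t 2%:R + t 0 * v 2%:R; 0; v 0 * t 0 + t 0 * v 0; 0;
            v 2%:R * t 3%:R + t 2%:R * v 3%:R - (v 1 * t 0 + t 1 * v 0);
            - (v 2%:R * t 2%:R + t 2%:R * v 2%:R)]] i) j.

Lemma cone_chart_deriv (t : 'rV[K]_4) k :
  map_mx (fun p => p^`M(k).@[t 0]) cone_chart_poly =
  cone_rows_diff (t 0) (fun i => (k == i)%:R).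
Proof.
apply/matrixP => i j; rewrite !mxE.
by move: i; apply: ord3P; move: j; apply: ord6P;
  rewrite /= ?(mderivN, mderivD, mderivB, mderivM, mderivXU, mderiv0, mderivC)
    -?mpolyC1 ?mderivC
    ?(mevalN, mevalD, mevalB, mevalM, mevalXU, meval0, meval1, rmorph_nat).
Qed.

Lemma det3_cone_rows (t : 'rV[K]_4) u v w :
  det3 (cone_rows (t 0) *m u) (cone_rows (t 0) *m v) (cone_rows (t 0) *m w) =
  ('X_0 * 'X_0).@[t 0] * Psi5 (t^T *m t) u v w.
Proof.
have dropE (z : 'cV[K]_6) : (drop_b0 K *m z)^~ 0 =
    (fun k => if k == 3%:R then 0 else z k 0).
  apply: funext => k; rewrite mxE sum6 !mxE; move: k; apply: ord6P; rewrite /=; ring.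
have hypE : (hyperplane K)^~ 0 = fun k => (k == 0)%:R - (k == 3%:R)%:R.
  by apply: funext => k; rewrite !mxE !andbT.
have SE j k : (t^T *m t) j k = t 0 j * t 0 k by rewrite mxE big_ord1 mxE.
rewrite mevalM mevalXU /Psi5 /Psi5_part /Psi6 hypE !dropE.
rewrite /psi6 /psi6_part /det_a /dot_ab /= !SE /det3 !mxE !sum6 !mxE /=.
ring.
Qed.

(** As for the smooth quadric, away from the vertex, which is not on the
    threefold. *)
Lemma cone_chart_submersive (t : 'rV[K]_4) (y : 'rV[K]_3)
    (z := g *m (grad f (y *m map_mx (meval (t 0)) cone_chart_poly *m g))^T) :
  ('X_0 * 'X_0 : {mpoly K[4]}).@[t 0] != 0 -> y != 0 ->
  f.@[(y *m map_mx (meval (t 0)) cone_chart_poly *m g) 0] = 0 ->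
  map_mx (meval (t 0)) cone_chart_poly *m z = 0 ->
  ~ (forall i : 'I_4, y *m map_mx (fun p => p^`M(i).@[t 0]) cone_chart_poly *m z = 0).
Proof.
rewrite mevalM mevalXU mulf_eq0 orbb {}/z cone_chart_eval.
set W := cone_rows (t 0); set x := y *m W.
set z := g *m _ => t0 y0 fx Wz dz; have [hq _ _] := Fano.
have xE (k : 'I_6) : x 0 k = nth 0
    [:: t 0 0 * (t 0 2%:R * y 0 2%:R - t 0 3%:R * y 0 1);
        t 0 0 ^+ 2 * y 0 1; t 0 0 ^+ 2 * y 0 2%:R; y 0 0;
        (t 0 2%:R * t 0 3%:R - t 0 1 * t 0 0) * y 0 2%:R - t 0 3%:R ^+ 2 * y 0 1;
        (t 0 1 * t 0 0 + t 0 2%:R * t 0 3%:R) * y 0 1 - t 0 2%:R ^+ 2 * y 0 2%:R] k.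
  rewrite mxE sum3 !mxE; move: k; apply: ord6P; rewrite /=; ring.
(* The point x is not the vertex, since f does not vanish there.              *)
have y12 : (y 0 1 != 0) || (y 0 2%:R != 0).
  rewrite -negb_and; apply/negP => /andP[/eqP y1 /eqP y2].
  have y00 : y 0 0 != 0.
    apply: contraNneq y0 => y00; apply/eqP/rowP.
    by apply: ord3P; rewrite mxE.
  have xv : x = y 0 0 *: vertex K.
    apply/rowP => k; rewrite xE y1 y2 !mxE; move: k; apply: ord6P; rewrite /=; ring.
  by have := prime_Fano_vertex hq gq g_unit Fano y00; rewrite -xv fx eqxx.
have x0 : x != 0.
  apply/eqP => /rowP xz; have t2 : t 0 0 ^+ 2 != 0 by rewrite expf_neq0.
  have y1 : y 0 1 = 0 by apply: (mulfI t2); have := xz 1; rewrite xE !mxE mulr0.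
  have y2 : y 0 2%:R = 0 by apply: (mulfI t2); have := xz 2%:R; rewrite xE !mxE mulr0.
  by move: y12; rewrite y1 y2 eqxx.
have xx : (x *m cone_form K *m x^T) 0 0 = 0.
  by rewrite mxE sum6 !mul_cone_form /= ![x^T _ _]mxE !xE /=; ring.
have zx l : z <> l *: (x *m cone_form K)^T := prime_Fano_conormal Fano g_unit gq x0 xx fx (l := l).
clearbody z; clear fx.
have W0 k : \sum_l W k l * z l 0 = 0.
  by have /matrixP/(_ k 0) := Wz; rewrite mxE [RHS]mxE.
have dz' i : \sum_k y 0 k * (\sum_l cone_rows_diff (t 0) (fun j => (i == j)%:R) k l * z l 0) = 0.
  have /matrixP/(_ 0 0) := dz i; rewrite cone_chart_deriv -mulmxA => h.
  transitivity ((0 : 'M[K]_1) 0 0); last by rewrite mxE.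
  by rewrite -h mxE; apply: eq_bigr => k _; rewrite [in RHS]mxE.
have := W0 0; have := W0 1; have := W0 2%:R.
rewrite !sum6 !mxE /= => w2 w1 w0.
have := dz' 1; have := dz' 2%:R; have := dz' 3%:R.
rewrite !sum3 !sum6 !mxE /= => d3 d2 d1.
move: W0 dz' => _ _.
have z3 : z 3%:R 0 = 0 by rewrite -[RHS]w0; ring.
have {}d1 : y 0 1 * z 5%:R 0 = y 0 2%:R * z 4%:R 0.
  apply: (mulfI t0); apply/eqP; rewrite -subr_eq0 -[X in _ == X]d1.
  by apply/eqP; ring.
have [m [m1 m2]] : exists m, z 4%:R 0 = m * y 0 1 /\ z 5%:R 0 = m * y 0 2%:R.
  case/orP: y12 => yk.
  - by exists (z 4%:R 0 / y 0 1); split; apply: (mulfI yk); rewrite ?d1; field.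
  - by exists (z 5%:R 0 / y 0 2%:R); split; apply: (mulfI yk); rewrite -?d1; field.
have z0 : t 0 0 * z 0 0 = 2%:R * m * (t 0 2%:R * y 0 2%:R - t 0 3%:R * y 0 1).
  case/orP: y12 => yk; apply: (mulfI yk); apply/eqP; rewrite -subr_eq0.
  - apply/eqP; transitivity (- (0 : K)); last by rewrite oppr0.
    by rewrite -[in RHS]d3 m1 m2; ring.
  - by rewrite -[X in _ == X]d2 m1 m2; apply/eqP; ring.
apply: (zx (m / t 0 0 ^+ 2)); apply/colP => k.
rewrite mxE [_^T _ _]mxE mul_cone_form !xE.
have t2 : t 0 0 ^+ 2 != 0 by rewrite expf_neq0.
have {}w1 : t 0 0 ^+ 2 * z 1 0 = m * x 0 4%:R.
  apply/eqP; rewrite -subr_eq0 -[X in _ == X]w1 xE m1 m2 /=; apply/eqP.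
  rewrite -[t 0 0 * t 0 3%:R]mulrC mulNr -[_ * _ * z 0 0]mulrA z0; ring.
have {}w2 : t 0 0 ^+ 2 * z 2%:R 0 = m * x 0 5%:R.
  apply/eqP; rewrite -subr_eq0 -[X in _ == X]w2 xE m1 m2 /=; apply/eqP.
  rewrite -[t 0 0 * t 0 2%:R]mulrC -[_ * _ * z 0 0]mulrA z0; ring.
move: k; apply: ord6P; rewrite /= ?m1 ?m2 ?z3.
- by apply: (mulfI t0); rewrite z0; field.
- by apply: (mulfI t2); rewrite w1 xE /=; field.
- by apply: (mulfI t2); rewrite w2 xE /=; field.
- by rewrite mulr0.
- by field.
- by field.
Qed.

End RankFiveCubics.

(** * The families of plane cubics in rank six and in rank five *)

Section FamiliesOfCubics.
Variable K : numClosedFieldType.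
Variables q f : {mpoly K[6]}.
Hypothesis Fano : prime_Fano_genus4 q f.

Lemma rank_six_families : quadric_rank q = 6%N ->
  exists Phi1 Phi2 : pluecker_forms K,
    [/\ two_P3_families q Phi1 Phi2, cuts_plane_cubics q f Phi1,
        cuts_plane_cubics q f Phi2 &
        general_cubic_smooth q f Phi1 /\ general_cubic_smooth q f Phi2].
Proof.
move=> rq; have [hq _ _] := Fano.
have [|g gu gq] := congruent_same_rank (hessian_sym q) (hyperbolic_sym K).
  by rewrite rank_hyperbolic.
have gu' : hyperbolic K *m g \in unitmx by rewrite unitmx_mul hyperbolic_unit.
have gq' := swap_congruence gq.
have ok g0 (g0u : g0 \in unitmx) (g0q : g0 *m hessian q *m g0^T = hyperbolic K) A :
    belongs_to (family_forms (@Psi6 K) g0) A -> plane_on q A /\ restrict f A != 0.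
  move=> /(belongs_plane_on hq g0q g0u) hA; split=> //.
  exact: smooth_quadric_restrict_neq0 Fano g0q A hA.
have smooth g0 (g0u : g0 \in unitmx) (g0q : g0 *m hessian q *m g0^T = hyperbolic K) :
    general_cubic_smooth q f (family_forms (@Psi6 K) g0).
  apply: (family_general_smooth Fano g0u (multilinear_Psi6 K) (@separating_Psi6 K)
    (ok _ g0u g0q) (W := wedge_chart K) (c := 'X_0)).
  - by rewrite -msupp_eq0 msuppX.
  - move=> t u v w; rewrite wedge_chart_eval det3_wedge expr0 mul1r mevalXU //.
  - by move=> t y; apply: (wedge_chart_submersive Fano g0u g0q).
exists (family_forms (@Psi6 K) g), (family_forms (@Psi6 K) (hyperbolic K *m g)).
split.
- exact: smooth_quadric_families.
- exact (family_cuts_cubics Fano (ok _ gu gq)).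
- exact (family_cuts_cubics Fano (ok _ gu' gq')).
- by split; apply: smooth.
Qed.

Lemma rank_five_family : quadric_rank q = 5%N ->
  exists Phi : pluecker_forms K,
    [/\ unique_P3_family q Phi, cuts_plane_cubics q f Phi &
        general_cubic_smooth q f Phi].
Proof.
move=> rq; have [hq _ _] := Fano.
have [|g gu gq] := congruent_same_rank (hessian_sym q) (cone_form_sym K).
  by rewrite rank_cone_form.
have ok A : belongs_to (family_forms (@Psi5 K) g) A -> plane_on q A /\ restrict f A != 0.
  move=> /(cone_belongs_plane_on hq gq gu) hA; split=> //.
  exact: (cone_restrict_neq0 hq gq gu Fano hA).
exists (family_forms (@Psi5 K) g); split.
- exact: cone_family.
- exact (family_cuts_cubics Fano ok).
apply: (family_general_smooth Fano gu (multilinear_Psi5 K) (@separating_Psi5 K) ok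
  (W := cone_chart_poly K) (c := 'X_0 * 'X_0)).
- by rewrite mulf_neq0 // -msupp_eq0 msuppX.
- by move=> t u v w; rewrite cone_chart_eval det3_cone_rows.
- by move=> t y; apply: (cone_chart_submersive Fano gu gq).
Qed.

End FamiliesOfCubics.

(** Generality of the threefold imposes no condition: the constant polynomial one
    defines the whole parameter space as an open set. *)
Lemma dense_open_full (K : numClosedFieldType) (T : Type) (N : nat)
    (coord : T -> 'I_N -> K) (L : T -> Prop) : dense_open coord L [:: 1].
Proof.
by move=> H [x [Lx Hx]]; exists x; split=> //; rewrite /in_open /= meval1 oner_neq0.
Qed.

Theorem mainTheorem2 (R : realType) :
  (exists U : seq {mpoly R[i][#|coef_index|]},
     dense_open (@coefs _) (@Fano_of_rank _ 6) U /\
     forall q f : {mpoly R[i][6]},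
       prime_Fano_genus4 q f -> quadric_rank q = 6%N ->
       exists Phi1 Phi2 : pluecker_forms _,
         [/\ two_P3_families q Phi1 Phi2,
             cuts_plane_cubics q f Phi1,
             cuts_plane_cubics q f Phi2 &
             in_open U (coefs (q, f)) ->
             general_cubic_smooth q f Phi1 /\ general_cubic_smooth q f Phi2])
  /\
  (exists U : seq {mpoly R[i][#|coef_index|]},
     dense_open (@coefs _) (@Fano_of_rank _ 5) U /\
     forall q f : {mpoly R[i][6]},
       prime_Fano_genus4 q f -> quadric_rank q = 5%N ->
       exists Phi : pluecker_forms _,
         [/\ unique_P3_family q Phi,
             cuts_plane_cubics q f Phi &
             in_open U (coefs (q, f)) -> general_cubic_smooth q f Phi]).
Proof.
split; (exists [:: 1]; split; first exact: dense_open_full) => q f Fano rq.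
  have [Phi1 [Phi2 [h1 h2 h3 h4]]] := rank_six_families Fano rq.
  by exists Phi1, Phi2; split.
have [Phi [h1 h2 h3]] := rank_five_family Fano rq.
by exists Phi; split.
Qed.
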